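(* Let $G$ be the connected, simply connected nilpotent 6-dimensional Lie group with a basis $e_1,\dots,e_6$ of left-invariant 1-forms satisfying $$de_2=de_3=de_6=0,\quad de_1=e_3\wedge e_6,\quad de_4=e_2\wedge e_6,\quad de_5=e_2\wedge e_3,$$ with the left-invariant metric $g=\sum_{i=1}^6e_i^2$ and the left-invariant $SU(3)$-structure $(F,\Psi)$ given in this coframe by $F=-e_{12}-e_{34}-e_{56}$, $\Psi^+=-e_{135}+e_{236}+e_{146}+e_{245}$, $\Psi^-=-e_{136}-e_{145}-e_{235}+e_{246}$. Let $\nabla$ be its $SU(3)$-connection with torsion 3-form, and let $Nil^6=G/\Gamma$ be the compact quotient by a uniform discrete subgroup $\Gamma$, with the induced structure. The almost Hermitian 6-manifold $(G,g,F,\Psi,A=\nabla)$, which is not conformally flat, solves the gravitino and gaugino equations and satisfies the Bianchi identities (B1), (B2) with positive $\alpha'$. Consequently: (a) The product $(G\times\mathbb R,\ \omega,\ A=\nabla^7)$ with the $G_2$-structure $\omega=-F\wedge e_7-\Psi^+$ solves all the supersymmetry equations (gravitino, dilatino, gaugino) with non-zero flux and non-constant dilaton and satisfies (B1), (B2). Therefore it solves the equations of motion in dimension 7. The product $(Nil^6\times S^1,\omega,A=\nabla^7)$ is a compact space solving locally the supersymmetry equations and satisfying (B1), (B2) in dimension 7. (b) The product $(Nil^6\times\mathbb R\times\mathbb R,\ \Phi,\ A=\nabla^8)$ with the $Spin(7)$-structure $\Phi=e_0\wedge\omega+{*^7\omega}$ solves the supersymmetry equations with non-zero flux and non-constant dilaton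 and satisfies (B1), (B2). Therefore it solves the equations of motion in dimension 8. The product $(Nil^6\times S^1\times S^1,\Phi,A=\nabla^8)$ is a compact space solving locally the supersymmetry equations and satisfying (B1), (B2) in dimension 8.
   Context: $e_{ij\dots}=e_i\wedge e_j\wedge\cdots$; $e_7$ and $e_0$ are the standard 1-forms on the first and second $\mathbb R$ (or $S^1$) factor; forms on factors are pulled back. A uniform discrete subgroup $\Gamma$ of $G$ exists by Malcev's theorem; the left-invariant forms descend to the quotient. **Dimension 6.** $J$ is the almost complex structure with $F=g(\cdot,J\cdot)$; $\Psi=\Psi^++\sqrt{-1}\Psi^-$; orientation $e_{123456}$. An $SU(3)$-connection with torsion 3-form is $\nabla=\nabla^g+\frac12T$ (i.e. $g(\nabla_XY,Z)=g(\nabla^g_XY,Z)+\frac12T(X,Y,Z)$), $T$ a 3-form, with $\nabla g=\nabla J=\nabla\Psi=0$; it is unique, and it exists for the structure above. **Dimension 7.** A $G_2$-structure is a 3-form locally equal to $\omega=e_{127}-e_{236}+e_{347}+e_{567}-e_{146}-e_{245}+e_{135}$ in an oriented orthonormal coframe (fixing metric, orientation $e_{1\dots7}$ and Hodge star $*^7$). Lee form $\theta^7=-\frac13{*^7({*^7d\omega}\wedge\omega)}$. $\nabla^7=\nabla^g+\frac12T^7$ is the unique connection with torsion 3-form and $\nabla^7\omega=0$ (exists iff $d{*^7\omega}=\theta^7\wedge{*^7\omega}$). Dilaton: $2d\phi=\theta^7$. **Dimension 8.** A $Spin(7)$-structure is a 4-form locally of the form $e_0\wedge\omega+{*^7\omega}$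 in an oriented orthonormal coframe $e_0,\dots,e_7$. Lee form $\theta^8=-\frac17{*({*d\Phi}\wedge\Phi)}$. $\nabla^8=\nabla^g+\frac12T^8$ is the unique connection with torsion 3-form and $\nabla^8\Phi=0$. Dilaton: $\theta^8=\frac{12}7d\phi$. **Supersymmetry equations** (flux $H=T$, dilaton $\phi$, gauge connection $A$ with curvature $F^A$, Clifford relation $e_me_n+e_ne_m=-2\delta_{mn}$, $\varepsilon$ the nowhere zero spinor defining the structure): gravitino $\nabla^g_m\varepsilon+\frac18H_{mnp}e_ne_p\varepsilon=0$; dilatino $(\partial_m\phi\,e_m+\frac1{12}H_{mnp}e_me_ne_p)\varepsilon=0$; gaugino $F^A_{mn}e_me_n\varepsilon=0$ (the 2-form part of $F^A$ lies in $su(3)$, $g_2$, $spin(7)$ respectively). ''Solving locally'' means that the Lee form is closed, so that $\phi$ is only a locally defined function. **Bianchi identities**, with $\tilde\nabla=\nabla^g-\frac12T$ and $T$ the torsion of $\nabla$: (B1) $dT=2\alpha'\,\mathrm{Tr}(F^A\wedge F^A)$; (B2) $dT=2\alpha'\big(\mathrm{Tr}(F^A\wedge F^A)-\mathrm{Tr}(R^{\tilde\nabla}\wedge R^{\tilde\nabla})\big)$. For a metric connection with curvature 2-forms $\Omega_{ab}=g(R(\cdot,\cdot)e_a,e_b)$, $\mathrm{Tr}(R\wedge R)=\sum_{a<b}\Omega_{ab}\wedge\Omega_{ab}$. ''Satisfies with positive $\alpha'$'' means that (B1) holds for some constant $\alpha'>0$ and (B2) holds for some constant $\alpha'>0$ (possibly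 a different one); equivalently, for a prescribed $\alpha'>0$ each identity is achieved after a constant homothetic rescaling of the structure. **Equations of motion** (for $H=T$, $A=\nabla$, and the constant $\alpha'$ of (B1)): $\mathrm{Ric}_{mn}-\frac14H_{mpq}H_n{}^{pq}+2\nabla^g_m\nabla^g_n\phi+2\alpha'\,\mathrm{Tr}(F^A_{mp}F^A_n{}^p)=0$; $\nabla^{g,m}(e^{-2\phi}H_{mnp})=0$; $D^m(e^{-2\phi}F^A_{mn})+\frac12e^{-2\phi}H_{npq}F^{A\,pq}=0$ ($D$ = Levi-Civita on form indices coupled to $A$); $s^g+4\,\mathrm{div}\,\mathrm{grad}\,\phi-4\|d\phi\|^2-\frac1{12}H_{mnp}H^{mnp}+\alpha'\,\mathrm{Tr}(F^A_{mn}F^{A\,mn})=0$, with $\mathrm{Tr}(F_{mp}F_{nq})=\sum_{a<b}(F_{mp})_{ab}(F_{nq})_{ab}$. *)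

(* Defs.v *)
From HB Require Import structures.
From mathcomp Require Import all_boot all_order all_algebra.
From mathcomp Require Import all_classical all_reals.
From mathcomp Require Import all_analysis.
From mathcomp Require Import ring lra.

Set Implicit Arguments.
Unset Strict Implicit.
Unset Printing Implicit Defensive.

Import Order.TTheory GRing.Theory Num.Theory.
Import numFieldNormedType.Exports.

Local Open Scope ring_scope.

(* All manifolds here are M = R^n with global coordinates, or quotients of such
   an M by a discrete group of left translations; they carry a global coframe
   e_0, ..., e_(n-1), and the metric is g = \sum_i e_i^2 with orientation
   e_0 /\ ... /\ e_(n-1).  All tensors are given by their components in that
   oriented orthonormal coframe and its dual frame E_0, ..., E_(n-1).
   A connected, simply connected nilpotent Lie group of dimension n is
   diffeomorphic to R^n (by exp), hence is a Lie group law on R^n. *)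

Section ExteriorAlgebra.
Variables (R : realType) (n : nat).
Implicit Types (I J K : {set 'I_n}) (i j k : 'I_n).

(* An element of the full exterior algebra: its coefficient on
   e_I = e_{i1} /\ ... /\ e_{ip}, where I = {i1 < ... < ip}. *)
Definition form : Type := {ffun {set 'I_n} -> R^o}.

Implicit Types a b : form.

(* e_J /\ e_K = (shuffle_sign J K) e_(J u K) for disjoint J and K *)
Definition shuffle_sign J K : R :=
  (-1) ^+ #|[pred p : 'I_n * 'I_n |
              [&& p.1 \in J, p.2 \in K & (p.2 < p.1)%N]]|.

Definition wedge a b : form :=
  [ffun I : {set 'I_n} => \sum_(J : {set 'I_n} | J \subset I)
     shuffle_sign J (I :\: J) * (a J * b (I :\: J))].

Definition form1 : form := [ffun I : {set 'I_n} => (#|I| == 0)%:R].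
Definition covec k : form := [ffun I : {set 'I_n} => (I == [set k]%SET)%:R].
Definition ewedge (s : seq 'I_n) : form :=
  foldr (fun k a => wedge (covec k) a) form1 s.

Definition contract k a : form :=
  [ffun I : {set 'I_n} =>
     if k \in I then 0 else shuffle_sign [set k]%SET I * a (k |: I)%SET].

(* a(E_i1, ..., E_ip) for s = [:: i1; ...; ip] *)
Definition comp a (s : seq 'I_n) : R :=
  foldl (fun b k => contract k b) a s finset.set0.

Definition is_form (p : nat) a : Prop := forall I, #|I| != p -> a I = 0.

Definition hodge a : form :=
  [ffun I => shuffle_sign (~: I)%SET I * a (~: I)%SET].

Definition two_form (B : 'I_n -> 'I_n -> R) : form :=
  \sum_(i < n) \sum_(j < n | (i < j)%N) B i j *: ewedge [:: i; j].

(* For A = (g(A E_j, E_k))_{jk} in so(n), - der A is the induced action of A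
   on forms, a derivation. *)
Definition der (A : 'I_n -> 'I_n -> R) a : form :=
  \sum_j \sum_k A j k *: wedge (covec j) (contract k a).

End ExteriorAlgebra.

(* e_{i1 i2 ...} with 1-based indices *)
Definition eb (R : realType) n (s : seq nat) : form R n.+1 :=
  ewedge R [seq inord i.-1 | i <- s].

Section Calculus.
Variables (R : realType) (n : nat).
Local Open Scope classical_set_scope.
Implicit Types (x v : 'rV[R]_n).

Fixpoint partials (s : seq 'I_n) (f : 'rV[R]_n -> R) : 'rV[R]_n -> R :=
  if s is i :: s' then fun x => 'D_(delta_mx 0 i) (partials s' f) x else f.

Definition smooth_on (U : set 'rV[R]_n) (f : 'rV[R]_n -> R) : Prop :=
  forall (s : seq 'I_n) x, U x -> differentiable (partials s f) x.

Definition smooth f := smooth_on setT f.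

Definition smooth_map m (f : 'rV[R]_n -> 'rV[R]_m) : Prop :=
  forall j, smooth (fun x => f x 0 j).

End Calculus.

Section Geometry.
Variables (R : realType) (n : nat).
Local Open Scope classical_set_scope.

Local Notation pt := 'rV[R]_n.

(* (e x) p k is the coordinate of the 1-form e_k on dx_p, so that
   (v *m e x) 0 k = e_k(v) for a tangent vector v at x. *)
Definition coframe := pt -> 'M[R]_n.
Implicit Types (e : coframe) (i j k : 'I_n) (x : pt).

Definition smooth_coframe e : Prop :=
  (forall p k, smooth (fun x => e x p k)) /\ (forall x, e x \in unitmx).

Definition frame e i x : pt := row i (invmx (e x)).

Definition fder e i (f : pt -> R) x : R := 'D_(frame e i x) f x.

(* d e_k (X, Y) = \sum_(p, q) (d_p e_k,q - d_q e_k,p) X_p Y_q *)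
Definition dcoframe e k i j x : R :=
  let X := frame e i x in let Y := frame e j x in
  'D_X (fun y => (Y *m e y) 0 k) x - 'D_Y (fun y => (X *m e y) 0 k) x.

Definition dcov e k x : form R n := two_form (fun i j => dcoframe e k i j x).

Definition form_field := pt -> form R n.
Implicit Types (w T : form_field).

Definition smooth_form w : Prop := forall I, smooth (fun x => w x I).

Definition fder_form e i w x : form R n :=
  [ffun I => fder e i (fun y => w y I) x].

(* The exterior derivative: d w = \sum_I (d w_I /\ e_I + w_I d e_I), where
   d e_I = \sum_k d e_k /\ (E_k contracted with e_I). *)
Definition dext e w x : form R n :=
  \sum_k (wedge (covec R k) (fder_form e k w x)
          + wedge (dcov e k x) (contract k (w x))).

Definition dfun e (f : pt -> R) x : form R n :=
  \sum_k fder e k f x *: covec R k.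

(* G i j k = g(nabla_{E_i} E_j, E_k) *)
Definition connection := 'I_n -> 'I_n -> 'I_n -> pt -> R.
Implicit Type G : connection.

(* g([E_i, E_j], E_k) *)
Definition bracket e i j k x : R := - dcoframe e k i j x.

(* Koszul's formula in an orthonormal frame *)
Definition levi_civita e : connection := fun i j k x =>
  (bracket e i j k x - bracket e j k i x + bracket e k i j x) / 2.

Definition metric_connection G : Prop :=
  forall i j k x, G i j k x + G i k j x = 0.

Definition torsion_free e G : Prop :=
  forall i j k x, G i j k x - G j i k x = bracket e i j k x.

Lemma bracketC e i j k x : bracket e i j k x = - bracket e j i k x.
Proof. by rewrite /bracket /dcoframe opprK opprB. Qed.

Lemma levi_civitaP e G :
  metric_connection G /\ torsion_free e G <-> G = levi_civita e.
Proof.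
split=> [[Gm Gt]|->].
  apply/funext => i; apply/funext => j; apply/funext => k; apply/funext => x.
  rewrite /levi_civita -(Gt i j k) -(Gt j k i) -(Gt k i j).
  have := Gm i j k x; have := Gm j k i x; have := Gm k i j x; lra.
split=> i j k x; rewrite /levi_civita.
  have := bracketC e i j k x; have := bracketC e i k j x.
  have := bracketC e j k i x; lra.
have := bracketC e i j k x; have := bracketC e j k i x.
have := bracketC e i k j x; lra.
Qed.

(* nabla = nabla^g + T/2 *)
Definition torsion_connection e T : connection := fun i j k x =>
  levi_civita e i j k x + comp (T x) [:: i; j; k] / 2.

(* nabla_{E_i} w, using nabla_{E_i} e_k = - \sum_j G i j k e_j *)
Definition cov_form e G i w x : form R n :=
  fder_form e i w x - der (fun j k => G i j k x) (w x).

Definition parallel e G w : Prop := forall i x, cov_form e G i w x = 0.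

(* For an endomorphism field J with J j k x = g(E_j, J E_k):
   nabla_{E_i} J = 0 *)
Definition parallel_endo e G (J : 'I_n -> 'I_n -> pt -> R) : Prop :=
  forall i j k x,
    fder e i (J j k) x
    + \sum_l (G i l j x * J l k x - G i k l x * J j l x) = 0.

(* R(E_i, E_j) = [nabla_i, nabla_j] - nabla_[E_i, E_j];
   curvature e G i j a b = g(R(E_i, E_j) E_a, E_b) *)
Definition curvature e G i j a b x : R :=
  fder e i (G j a b) x - fder e j (G i a b) x
  + \sum_c (G j a c x * G i c b x - G i a c x * G j c b x)
  - \sum_c bracket e i j c x * G c a b x.

(* Tr (R /\ R) *)
Definition trace_RR e G x : form R n :=
  \sum_(a < n) \sum_(b < n | (a < b)%N)
    let Om := two_form (fun i j => curvature e G i j a b x) in wedge Om Om.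

Definition ricci e i j x : R :=
  \sum_k curvature e (levi_civita e) k i j k x.

Definition scalar_curvature e x : R := \sum_i ricci e i i x.

Definition hessian e (f : pt -> R) i j x : R :=
  fder e i (fder e j f) x - \sum_k levi_civita e i j k x * fder e k f x.

(* e^f e_k is an orthonormal coframe for e^(2f) g *)
Definition rescale (f : pt -> R) e : coframe := fun x => expR (f x) *: e x.

Definition conformally_flat e : Prop :=
  forall x, exists U : set pt, exists f : pt -> R,
    [/\ open U, U x, smooth_on U f &
        forall y, U y -> forall i j a b,
          curvature (rescale f e) (levi_civita (rescale f e)) i j a b y = 0].

Definition bianchi1 e T G (alpha : R) : Prop :=
  forall x, dext e T x = (2 * alpha) *: trace_RR e G x.

Definition bianchi2 e T G (alpha : R) : Prop :=
  forall x, dext e T x = (2 * alpha) *: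
    (trace_RR e G x - trace_RR e (torsion_connection e (fun y => - T y)) x).

Section EquationsOfMotion.
(* flux H, gauge connection A on the tangent bundle, dilaton phi *)
Variables (e : coframe) (H : form_field) (A : connection) (phi : pt -> R).
Variable alpha : R.

Definition flux_comp i j k x : R := comp (H x) [:: i; j; k].

(* Tr (F_ij F_kl) *)
Definition trace_FF i j k l x : R :=
  \sum_(a < n) \sum_(b < n | (a < b)%N)
    curvature e A i j a b x * curvature e A k l a b x.

Definition einstein_equation : Prop := forall m q x,
  ricci e m q x - (\sum_k \sum_l flux_comp m k l x * flux_comp q k l x) / 4
  + 2 * hessian e phi m q x + 2 * alpha * (\sum_p trace_FF m p q p x) = 0.

Definition flux_equation : Prop := forall i j x,
  \sum_m comp (cov_form e (levi_civita e) m
                 (fun y => expR (- 2 * phi y) *: H y) x) [:: m; i; j] = 0.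

(* D_{E_m} B on components (B i j)_{ab} = g(B_ij E_a, E_b) of a 2-form with
   values in endomorphisms: Levi-Civita on i, j and A on a, b *)
Definition gauge_cov (B : 'I_n -> 'I_n -> 'I_n -> 'I_n -> pt -> R)
    m i j a b x : R :=
  fder e m (B i j a b) x
  - \sum_c (levi_civita e m i c x * B c j a b x
            + levi_civita e m j c x * B i c a b x)
  + \sum_c (B i j a c x * A m c b x - A m a c x * B i j c b x).

Definition gauge_equation : Prop := forall i a b x,
  \sum_m gauge_cov (fun k l c d y => expR (- 2 * phi y) * curvature e A k l c d y)
           m m i a b x
  + expR (- 2 * phi x) / 2
    * (\sum_p \sum_q flux_comp i p q x * curvature e A p q a b x) = 0.

Definition dilaton_equation : Prop := forall x,
  scalar_curvature e x + 4 * (\sum_m hessian e phi m m x)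
  - 4 * (\sum_m fder e m phi x ^+ 2)
  - (\sum_i \sum_j \sum_k flux_comp i j k x ^+ 2) / 12
  + alpha * (\sum_i \sum_j trace_FF i j i j x) = 0.

Definition equations_of_motion : Prop :=
  [/\ einstein_equation, flux_equation, gauge_equation & dilaton_equation].

End EquationsOfMotion.

Section Spinors.
(* Spinor fields are written in the trivialisation of the spinor bundle induced
   by the frame E_i; Clifford multiplication by e_i is the matrix gam i. *)
Variables (N : nat) (gam : 'I_n -> 'M[R]_N).

Definition clifford : Prop := forall i j,
  gam i *m gam j + gam j *m gam i = (if i == j then - 2 else 0)%:M.

(* \sum_(j, k) A_jk e_j e_k; A / 4 is the spin representation of so(n) *)
Definition clifford2 (A : 'I_n -> 'I_n -> R) : 'M[R]_N :=
  \sum_j \sum_k A j k *: (gam j *m gam k).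

Definition spinor_field := pt -> 'cV[R]_N.
Implicit Type eps : spinor_field.

Definition smooth_spinor eps : Prop := forall s, smooth (fun x => eps x s 0).

(* eps is a nowhere zero spinor whose isotropy algebra at each point is the Lie
   algebra of the structure group, i.e. the isotropy algebra of the forms in S. *)
Definition defines_structure (S : seq (form R n)) eps : Prop :=
  forall x, eps x != 0 /\
    forall A : 'I_n -> 'I_n -> R, (forall j k, A j k = - A k j) ->
      (clifford2 A *m eps x = 0 <-> forall a, a \in S -> der A a = 0).

Definition spin_cov e G i eps x : 'cV[R]_N :=
  \col_s fder e i (fun y => eps y s 0) x
  + 4^-1 *: (clifford2 (fun j k => G i j k x) *m eps x).

Definition gravitino e (H : form_field) eps : Prop := forall m x,
  spin_cov e (levi_civita e) m eps x
  + 8^-1 *: (clifford2 (fun p q => comp (H x) [:: m; p; q]) *m eps x) = 0.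

Definition dilatino_on (U : set pt) e (H : form_field) (phi : pt -> R) eps
    : Prop := forall x, U x ->
  (\sum_m fder e m phi x *: gam m
   + 12^-1 *: \sum_m \sum_p \sum_q
       comp (H x) [:: m; p; q] *: (gam m *m gam p *m gam q)) *m eps x = 0.

Definition gaugino e (A : connection) eps : Prop := forall a b x,
  clifford2 (fun p q => curvature e A p q a b x) *m eps x = 0.

End Spinors.

End Geometry.

Section Groups.
Variables (R : realType) (n : nat).
Local Open Scope classical_set_scope.
Local Notation pt := 'rV[R]_n.
Variables (mul : pt -> pt -> pt) (one : pt) (inv : pt -> pt).

Definition lie_group : Prop :=
  [/\ associative mul,
      left_id one mul /\ right_id one mul,
      left_inverse one inv mul /\ right_inverse one inv mul,
      smooth_map (fun z : 'rV[R]_(n + n) => mul (lsubmx z) (rsubmx z)) &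
      smooth_map inv].

(* The left translations by elements of L preserve the 1-forms e_k. *)
Definition translation_invariant (L : set pt) (e : coframe R n) : Prop :=
  forall l, L l -> forall x v,
    'D_v (mul l) x *m e (mul l x) = v *m e x.

(* With respect to a coframe invariant under L, an object on the quotient by L
   is an object on the group whose components satisfy this. *)
Definition invariant (L : set pt) (V : Type) (f : pt -> V) : Prop :=
  forall l, L l -> forall x, f (mul l x) = f x.

Definition discrete_subgroup (L : set pt) : Prop :=
  [/\ L one, forall x y, L x -> L y -> L (mul x y),
      forall x, L x -> L (inv x) &
      exists U : set pt, [/\ open U, U one & U `&` L `<=` [set one]]].

Definition orbit (L : set pt) (x : pt) : set pt := [set mul l x | l in L].

Definition same_orbit (L : set pt) : rel pt :=
  fun x y => `[< orbit L x = orbit L y >].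

Lemma same_orbit_equiv L : equiv_class_of (same_orbit L).
Proof.
split=> [x|x y|y x z]; first exact/asboolP.
  by apply/asboolP/asboolP.
by move=> /asboolP xy /asboolP yz; apply/asboolP; rewrite xy.
Qed.

Canonical same_orbit_rel L := EquivRelPack (same_orbit_equiv L).

(* the space L \ G of orbits of the left translations by L *)
Definition quotient_space (L : set pt) : topologicalType :=
  quotient_topology {eq_quot same_orbit L}%qT.

Definition uniform_lattice (L : set pt) : Prop :=
  discrete_subgroup L /\ compact [set: quotient_space L].

End Groups.

Section Products.
Variables (R : realType) (n : nat).
Local Open Scope classical_set_scope.
Local Notation pt := 'rV[R]_n.

Definition mul_right (mul : pt -> pt -> pt) (x y : 'rV[R]_(n + 1)) :
    'rV[R]_(n + 1) :=
  row_mx (mul (lsubmx x) (lsubmx y)) (rsubmx x + rsubmx y).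
Definition one_right (one : pt) : 'rV[R]_(n + 1) := row_mx one 0.
Definition inv_right (inv : pt -> pt) (x : 'rV[R]_(n + 1)) : 'rV[R]_(n + 1) :=
  row_mx (inv (lsubmx x)) (- rsubmx x).
Definition coframe_right (e : coframe R n) : coframe R (n + 1) :=
  fun x => block_mx (e (lsubmx x)) 0 0 1%:M.
Definition lattice_right (L : set pt) (Z : set R) : set 'rV[R]_(n + 1) :=
  [set x | L (lsubmx x) /\ Z (rsubmx x 0 0)].
Definition pull_right (a : form R n) : form R (n + 1) :=
  [ffun I => \sum_(J : {set 'I_n} | (lshift 1 @: J)%SET == I) a J].

Definition mul_left (mul : pt -> pt -> pt) (x y : 'rV[R]_(1 + n)) :
    'rV[R]_(1 + n) :=
  row_mx (lsubmx x + lsubmx y) (mul (rsubmx x) (rsubmx y)).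
Definition one_left (one : pt) : 'rV[R]_(1 + n) := row_mx 0 one.
Definition inv_left (inv : pt -> pt) (x : 'rV[R]_(1 + n)) : 'rV[R]_(1 + n) :=
  row_mx (- lsubmx x) (inv (rsubmx x)).
Definition coframe_left (e : coframe R n) : coframe R (1 + n) :=
  fun x => block_mx 1%:M 0 0 (e (rsubmx x)).
Definition lattice_left (Z : set R) (L : set pt) : set 'rV[R]_(1 + n) :=
  [set x | Z (lsubmx x 0 0) /\ L (rsubmx x)].
Definition pull_left (a : form R n) : form R (1 + n) :=
  [ffun I => \sum_(J : {set 'I_n} | (@rshift 1 n @: J)%SET == I) a J].

End Products.

(* R / (c Z): a circle of length c for c > 0 *)
Definition multiples (R : realType) (c : R) : set R :=
  [set t | exists k : int, t = k%:~R * c]%classic.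

Section Structures.
Variable R : realType.

Definition structure_equations (e : coframe R 6) : Prop := forall x,
  [/\ dcov e (inord 1) x = 0, dcov e (inord 2) x = 0 & dcov e (inord 5) x = 0]
  /\
  [/\ dcov e (inord 0) x = eb R 5 [:: 3; 6],
      dcov e (inord 3) x = eb R 5 [:: 2; 6] &
      dcov e (inord 4) x = eb R 5 [:: 2; 3]].

Local Notation e6 := (eb R 5).
Local Notation e7 := (eb R 6).

Definition F6 : form R 6 := - e6 [:: 1; 2] - e6 [:: 3; 4] - e6 [:: 5; 6].
Definition Psi_plus : form R 6 :=
  - e6 [:: 1; 3; 5] + e6 [:: 2; 3; 6] + e6 [:: 1; 4; 6] + e6 [:: 2; 4; 5].
Definition Psi_minus : form R 6 :=
  - e6 [:: 1; 3; 6] - e6 [:: 1; 4; 5] - e6 [:: 2; 3; 5] + e6 [:: 2; 4; 6].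

Definition G2_model : form R 7 :=
  e7 [:: 1; 2; 7] - e7 [:: 2; 3; 6] + e7 [:: 3; 4; 7] + e7 [:: 5; 6; 7]
  - e7 [:: 1; 4; 6] - e7 [:: 2; 4; 5] + e7 [:: 1; 3; 5].

Definition omega7 : form R 7 :=
  wedge (- pull_right F6) (e7 [:: 7]) - pull_right Psi_plus.

(* In dimension 8 the index of e_i is i. *)
Definition Phi8 : form R 8 :=
  wedge (covec R (ord0 : 'I_8)) (pull_left omega7)
  + pull_left (hodge omega7).

(* F = g(., J.), so F(E_j, E_k) = g(E_j, J E_k) *)
Definition SU3_torsion (e : coframe R 6) (T : form_field R 6) : Prop :=
  [/\ smooth_form T /\ (forall x, is_form 3 (T x)),
      metric_connection (torsion_connection e T),
      parallel_endo e (torsion_connection e T)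
        (fun j k _ => comp F6 [:: j; k]),
      parallel e (torsion_connection e T) (fun=> Psi_plus) &
      parallel e (torsion_connection e T) (fun=> Psi_minus)].

(* T is a torsion 3-form of a connection for which the constant-coefficient
   form a (the G2- or Spin(7)-form) is parallel. *)
Definition skew_torsion n (e : coframe R n) (a : form R n) (T : form_field R n)
    : Prop :=
  [/\ smooth_form T, forall x, is_form 3 (T x) &
      parallel e (torsion_connection e T) (fun=> a)].

Definition lee7 (e : coframe R 7) (a : form R 7) : form_field R 7 := fun x =>
  - 3^-1 *: hodge (wedge (hodge (dext e (fun=> a) x)) a).

Definition lee8 (e : coframe R 8) (a : form R 8) : form_field R 8 := fun x =>
  - 7^-1 *: hodge (wedge (hodge (dext e (fun=> a) x)) a).

End Structures.

Section Solutions.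
Variables (R : realType) (n N : nat).
Local Open Scope classical_set_scope.
Local Notation pt := 'rV[R]_n.
(* The space is the quotient by the left translations by L, with the coframe e,
   the structure given by the forms in S, flux H, and gauge connection
   A = nabla^g + H/2.  The dilaton is determined by c dphi = lee. *)
Variables (mul : pt -> pt -> pt) (one : pt) (inv : pt -> pt) (L : set pt).
Variables (e : coframe R n) (gam : 'I_n -> 'M[R]_N) (S : seq (form R n)).
Variables (H lee : form_field R n) (c : R).

Local Notation A := (torsion_connection e H).

Definition supersymmetric_spinor (eps : spinor_field R n N) : Prop :=
  [/\ smooth_spinor eps, invariant mul L eps, defines_structure gam S eps,
      gravitino gam e H eps & gaugino gam e A eps].

Definition descends : Prop :=
  translation_invariant mul L e /\ invariant mul L H.

Definition global_solution : Prop :=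
  discrete_subgroup mul one inv L /\ descends /\
  (exists x, H x != 0) /\
  (exists phi : pt -> R, exists eps : spinor_field R n N,
    [/\ smooth phi /\ invariant mul L phi,
        forall x, c *: dfun e phi x = lee x,
        exists x y, phi x != phi y,
        supersymmetric_spinor eps /\ dilatino_on gam setT e H phi eps &
        exists2 alpha : R, 0 < alpha &
          bianchi1 e H A alpha /\ equations_of_motion e H A phi alpha]) /\
  (exists2 alpha : R, 0 < alpha & bianchi2 e H A alpha).

Definition compact_local_solution : Prop :=
  uniform_lattice mul one inv L /\ descends /\
  (forall x, dext e lee x = 0) /\
  (exists eps : spinor_field R n N, supersymmetric_spinor eps /\
    forall x, exists U : set pt, exists phi : pt -> R,
      [/\ open U, U x, smooth_on U phi,
          forall y, U y -> c *: dfun e phi y = lee y &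
          dilatino_on gam U e H phi eps]) /\
  (exists2 alpha : R, 0 < alpha & bianchi1 e H A alpha) /\
  (exists2 alpha : R, 0 < alpha & bianchi2 e H A alpha).

End Solutions.

(* Main.v *)
From Stdlib Require Import ZArith NArith.
From mathcomp Require Import all_boot all_order all_algebra.
From mathcomp Require Import all_classical all_reals all_analysis.
From mathcomp Require Import ring lra zify ssrZ.
Require Import Defs.

(** The structure is left-invariant, so in the coframe e the forms d e_k, the
    Levi-Civita connection, the torsion and all curvatures have constant
    coefficients, rational with denominators dividing 4.  In each of the
    dimensions 6, 7 and 8 the torsion is
      T = e_136 - 2 e_145 + e_235 - e_246,
    and the Bianchi identities hold with alpha' = 1/4 for (B1) and 1/6 for (B2).
    The dilaton is phi = x_7 / 2, the Lee forms being e_7 and 6/7 e_7.  What has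
    to be shown is thus a finite list of identities between integers, except for
    the points discussed below.  Forms and Clifford elements with integer
    coefficients are represented by lists of (basis element, coefficient), the
    operations on them are implemented and proved correct, and each identity is
    then a closed boolean that evaluates to true.

    The Lie algebras su(3), g2 and spin(7) are cut out of so(6), so(7) and so(8)
    by seven linear equations.  By forms_isotropy and spin_isotropy a skew matrix
    acts on the structure forms and on the spinor only through the values of
    these seven equations, and by forms_indep and spin_indep the seven images are
    linearly independent.  Hence the spinor and the forms have the same isotropy
    algebra, and the gravitino and gaugino equations, as well as the parallelism
    of the forms, all say that the connection matrices and the curvature
    satisfy the seven equations (holonomyP, curvature_holonomyP).  The spinor is
    constant, Q v, where Q is a product of factors 1 + w or 1 - w with commuting
    Clifford words w of square 1; such a v exists in every representation because
    Q has nonzero trace (spinor_ex).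

    Two torsion forms differ by a three-form all of whose contractions satisfy
    the seven equations.  If Y denotes this linear system, a polynomial in the
    symmetric matrix Y^T Y times Y^T Y is a nonzero multiple of the identity, so
    the difference vanishes (three_form_eq0).

    For four distinct indices the curvature component R_ijkl is only multiplied
    by a positive function under a conformal change of the metric, whatever the
    conformal factor; here g(R(E_2, E_3) E_1, E_4) = -1/4, so the metric is not
    conformally flat (not_conformally_flat).

    A discrete subgroup is uniform as soon as every orbit meets a fixed box, and
    conversely for a group of continuous translations (cocompact_compact,
    compact_cocompact).  This property passes to products with circles. *)

Set Implicit Arguments.
Unset Strict Implicit.
Unset Printing Implicit Defensive.

Import Order.TTheory GRing.Theory Num.Theory.
Import numFieldNormedType.Exports.
Local Open Scope classical_set_scope.
Local Open Scope ring_scope.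
Delimit Scope Z_scope with ZZ.

(** * Integral linear combinations *)

Section Coefficients.
Variable R : realType.

(** The image in R of an integer. *)
Definition zr (z : Z) : R := (int_of_Z z)%:~R.

Lemma zrD x y : zr (x + y)%ZZ = zr x + zr y.
Proof. by rewrite /zr (rmorphD int_of_Z) rmorphD. Qed.
Lemma zrN x : zr (- x)%ZZ = - zr x.
Proof. by rewrite /zr (rmorphN int_of_Z) rmorphN. Qed.
Lemma zrB x y : zr (x - y)%ZZ = zr x - zr y.
Proof. by rewrite /Z.sub zrD zrN. Qed.
Lemma zrM x y : zr (x * y)%ZZ = zr x * zr y.
Proof. by rewrite /zr (rmorphM int_of_Z) rmorphM. Qed.
Lemma zr0 : zr 0%ZZ = 0. Proof. by []. Qed.
Lemma zr_eq0 x : (zr x == 0) = (x =? 0)%ZZ.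
Proof.
rewrite /zr intr_eq0; apply/eqP/Z.eqb_spec => [|->//].
exact: (can_inj int_of_ZK (x2 := 0%ZZ)).
Qed.

(** The sum of f 0, ..., f (n - 1). *)
Definition zsum (n : nat) (f : nat -> Z) : Z :=
  foldr (fun i s => (f i + s)%ZZ) 0%ZZ (iota 0 n).

Lemma zr_foldr (s : seq nat) f : zr (foldr (fun i s => (f i + s)%ZZ) 0%ZZ s) = \sum_(i <- s) zr (f i).
Proof. by elim: s => [|i s IH] /=; rewrite ?big_nil ?big_cons ?zrD ?IH. Qed.

Lemma zr_sum n (f : nat -> Z) : \sum_(i < n) zr (f i) = zr (zsum n f).
Proof.
by rewrite /zsum zr_foldr -(big_mkord xpredT (zr \o f)) /= /index_iota subn0.
Qed.

Section Lin.
Variables (K : eqType) (V : lmodType R).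
Implicit Types (b : K -> V) (l : seq (K * Z)).

(** The linear combination of the vectors b k given by a list of pairs
    (k, coefficient); a key may occur several times. *)
Definition lin b l : V := \sum_(t <- l) zr t.2 *: b t.1.

(** The total coefficient of the key k. *)
Definition coef (k : K) l : Z :=
  foldr (fun t c => if t.1 == k then (t.2 + c)%ZZ else c) 0%ZZ l.

Definition fscale (c : Z) l := [seq (t.1, (c * t.2)%ZZ) | t <- l].
(** All total coefficients vanish. *)
Definition fiszero l := all (fun t => (coef t.1 l =? 0)%ZZ) l.
Definition feq l l' := fiszero (l ++ fscale (-1) l').

Lemma lin_nil b : lin b [::] = 0. Proof. exact: big_nil. Qed.
Lemma lin_cons b t l : lin b (t :: l) = zr t.2 *: b t.1 + lin b l.
Proof. exact: big_cons. Qed.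
Lemma lin_seq1 b k c : lin b [:: (k, c)] = zr c *: b k.
Proof. exact: big_seq1. Qed.
Lemma lin_cat b l l' : lin b (l ++ l') = lin b l + lin b l'.
Proof. exact: big_cat. Qed.
Lemma lin_scale b c l : lin b (fscale c l) = zr c *: lin b l.
Proof.
rewrite /lin big_map scaler_sumr; apply: eq_bigr => t _.
by rewrite /= zrM scalerA.
Qed.

Lemma lin_coef b l : lin b l = \sum_(k <- undup (unzip1 l)) zr (coef k l) *: b k.
Proof.
suff H s : uniq s -> {subset unzip1 l <= s} ->
    lin b l = \sum_(k <- s) zr (coef k l) *: b k.
  by apply: H; [exact: undup_uniq | move=> k; rewrite mem_undup].
move=> us; elim: l => [|[k c] l IH] /= sub.
  by rewrite lin_nil big1 // => k _; rewrite scale0r.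
have ks : k \in s by apply: sub; rewrite mem_head.
rewrite lin_cons /= IH; last by move=> j jl; apply: sub; rewrite in_cons jl orbT.
rewrite !(bigD1_seq k ks us) /= eqxx zrD scalerDl addrA; congr (_ + _).
by apply: eq_bigr => j /negPf; rewrite eq_sym => ->.
Qed.

Lemma fiszeroP b l : fiszero l -> lin b l = 0.
Proof.
move=> /allP h; rewrite lin_coef big_seq big1 // => k.
rewrite mem_undup => /mapP[t tl ->]; have /Z.eqb_eq -> := h t tl.
by rewrite scale0r.
Qed.

Lemma feqP b l l' : feq l l' -> lin b l = lin b l'.
Proof.
move=> /(@fiszeroP b)/eqP; rewrite lin_cat lin_scale scaleN1r subr_eq0.
by move/eqP.
Qed.

Lemma lin_flatten b ls : lin b (flatten ls) = \sum_(l <- ls) lin b l.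
Proof.
by elim: ls => [|l ls IH]; rewrite ?lin_nil ?big_nil //= lin_cat big_cons IH.
Qed.

(** Normal form: one term per key, zero terms dropped. *)
Definition fnorm l :=
  foldr (fun k s => let c := coef k l in if (c =? 0)%ZZ then s else (k, c) :: s)
    [::] (undup (unzip1 l)).

Lemma lin_norm b l : lin b (fnorm l) = lin b l.
Proof.
rewrite (lin_coef b l) /fnorm; elim: (undup _) => [|k s IH] /=.
  by rewrite lin_nil big_nil.
rewrite big_cons -IH; case: Z.eqb_spec => [->|_]; last by rewrite lin_cons.
by rewrite scale0r add0r.
Qed.

End Lin.

(** Extends bilinearly an operation given on keys. *)
Definition fbilin (K K' K'' : eqType) (op : K -> K' -> seq (K'' * Z)) l l' :=
  flatten [seq flatten [seq fscale (s.2 * t.2) (op s.1 t.1) | t <- l'] | s <- l].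

Lemma lin_fbilin (K K' K'' : eqType) (V V' V'' : lmodType R)
    (b : K -> V) (b' : K' -> V') (b'' : K'' -> V'') (op : K -> K' -> seq (K'' * Z))
    (f : V -> V' -> V'') :
  (forall k k', f (b k) (b' k') = lin b'' (op k k')) ->
  (forall v, linear (f v)) -> (forall v', linear (f^~ v')) ->
  forall l l', f (lin b l) (lin b' l') = lin b'' (fbilin op l l').
Proof.
move=> opE fl fr l l'.
have f0r v : f v 0 = 0.
  by have := fl v (-1) 0 0; rewrite scaler0 addr0 scaleN1r addNr.
have f0l v : f 0 v = 0.
  by have := fr v (-1) 0 0; rewrite scaler0 addr0 scaleN1r addNr.
elim: l => [|[k c] l IH]; first by rewrite !lin_nil f0l.
rewrite lin_cons fr IH /fbilin /= lin_cat; congr (_ + _).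
elim: l' {IH} => [|[k' c'] l' IH']; first by rewrite !lin_nil f0r scaler0.
rewrite lin_cons fl scalerDr IH' /= lin_cat lin_scale opE zrM scalerA.
by [].
Qed.

(** Extends linearly an operation given on keys. *)
Definition flin (K K' : eqType) (op : K -> seq (K' * Z)) l :=
  flatten [seq fscale s.2 (op s.1) | s <- l].

Lemma lin_flin (K K' : eqType) (V V' : lmodType R)
    (b : K -> V) (b' : K' -> V') (op : K -> seq (K' * Z)) (f : V -> V') :
  (forall k, f (b k) = lin b' (op k)) -> linear f ->
  forall l, f (lin b l) = lin b' (flin op l).
Proof.
move=> opE fl l.
have f0 : f 0 = 0.
  by have := fl (-1) 0 0; rewrite scaler0 addr0 scaleN1r addNr.
elim: l => [|[k c] l IH]; first by rewrite !lin_nil f0.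
by rewrite lin_cons fl IH /flin /= lin_cat lin_scale opE.
Qed.

End Coefficients.

(** * Exterior algebra on basis forms *)

Section BasisForms.
Variables (R : realType) (n : nat).
Local Notation form := (form R n).
Implicit Types (S T I : {set 'I_n}) (a b : form).

Lemma wedge_linear_r a : linear (wedge a).
Proof.
move=> c b b'; apply/ffunP => I; rewrite !ffunE scaler_sumr -big_split /=.
apply: eq_bigr => J _; rewrite !ffunE /GRing.scale /=; ring.
Qed.

Lemma wedge_linear_l b : linear (fun a : form => wedge a b).
Proof.
move=> c a a'; apply/ffunP => I; rewrite !ffunE scaler_sumr -big_split /=.
apply: eq_bigr => J _; rewrite !ffunE /GRing.scale /=; ring.
Qed.

Lemma contract_linear k : linear (@contract R n k).
Proof.
move=> c b b'; apply/ffunP => I; rewrite !ffunE.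
case: ifP => _; first by rewrite scaler0 addr0.
by rewrite /GRing.scale /=; ring.
Qed.

Lemma hodge_linear : linear (@hodge R n).
Proof. by move=> c b b'; apply/ffunP => I; rewrite !ffunE /GRing.scale /=; ring. Qed.

(** e_S, with the factors in increasing order. *)
Definition basis_form S : form := [ffun I => (I == S)%:R].

Lemma wedge_basis S T : wedge (basis_form S) (basis_form T) =
  if [disjoint S & T] then shuffle_sign R S T *: basis_form (S :|: T)%SET else 0.
Proof.
apply/ffunP => I; rewrite !ffunE.
have -> : \sum_(J : {set 'I_n} | J \subset I)
    shuffle_sign R J (I :\: J) * (basis_form S J * basis_form T (I :\: J)%SET)
  = if (S \subset I) && ((I :\: S)%SET == T) then shuffle_sign R S T else 0.
  have E J : shuffle_sign R J (I :\: J) * (basis_form S J * basis_form T (I :\: J)%SET)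
      = if J == S then (if (I :\: S)%SET == T then shuffle_sign R S T else 0) else 0.
    rewrite !ffunE; case: eqP => [->|_]; last by rewrite mul0r mulr0.
    by case: eqP => [->|_]; rewrite ?mulr0 ?mul0r ?mulr1.
  under eq_bigr do rewrite E.
  case: (boolP (S \subset I)) => SI /=.
    rewrite (bigD1 S) //= eqxx big1 ?addr0 // => J /andP[_ /negPf->] //.
  rewrite big1 // => J JI; case: eqP => // JS; by rewrite -JS JI in SI.
have -> : (S \subset I) && ((I :\: S)%SET == T) =
          [disjoint S & T] && (I == (S :|: T)%SET).
  apply/andP/andP => [[SI /eqP <-]|[dST /eqP ->]].
    split.
      rewrite -setI_eq0; apply/eqP/finset.setP => x.
      by rewrite !finset.inE; case: (x \in S).
    apply/eqP/finset.setP => x; rewrite !finset.inE.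
    by case: (boolP (x \in S)) => // /(fintype.subsetP SI) ->.
  split; first exact: finset.subsetUl.
  rewrite finset.setDUl finset.setDv finset.set0U; apply/eqP/finset.setDidPl.
  by rewrite disjoint_sym.
case: (boolP [disjoint S & T]%B) => dST /=; last by rewrite ffunE.
rewrite !ffunE; by case: eqP => _; rewrite /GRing.scale /= ?mulr1 ?mulr0.
Qed.

Lemma contract_basis k S : contract k (basis_form S) =
  if k \in S then shuffle_sign R [set k]%SET (S :\ k)%SET *: basis_form (S :\ k)%SET
  else 0.
Proof.
apply/ffunP => I; rewrite !ffunE; case: (boolP (k \in I)) => kI.
  case: ifP => kS; rewrite !ffunE //.
  case: eqP => [IE|]; last by rewrite /GRing.scale /= mulr0.
  by move: kI; rewrite IE !finset.inE eqxx.
case: eqP => [kIS|nE].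
  by rewrite -kIS setU11 setU1K // !ffunE eqxx.
case: ifP => kS; rewrite !ffunE ?mulr0 //.
case: eqP => [IE|]; last by rewrite /GRing.scale /= mulr0.
by case: nE; rewrite IE finset.setD1K.
Qed.

Lemma hodge_basis S :
  hodge (basis_form S) = shuffle_sign R S (~: S)%SET *: basis_form (~: S)%SET.
Proof.
apply/ffunP => I; rewrite !ffunE.
case: (eqVneq I (~: S)%SET) => [->|nE]; first by rewrite finset.setCK eqxx.
case: eqP => [E|_]; last by rewrite /GRing.scale /= !mulr0.
by rewrite -E finset.setCK eqxx in nE.
Qed.

Lemma shuffle_signE S T :
  shuffle_sign R S T = (-1) ^+ (\sum_(i < n | i \in S) \sum_(j < n | (j < i)%N) (j \in T)).
Proof.
rewrite /shuffle_sign -sum1_card; congr (_ ^+ _).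
rewrite [RHS](eq_bigr (fun i : 'I_n => \sum_(j < n | (j < i)%N && (j \in T)) 1)%N); last first.
  by move=> i _; rewrite big_mkcondr /=; apply: eq_bigr => j _; case: (j \in T).
by rewrite pair_big_dep /=; apply: eq_bigl => -[i j] /=; rewrite [X in _ && X]andbC.
Qed.

End BasisForms.

(** Sets of indices are encoded as bit masks: i belongs to m when bit i of m is
    set. *)
Definition bit (m : N) (i : nat) : bool := N.testbit m (N.of_nat i).
Definition mask1 (k : nat) : N := N.setbit 0 (N.of_nat k).

Lemma bit_mask1 k i : bit (mask1 k) i = (k == i).
Proof.
rewrite /bit /mask1; apply/idP/eqP => [|->]; last exact: N.setbit_eq.
case: (eqVneq k i) => // ne; rewrite N.setbit_neq ?N.bits_0 // => /Nat2N.inj ki.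
by rewrite ki eqxx in ne.
Qed.

Lemma bitU m m' i : bit (N.lor m m') i = bit m i || bit m' i.
Proof. exact: N.lor_spec. Qed.

Lemma bitD1 m k i : bit (N.clearbit m (N.of_nat k)) i = (i != k) && bit m i.
Proof.
rewrite /bit; case: eqVneq => [->|ne] /=; first exact: N.clearbit_eq.
by apply: N.clearbit_neq => /Nat2N.inj ki; rewrite ki eqxx in ne.
Qed.

Lemma bitC n m i : (i < n)%N -> bit (N.lxor m (N.ones (N.of_nat n))) i = ~~ bit m i.
Proof.
move=> /ssrnat.ltP lt; rewrite /bit N.lxor_spec N.ones_spec_low; first by case: N.testbit.
lia.
Qed.

Section Masks.
Variables (R : realType) (n : nat).
Local Notation form := (form R n).

(** Bits of m beyond n are ignored. *)
Definition set_of (m : N) : {set 'I_n} := [set i : 'I_n | bit m i]%SET.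
(** The basis form e_S for the set S with mask m. *)
Definition bas (m : N) : form := basis_form R (set_of m).

(** The number of pairs i > j with i in m and j in m'. *)
Definition inversions (m m' : N) : nat :=
  sumn [seq if bit m i then count (bit m') (iota 0 i) else 0%N | i <- iota 0 n].
(** The sign in e_m /\ e_m' = fsgn m m' e_(m u m') for disjoint m and m'. *)
Definition fsgn (m m' : N) : Z := if odd (inversions m m') then (-1)%ZZ else 1%ZZ.

Lemma in_set_of m i : (i \in set_of m) = bit m i.
Proof. by rewrite finset.inE. Qed.

Lemma shuffle_sign_mask m m' :
  shuffle_sign R (set_of m) (set_of m') = zr R (fsgn m m').
Proof.
rewrite shuffle_signE -signr_odd /fsgn.
suff -> : (\sum_(i < n | i \in set_of m) \sum_(j < n | (j < i)%N) (j \in set_of m'))%N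
    = inversions m m' by case: odd.
rewrite /inversions sumnE big_map.
rewrite (_ : iota 0 n = index_iota 0 n); last by rewrite /index_iota subn0.
rewrite big_mkord big_mkcond /=; apply: eq_bigr => i _; rewrite in_set_of.
case: ifP => // _; rewrite -sumn_count sumnE big_map.
rewrite (_ : iota 0 i = index_iota 0 i); last by rewrite /index_iota subn0.
rewrite big_mkord (big_ord_widen n (fun j => bit m' j : nat)) 1?ltnW //.
by apply: eq_bigr => j _; rewrite in_set_of.
Qed.

Lemma wedge_bas m m' : wedge (bas m) (bas m') =
  lin bas (if has (fun i => bit m i && bit m' i) (iota 0 n) then [::]
           else [:: (N.lor m m', fsgn m m')]).
Proof.
rewrite /bas wedge_basis; case: hasP => [[i]|h].
  rewrite mem_iota add0n => /andP[_ lt] /andP[mi m'i]; rewrite ifF ?lin_nil //.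
  apply/negP => /pred0P /(_ (Ordinal lt)) /=.
  by rewrite !in_set_of /= mi m'i.
rewrite ifT; last first.
  apply/pred0P => i /=; rewrite !in_set_of; apply/negP => mm'; case: h.
  by exists (val i) => //; rewrite mem_iota add0n ltn_ord.
rewrite lin_seq1 shuffle_sign_mask; congr (_ *: basis_form R _).
by apply/finset.setP => i; rewrite !finset.inE bitU.
Qed.

Definition wedgem l l' := fbilin
  (fun m m' => if has (fun i => bit m i && bit m' i) (iota 0 n) then [::]
               else [:: (N.lor m m', fsgn m m')]) l l'.

Lemma wedgemP l l' : wedge (lin bas l) (lin bas l') = lin bas (wedgem l l').
Proof.
apply: lin_fbilin => [k k'|v|v']; first exact: wedge_bas.
  exact: wedge_linear_r.
exact: wedge_linear_l.
Qed.

Lemma set_of1 (k : 'I_n) : [set k]%SET = set_of (mask1 k).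
Proof. by apply/finset.setP => i; rewrite !finset.inE bit_mask1 eq_sym. Qed.

Lemma covec_lin (k : 'I_n) : covec R k = lin bas [:: (mask1 k, 1%ZZ)].
Proof.
rewrite lin_seq1 scale1r /bas -set_of1.
by apply/ffunP => I; rewrite !ffunE.
Qed.

Lemma form1_lin : form1 R n = lin bas [:: (0%num, 1%ZZ)].
Proof.
rewrite lin_seq1 scale1r; apply/ffunP => I; rewrite !ffunE finset.cards_eq0.
congr (_ == _)%:R; apply/finset.setP => i; rewrite !finset.inE.
Qed.

Definition ewedgem (s : seq nat) : seq (N * Z) :=
  foldr (fun k l => wedgem [:: (mask1 k, 1%ZZ)] l) [:: (0%num, 1%ZZ)] s.

Lemma ewedgemP (s : seq 'I_n) : ewedge R s = lin bas (ewedgem (map val s)).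
Proof.
elim: s => [|k s IH] /=; first exact: form1_lin.
by rewrite -wedgemP -covec_lin -IH.
Qed.

Definition contractm (k : nat) l := flin (fun m => if bit m k then
  [:: (N.clearbit m (N.of_nat k), fsgn (mask1 k) (N.clearbit m (N.of_nat k)))]
  else [::]) l.

Lemma set_ofD1 m (k : 'I_n) : (set_of m :\ k)%SET = set_of (N.clearbit m (N.of_nat k)).
Proof. by apply/finset.setP => i; rewrite !finset.inE bitD1. Qed.

Lemma contractmP (k : 'I_n) l : contract k (lin bas l) = lin bas (contractm k l).
Proof.
apply: lin_flin => [m|]; last exact: contract_linear.
rewrite /bas contract_basis in_set_of; case: ifP => _; last by rewrite lin_nil.
by rewrite lin_seq1 set_ofD1 set_of1 shuffle_sign_mask.
Qed.

Definition hodgem l := flin (fun m =>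
  let m' := N.lxor m (N.ones (N.of_nat n)) in [:: (m', fsgn m m')]) l.

Lemma hodgemP l : hodge (lin bas l) = lin bas (hodgem l).
Proof.
apply: lin_flin => [m|]; last exact: hodge_linear.
rewrite /bas hodge_basis lin_seq1.
have -> : (~: set_of m)%SET = set_of (N.lxor m (N.ones (N.of_nat n))).
  by apply/finset.setP => i; rewrite !finset.inE bitC.
by rewrite shuffle_sign_mask.
Qed.

(** The coefficient on e_I. *)
Lemma lin_at l (I : {set 'I_n}) : lin bas l I = \sum_(t <- l | I == set_of t.1) zr R t.2.
Proof.
elim: l => [|t l IH]; first by rewrite lin_nil big_nil ffunE.
rewrite lin_cons big_cons !ffunE IH.
by case: eqP => _; rewrite /GRing.scale /= ?mulr1 // mulr0 add0r.
Qed.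

(** All masks are subsets of {0, ..., n - 1}, so that different masks denote
    different sets. *)
Definition below (l : seq (N * Z)) := all (fun t => (t.1 <? 2 ^ N.of_nat n)%num) l.

Lemma set_of_inj m m' : (m <? 2 ^ N.of_nat n)%num -> (m' <? 2 ^ N.of_nat n)%num ->
  (set_of m == set_of m') = (m == m').
Proof.
move=> /N.ltb_lt hm /N.ltb_lt hm'; apply/eqP/eqP => [/finset.setP E|->//].
apply/N.bits_inj => i; case: (ltnP (N.to_nat i) n) => ni.
  have := E (Ordinal ni); rewrite !in_set_of /bit /=.
  by rewrite Nnat.N2Nat.id.
have ni' : (N.of_nat n <= i)%num by lia.
rewrite -(N.mod_small _ _ hm) -(N.mod_small _ _ hm').
by rewrite !N.mod_pow2_bits_high.
Qed.

Lemma lin_coefE l m : below l -> (m <? 2 ^ N.of_nat n)%num ->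
  lin bas l (set_of m) = zr R (coef m l).
Proof.
rewrite lin_at => + hm; elim: l => [|[k c] l IH] /=; first by rewrite big_nil.
move=> /andP[hk /IH E]; rewrite big_cons E /= set_of_inj // eq_sym.
by case: eqP => _; rewrite ?zrD.
Qed.

End Masks.

(** * Left-invariant geometry with integral structure functions *)

Section ModelSums.
Variables (R : realType) (n : nat).

Lemma lin_sum (K : eqType) (V : lmodType R) (b : K -> V) (F : nat -> seq (K * Z)) :
  \sum_(i < n) lin b (F i) = lin b (flatten [seq F i | i <- iota 0 n]).
Proof.
rewrite lin_flatten big_map (_ : iota 0 n = index_iota 0 n).
  by rewrite big_mkord.
by rewrite /index_iota subn0.
Qed.

Lemma lin_sum_cond (K : eqType) (V : lmodType R) (b : K -> V) (P : pred nat)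
    (F : nat -> seq (K * Z)) :
  \sum_(i < n | P i) lin b (F i) =
  lin b (flatten [seq if P i then F i else [::] | i <- iota 0 n]).
Proof.
rewrite -lin_sum big_mkcond; apply: eq_bigr => i _.
by case: (P i); rewrite ?lin_nil.
Qed.

Lemma zr_sum_div (f : nat -> Z) (D : R) (F : 'I_n -> R) :
  (forall i, F i = zr R (f i) / D) -> \sum_(i < n) F i = zr R (zsum n f) / D.
Proof. by move=> FE; rewrite -zr_sum mulr_suml; apply: eq_bigr. Qed.

Lemma zr_sum_mul (f : nat -> Z) (D : R) (F : 'I_n -> R) :
  (forall i, F i = D * zr R (f i)) -> \sum_(i < n) F i = D * zr R (zsum n f).
Proof. by move=> FE; rewrite -zr_sum mulr_sumr; apply: eq_bigr. Qed.

(** P holds for all i < n. *)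
Definition all_ord (P : nat -> bool) := all P (iota 0 n).

Lemma all_ordP (P : nat -> bool) : all_ord P -> forall i : 'I_n, P i.
Proof. by move=> /allP h i; apply: h; rewrite mem_iota ltn_ord. Qed.

(** The two-form with coefficients B i j, i < j. *)
Definition two_formm (B : nat -> nat -> Z) : seq (N * Z) :=
  fnorm (flatten [seq flatten [seq if (i < j)%N then
      (if (B i j =? 0)%ZZ then [::] else fscale (B i j) (ewedgem n [:: i; j])) else [::]
    | j <- iota 0 n] | i <- iota 0 n]).

Lemma two_formmP (B : nat -> nat -> Z) (D : R) (B' : 'I_n -> 'I_n -> R) :
  (forall i j, B' i j = zr R (B i j) / D) ->
  two_form B' = D^-1 *: lin (@bas R n) (two_formm B).
Proof.
move=> BE; rewrite /two_formm lin_norm -lin_sum /two_form scaler_sumr; apply: eq_bigr => i _.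
rewrite -(lin_sum_cond _ (fun j => i < j)%N
  (fun j => if (B i j =? 0)%ZZ then [::] else fscale (B i j) (ewedgem n [:: val i; j]))).
rewrite scaler_sumr; apply: eq_bigr => j _; rewrite BE ewedgemP.
case: Z.eqb_spec => [->|_]; first by rewrite mul0r scale0r lin_nil scaler0.
by rewrite lin_scale scalerA mulrC.
Qed.

(** Evaluation on frame vectors: contract successively, then add up the
    coefficients of the masks without an index below n. *)
Definition compm (l : seq (N * Z)) (s : seq nat) : Z :=
  foldr (fun t c => if has (bit t.1) (iota 0 n) then c else (t.2 + c)%ZZ) 0%ZZ
    (foldl (fun b k => contractm n k b) l s).

Lemma compmP l (s : seq 'I_n) : comp (lin (@bas R n) l) s = zr R (compm l (map val s)).
Proof.
rewrite /comp /compm.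
have -> : foldl (fun b k => contract k b) (lin (@bas R n) l) s =
    lin (@bas R n) (foldl (fun b k => contractm n k b) l (map val s)).
  by elim: s l => //= k s IH l; rewrite contractmP IH.
move: (foldl _ l _) => {}l; rewrite lin_at.
elim: l => [|[m c] l IH] /=; first by rewrite big_nil.
rewrite big_cons IH /=; case: hasP => [[i]|h].
  rewrite mem_iota add0n => /andP[_ lt] mi; rewrite ifF //.
  apply/negP => /eqP/finset.setP/(_ (Ordinal lt)).
  by rewrite !finset.inE /= mi.
rewrite ifT ?zrD //; apply/eqP/finset.setP => i; rewrite !finset.inE.
by apply/esym/negP => mi; apply: h; exists (val i) => //; rewrite mem_iota ltn_ord.
Qed.

Lemma contractZ (c : R) k (a : form R n) : contract k (c *: a) = c *: contract k a.
Proof. by apply/ffunP => I; rewrite !ffunE; case: ifP => _; rewrite /GRing.scale /=; ring. Qed.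
Lemma contractD k (a b : form R n) : contract k (a + b) = contract k a + contract k b.
Proof. by apply/ffunP => I; rewrite !ffunE; case: ifP => _; rewrite ?addr0 ?mulrDr. Qed.
Lemma wedgeZr (c : R) (a b : form R n) : wedge a (c *: b) = c *: wedge a b.
Proof.
apply/ffunP => I; rewrite !ffunE scaler_sumr; apply: eq_bigr => J _.
by rewrite !ffunE /GRing.scale /=; ring.
Qed.
Lemma wedgeZl (c : R) (a b : form R n) : wedge (c *: a) b = c *: wedge a b.
Proof.
apply/ffunP => I; rewrite !ffunE scaler_sumr; apply: eq_bigr => J _.
by rewrite !ffunE /GRing.scale /=; ring.
Qed.
Lemma wedge0r (a : form R n) : wedge a 0 = 0.
Proof. by have := wedgeZr 0 a 0; rewrite !scale0r. Qed.

Lemma compZ (c : R) (a : form R n) s : comp (c *: a) s = c * comp a s.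
Proof.
rewrite /comp; elim: s a => [|k s IH] a /=; first by rewrite ffunE.
by rewrite -IH contractZ.
Qed.

Lemma compD (a b : form R n) s : comp (a + b) s = comp a s + comp b s.
Proof.
rewrite /comp; elim: s a b => [|k s IH] a b /=; first by rewrite ffunE.
by rewrite -IH contractD.
Qed.

Lemma comp0 s : comp (0 : form R n) s = 0.
Proof. by have := compZ 0 0 s; rewrite scale0r mul0r. Qed.
Lemma derZ (c : R) A (a : form R n) : der A (c *: a) = c *: der A a.
Proof.
rewrite /der scaler_sumr; apply: eq_bigr => j _.
rewrite scaler_sumr; apply: eq_bigr => k _.
by rewrite contractZ wedgeZr !scalerA mulrC.
Qed.

(** e_j /\ (E_k contracted with l): the term of the derivation der that is
    multiplied by A_jk. *)
Definition der_elem (l : seq (N * Z)) (j k : nat) : seq (N * Z) :=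
  wedgem n [:: (mask1 j, 1%ZZ)] (contractm n k l).

Lemma derE A l : der A (lin (@bas R n) l) =
  \sum_j \sum_k A j k *: lin (@bas R n) (der_elem l j k).
Proof.
apply: eq_bigr => j _; apply: eq_bigr => k _; congr (_ *: _).
by rewrite contractmP covec_lin wedgemP.
Qed.

(** The derivation given by the matrix B. *)
Definition derm (B : nat -> nat -> Z) (l : seq (N * Z)) : seq (N * Z) :=
  flatten [seq flatten [seq if (B j k =? 0)%ZZ then [::] else fscale (B j k) (der_elem l j k)
    | k <- iota 0 n] | j <- iota 0 n].

Lemma dermP (B : nat -> nat -> Z) (D : R) (A : 'I_n -> 'I_n -> R) l :
  (forall i j, A i j = zr R (B i j) / D) ->
  der A (lin (@bas R n) l) = D^-1 *: lin (@bas R n) (derm B l).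
Proof.
move=> AE; rewrite derE /derm -lin_sum scaler_sumr; apply: eq_bigr => j _.
rewrite -lin_sum scaler_sumr; apply: eq_bigr => k _; rewrite AE.
case: Z.eqb_spec => [->|_]; first by rewrite mul0r scale0r lin_nil scaler0.
by rewrite lin_scale scalerA mulrC.
Qed.

End ModelSums.

(** Coframes with constant integral structure functions
    d k i j = d e_k (E_i, E_j). *)
Section ConstantCoframe.
Variables (R : realType) (n : nat) (e : coframe R n) (d : nat -> nat -> nat -> Z).
Hypothesis dE : forall k i j x, dcoframe e k i j x = zr R (d k i j).
Local Notation b := (@bas R n).

Lemma fder_cst i (c : R) x : fder e i (fun=> c) x = 0.
Proof. exact: derive_cst. Qed.

Lemma fder_form_cst i (a : form R n) x : fder_form e i (fun=> a) x = 0.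
Proof. by apply/ffunP => I; rewrite !ffunE fder_cst. Qed.

(** g([E_i, E_j], E_k) *)
Definition bracketm i j k : Z := (- d k i j)%ZZ.
(** Twice the Levi-Civita connection, g(nabla_{E_i} E_j, E_k), by Koszul's
    formula. *)
Definition levi_civitam i j k : Z := (bracketm i j k - bracketm j k i + bracketm k i j)%ZZ.

Lemma bracketE i j k x : bracket e i j k x = zr R (bracketm i j k).
Proof. by rewrite /bracket dE zrN. Qed.

Lemma levi_civitaE i j k x : levi_civita e i j k x = zr R (levi_civitam i j k) / 2.
Proof. by rewrite /levi_civita !bracketE /levi_civitam zrD zrB. Qed.

Definition dextm (l : seq (N * Z)) : seq (N * Z) :=
  flatten [seq wedgem n (two_formm n (d k)) (contractm n k l) | k <- iota 0 n].

Lemma dextE l x : dext e (fun=> lin b l) x = lin b (dextm l).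
Proof.
rewrite /dext /dextm -lin_sum; apply: eq_bigr => k _.
rewrite fder_form_cst wedge0r add0r contractmP -wedgemP; congr (wedge _ _).
by rewrite /dcov (@two_formmP R n (d k) 1) ?invr1 ?scale1r // => i j; rewrite dE mulr1.
Qed.

(** Twice the coefficients of nabla^g + (s/2) t. *)
Definition connectionm (s : Z) (t : nat -> nat -> nat -> Z) i j k : Z := (levi_civitam i j k + s * t i j k)%ZZ.

Lemma torsion_connectionE (tm : seq (N * Z)) (s : Z) (T : form_field R n) i j k x :
  T x = zr R s *: lin b tm ->
  torsion_connection e T i j k x =
  zr R (connectionm s (fun i j k => compm n tm [:: i; j; k]) i j k) / 2.
Proof.
move=> TE; rewrite /torsion_connection TE levi_civitaE compZ compmP /connectionm zrD zrM /=.
by rewrite mulrDl.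
Qed.

Section Connection.
Variables (G : connection R n) (g : nat -> nat -> nat -> Z).
Hypothesis GE : forall i j k x, G i j k x = zr R (g i j k) / 2.

(** Four times the curvature of the connection with coefficients g / 2. *)
Definition curvm i j a c : Z := zsum n (fun k =>
  g j a k * g i k c - g i a k * g j k c - 2 * bracketm i j k * g k a c)%ZZ.

Lemma zr2 : zr R 2 = 2. Proof. by []. Qed.

Lemma curvatureE i j a c x : curvature e G i j a c x = zr R (curvm i j a c) / 4.
Proof.
rewrite /curvature.
have cst i' a' b' : G i' a' b' = (fun=> zr R (g i' a' b') / 2).
  by apply/funext => y; rewrite GE.
rewrite !cst !fder_cst subrr add0r -sumrB /curvm.
apply: zr_sum_div => k; rewrite !cst bracketE !zrB !zrM zr2; lra.
Qed.

Variable c : nat -> nat -> nat -> nat -> Z.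
Hypothesis cE : forall i j a k x, curvature e G i j a k x = zr R (c i j a k) / 4.

(** Sixteen times Tr (R /\ R), for a curvature c / 4. *)
Definition trace_RRm : seq (N * Z) :=
  flatten [seq flatten [seq if (a < k)%N then
      (let om := two_formm n (fun i j => c i j a k) in wedgem n om om) else [::]
    | k <- iota 0 n] | a <- iota 0 n].

Lemma trace_RRE x : trace_RR e G x = 16^-1 *: lin b trace_RRm.
Proof.
rewrite /trace_RR /trace_RRm -lin_sum scaler_sumr; apply: eq_bigr => a _.
rewrite -(@lin_sum_cond R n _ _ b (fun k => a < k)%N
  (fun k => let om := two_formm n (fun i j => c i j a k) in wedgem n om om)).
rewrite scaler_sumr; apply: eq_bigr => k _ /=.
rewrite (@two_formmP R n (fun i j => c i j a k) 4) ?wedgeZl ?wedgeZr ?scalerA ?wedgemP //.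
by congr (_ *: _); lra.
Qed.

End Connection.

Section Equations.
Variables (tm : seq (N * Z)) (A : connection R n) (phi : 'rV[R]_n -> R) (p : nat -> Z).
Variables (t g : nat -> nat -> nat -> Z) (c cg : nat -> nat -> nat -> nat -> Z).
Local Notation H := (fun=> lin b tm : form R n).
Hypothesis tE : forall i j k : 'I_n, compm n tm [:: val i; val j; val k] = t i j k.
Hypothesis AE : forall i j k x, A i j k x = zr R (g i j k) / 2.
Hypothesis cE : forall i j a k x, curvature e A i j a k x = zr R (c i j a k) / 4.
Hypothesis cgE :
  forall i j a k x, curvature e (levi_civita e) i j a k x = zr R (cg i j a k) / 4.
Hypothesis phiE : forall m x, fder e m phi x = zr R (p m) / 2.
Hypothesis expE : forall m x k, fder e m (fun y => expR (- 2 * phi y) * k) x =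
  expR (- 2 * phi x) * (- zr R (p m) * k).

(** Four times the Ricci tensor. *)
Definition riccim i j : Z := zsum n (fun k => cg k i j k).
(** Four times the Hessian of phi, for E_k phi = p k / 2 constant. *)
Definition hessm i j : Z := (- zsum n (fun k => levi_civitam i j k * p k))%ZZ.
(** Sixteen times Tr (F_ij F_kl). *)
Definition trFFm i j k l : Z := zsum n (fun a => zsum n (fun a' =>
  if (a < a')%N then c i j a a' * c k l a a' else 0))%ZZ.

Lemma ricciE i j x : ricci e i j x = zr R (riccim i j) / 4.
Proof. by apply: zr_sum_div => k; rewrite cgE. Qed.

Lemma hessianE i j x : hessian e phi i j x = zr R (hessm i j) / 4.
Proof.
rewrite /hessian (_ : fder e j phi = fun=> zr R (p j) / 2); last by apply/funext.
rewrite fder_cst /hessm zrN mulNr sub0r; congr (- _); apply: zr_sum_div => k.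
by rewrite levi_civitaE phiE zrM; lra.
Qed.

Lemma flux_compE i j k x : flux_comp H i j k x = zr R (t i j k).
Proof. by rewrite /flux_comp compmP tE. Qed.

Lemma trace_FFE i j k l x : trace_FF e A i j k l x = zr R (trFFm i j k l) / 16.
Proof.
apply: zr_sum_div => a; rewrite big_mkcond /=; apply: zr_sum_div => a'.
case: ifP => _; last by rewrite mul0r.
by rewrite !cE zrM; lra.
Qed.

(** The Einstein equation multiplied by 32, for alpha' = 1/4. *)
Definition einstein_check : bool := all_ord n (fun m => all_ord n (fun q =>
  (8 * riccim m q - 8 * zsum n (fun k => zsum n (fun l => t m k l * t q k l))
   + 16 * hessm m q + zsum n (fun k => trFFm m k q k) =? 0)%ZZ)).

Lemma einsteinP : einstein_check -> einstein_equation e H A phi 4^-1.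
Proof.
move=> /all_ordP h m q x; have /all_ordP /(_ q) /Z.eqb_eq hz := h m.
rewrite ricciE hessianE.
have -> : \sum_k \sum_l flux_comp H m k l x * flux_comp H q k l x =
    zr R (zsum n (fun k => zsum n (fun l => t m k l * t q k l)%ZZ)) / 1.
  apply: zr_sum_div => k; apply: zr_sum_div => l.
  by rewrite !flux_compE zrM divr1.
have -> : \sum_k trace_FF e A m k q k x = zr R (zsum n (fun k => trFFm m k q k)) / 16.
  by apply: zr_sum_div => k; rewrite trace_FFE.
have := congr1 (zr R) hz; rewrite 2!zrD zrB !zrM zr0.
have -> : zr R 8 = 8 by []. have -> : zr R 16 = 16 by [].
lra.
Qed.

(** Twice the covariant derivative of e^(- 2 phi) T, divided by e^(- 2 phi). *)
Definition flux_form (m : nat) : seq (N * Z) :=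
  fnorm (fscale (-2 * p m) tm ++ fscale (-1) (derm n (levi_civitam m) tm)).
Definition flux_check : bool := all_ord n (fun i => all_ord n (fun j =>
  (zsum n (fun m => compm n (flux_form m) [:: m; i; j]) =? 0)%ZZ)).

Lemma fluxP : flux_check -> flux_equation e H phi.
Proof.
move=> /all_ordP h i j x; have /all_ordP /(_ j) /Z.eqb_eq hz := h i.
have E m : cov_form e (levi_civita e) m (fun y => expR (- 2 * phi y) *: H y) x =
    (expR (- 2 * phi x) / 2) *: lin b (flux_form m).
  rewrite /cov_form derZ (@dermP R n (levi_civitam m) 2); last first.
    by move=> k l; rewrite levi_civitaE.
  have -> : fder_form e m (fun y => expR (- 2 * phi y) *: H y) x =
     (expR (- 2 * phi x) * - zr R (p m)) *: lin b tm.
    apply/ffunP => I; rewrite !ffunE /GRing.scale /= -mulrA -expE; congr (fder e m _ x).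
    by apply/funext => y; rewrite ffunE.
  rewrite /flux_form lin_norm lin_cat !lin_scale zrM scaleN1r.
  rewrite scalerDr scalerN !scalerA; congr (_ *: _ - _).
  have -> : zr R (-2) = -2 by [].
  by field.
rewrite (eq_bigr (fun m : 'I_n => (expR (- 2 * phi x) / 2) *
   zr R (compm n (flux_form m) [:: val m; val i; val j]))); last first.
  by move=> m _; rewrite E compZ compmP.
rewrite (zr_sum_mul (f := fun m => compm n (flux_form m) [:: m; val i; val j])
   (D := expR (- 2 * phi x) / 2)) //.
by rewrite hz mulr0.
Qed.

(** The gauge equation divided by e^(- 2 phi) / 8. *)
Definition gauge_check : bool := all_ord n (fun i => all_ord n (fun a => all_ord n (fun k =>
  (zsum n (fun m => - 2 * p m * c m i a k
     + zsum n (fun l => c m i a l * g m l k - g m a l * c m i l k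
                      - levi_civitam m m l * c l i a k - levi_civitam m i l * c m l a k))
   + zsum n (fun q => zsum n (fun r => t i q r * c q r a k)) =? 0)%ZZ))).

Lemma gaugeP : gauge_check -> gauge_equation e H A phi.
Proof.
move=> /all_ordP h i a k x; have /all_ordP /(_ a) /all_ordP /(_ k) /Z.eqb_eq hz := h i.
set E := expR _.
have -> : \sum_p0 \sum_q flux_comp H i p0 q x * curvature e A p0 q a k x =
   zr R (zsum n (fun q => zsum n (fun r => t i q r * c q r a k)%ZZ)) / 4.
  apply: zr_sum_div => q; apply: zr_sum_div => r.
  by rewrite flux_compE cE zrM mulrA.
rewrite (zr_sum_mul (D := E / 8) (f := fun m => (- 2 * p m * c m i a k
     + zsum n (fun l => c m i a l * g m l k - g m a l * c m i l k
                      - levi_civitam m m l * c l i a k - levi_civitam m i l * c m l a k))%ZZ)).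
  have := congr1 (fun z => E / 8 * zr R z) hz; rewrite /= zr0 mulr0 zrD mulrDr => <-.
  by congr (_ + _); field.
move=> m; rewrite /gauge_cov.
have -> : fder e m (fun y => expR (- 2 * phi y) * curvature e A m i a k y) x =
    E * (- zr R (p m) * (zr R (c m i a k) / 4)).
  by rewrite -expE; congr (fder e m _ x); apply/funext => y; rewrite cE.
rewrite -addrA zrD mulrDr; congr (_ + _).
  by rewrite !zrM; have -> : zr R (-2) = -2 by []; field.
rewrite addrC -sumrB; apply: zr_sum_mul => l.
rewrite !cE !AE !levi_civitaE -/E.
by move: (levi_civitam m m l) (levi_civitam m i l) => u v; rewrite !zrB !zrM; field.
Qed.

(** The dilaton equation multiplied by 192, for alpha' = 1/4. *)
Definition dilaton_check : bool :=
  (48 * zsum n (fun i => riccim i i) + 192 * zsum n (fun m => hessm m m)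
   - 192 * zsum n (fun m => p m * p m)
   - 16 * zsum n (fun i => zsum n (fun j => zsum n (fun k => t i j k * t i j k)))
   + 3 * zsum n (fun i => zsum n (fun j => trFFm i j i j)) =? 0)%ZZ.

Lemma dilatonP : dilaton_check -> dilaton_equation e H A phi 4^-1.
Proof.
move=> /Z.eqb_eq hz x.
have -> : scalar_curvature e x = zr R (zsum n (fun i => riccim i i)) / 4.
  by apply: zr_sum_div => i; rewrite ricciE.
have -> : \sum_m hessian e phi m m x = zr R (zsum n (fun i => hessm i i)) / 4.
  by apply: zr_sum_div => i; rewrite hessianE.
have -> : \sum_m fder e m phi x ^+ 2 = zr R (zsum n (fun m => p m * p m)%ZZ) / 4.
  by apply: zr_sum_div => i; rewrite phiE zrM expr2; lra.
have -> : \sum_i \sum_j \sum_k flux_comp H i j k x ^+ 2 =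
    zr R (zsum n (fun i => zsum n (fun j => zsum n (fun k => t i j k * t i j k)))%ZZ) / 1.
  apply: zr_sum_div => i; apply: zr_sum_div => j; apply: zr_sum_div => k.
  by rewrite flux_compE zrM divr1.
have -> : \sum_i \sum_j trace_FF e A i j i j x =
    zr R (zsum n (fun i => zsum n (fun j => trFFm i j i j))) / 16.
  by apply: zr_sum_div => i; apply: zr_sum_div => j; rewrite trace_FFE.
have := congr1 (zr R) hz; rewrite zrD 2!zrB zrD !zrM zr0.
have -> : zr R 48 = 48 by []. have -> : zr R 192 = 192 by [].
have -> : zr R 16 = 16 by []. have -> : zr R 3 = 3 by [].
lra.
Qed.

Lemma equations_of_motionP :
  [&& einstein_check, flux_check, gauge_check & dilaton_check] ->
  equations_of_motion e H A phi 4^-1.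
Proof.
case/and4P=> h1 h2 h3 h4; split.
- exact: einsteinP.
- exact: fluxP.
- exact: gaugeP.
- exact: dilatonP.
Qed.

End Equations.

End ConstantCoframe.

(** * Clifford words *)

Section CliffordWords.
Variables (R : realType) (n N : nat) (gam : 'I_n -> 'M[R]_N).
Hypothesis gamP : clifford gam.

(** Generators indexed by natural numbers, zero outside the range. *)
Definition gamn (k : nat) : 'M[R]_N := if insub k is Some i then gam i else 0.

Lemma gamn_ord (i : 'I_n) : gamn i = gam i.
Proof. by rewrite /gamn valK. Qed.

(** The product of the generators in the word w. *)
Definition gamw (w : seq nat) : 'M[R]_N := foldr (fun k M => gamn k *m M) 1%:M w.

Lemma gamn_anti j k : j != k -> gamn j *m gamn k = - (gamn k *m gamn j).
Proof.
move=> jk; rewrite /gamn; case: insubP => [i _ ij|_]; last first.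
  by rewrite mul0mx mulmx0 oppr0.
case: insubP => [i' _ i'k|_]; last by rewrite mul0mx mulmx0 oppr0.
apply/eqP; rewrite -subr_eq0 opprK gamP ifF ?raddf0 //.
by rewrite -val_eqE /= ij i'k (negPf jk).
Qed.

Lemma gamn_sqr k : gamn k *m gamn k = if (k < n)%N then - 1%:M else 0.
Proof.
rewrite /gamn; case: insubP => [i -> _|/negPf->]; last by rewrite mul0mx.
(* the Clifford relation gives the square multiplied by 2 *)
apply: (@scalerI _ _ 2%:R); first by rewrite pnatr_eq0.
rewrite scaler_nat mulr2n gamP eqxx scalerN; apply/matrixP => a b.
by rewrite !mxE; case: (a == b); rewrite ?mulr1n ?mulr0n ?mulr1 ?mulr0 ?oppr0.
Qed.

(** The product of the generator k with the word w, as a sorted word with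
    sign when w is sorted. *)
Fixpoint insw (k : nat) (w : seq nat) : seq (seq nat * Z) :=
  if w is j :: w' then
    if (k < j)%N then [:: (k :: w, 1%ZZ)]
    else if k == j then (if (k < n)%N then [:: (w', (-1)%ZZ)] else [::])
    else [seq (j :: t.1, (- t.2)%ZZ) | t <- insw k w']
  else [:: ([:: k], 1%ZZ)].

Lemma lin_cons_word j l :
  lin gamw [seq (j :: t.1, (- t.2)%ZZ) | t <- l] = - (gamn j *m lin gamw l).
Proof.
elim: l => [|t l IH] /=; first by rewrite !lin_nil mulmx0 oppr0.
rewrite !lin_cons IH mulmxDr opprD zrN scaleNr /= -scalemxAr; congr (- _ + _).
Qed.

Lemma inswP k w : gamn k *m gamw w = lin gamw (insw k w).
Proof.
elim: w => [|j w IH] /=; first by rewrite lin_seq1 scale1r.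
case: ltnP => kj; first by rewrite lin_seq1 scale1r.
case: eqVneq => [->|ne].
  rewrite mulmxA gamn_sqr; case: ifP => _; rewrite ?lin_nil ?mul0mx //.
  by rewrite lin_seq1 mulNmx mul1mx scaleN1r.
by rewrite lin_cons_word -IH mulmxA (gamn_anti ne) mulNmx mulmxA.
Qed.

Definition mulw (w w' : seq nat) : seq (seq nat * Z) :=
  foldr (fun k l => flin (insw k) l) [:: (w', 1%ZZ)] w.

Lemma mulmx_linear_r (M : 'M[R]_N) : linear (fun M' : 'M[R]_N => M *m M').
Proof. by move=> c A B; rewrite mulmxDr scalemxAr. Qed.
Lemma mulmx_linear_l (M : 'M[R]_N) : linear (fun M' : 'M[R]_N => M' *m M).
Proof. by move=> c A B; rewrite mulmxDl scalemxAl. Qed.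

Lemma mulwP w w' : gamw w *m gamw w' = lin gamw (mulw w w').
Proof.
elim: w => [|k w IH] /=; first by rewrite mul1mx lin_seq1 scale1r.
rewrite -mulmxA IH; apply: (lin_flin (f := fun M : 'M[R]_N => gamn k *m M)) => [w''|].
  exact: inswP.
exact: mulmx_linear_r.
Qed.

Definition cmul l l' := fnorm (fbilin mulw l l').

Lemma cmulP l l' : lin gamw l *m lin gamw l' = lin gamw (cmul l l').
Proof.
rewrite /cmul lin_norm.
apply: (lin_fbilin (f := fun A B : 'M[R]_N => A *m B)) => [k k'|M|M].
- exact: mulwP.
- exact: mulmx_linear_r.
- exact: mulmx_linear_l.
Qed.

(** w anticommutes with one of the generators. *)
Definition traceless (w : seq nat) : bool := has (fun i =>
  feq (cmul [:: ([:: i], 1%ZZ)] [:: (w, 1%ZZ)])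
      (cmul [:: (w, (-1)%ZZ)] [:: ([:: i], 1%ZZ)])) (iota 0 n).

Lemma lin_word (w : seq nat) c : lin gamw [:: (w, c)] = zr R c *: gamw w.
Proof. exact: lin_seq1. Qed.

(** If g is a generator anticommuting with the word w, then g w g = w, while
    the trace of g w g is that of w g^2 = - w. *)
Lemma tracelessP w : traceless w -> \tr (gamw w) = 0.
Proof.
move=> /hasP[i]; rewrite mem_iota add0n => /andP[_ lt] /(feqP gamw).
rewrite -!cmulP !lin_word scale1r /= mulmx1 scaleN1r mulNmx => anti.
have gg : gamn i *m gamn i = - 1%:M by rewrite gamn_sqr lt.
have h : gamn i *m (gamw w *m gamn i) = gamw w.
  by rewrite mulmxA [X in X *m _](_ : _ = - (gamw w *m gamn i)) ?mulNmx -?mulmxA ?gg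
     ?mulmxN ?opprK ?mulmx1 // -anti scale1r.
have := congr1 mxtrace h; rewrite mxtrace_mulC -mulmxA gg mulmxN mulmx1 raddfN /=.
by move=> /eqP; rewrite eq_sym -subr_eq0 opprK -mulr2n mulrn_eq0 /= => /eqP.
Qed.

Lemma trace_lin l : all (fun t => (t.1 == [::]) || traceless t.1) l ->
  \tr (lin gamw l) = zr R (coef [::] l) * N%:R.
Proof.
elim: l => [|[w c] l IH] /=; first by rewrite lin_nil raddf0 mul0r.
move=> /andP[h /IH E]; rewrite lin_cons raddfD /= mxtraceZ E /=.
case: eqP h => [->|_] /= h; first by rewrite mxtrace1 zrD mulrDl.
by rewrite tracelessP // mulr0 add0r.
Qed.

Lemma clifford2E (A : 'I_n -> 'I_n -> R) : clifford2 gam A =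
  \sum_j \sum_k A j k *: lin gamw (mulw [:: val j] [:: val k]).
Proof.
apply: eq_bigr => j _; apply: eq_bigr => k _; congr (_ *: _).
by rewrite -mulwP /= !mulmx1 !gamn_ord.
Qed.

End CliffordWords.

(** * Isotropy algebras *)

(** A Lie algebra of skew matrices given by linear equations: the m-th entry
    of eqs lists triples (j, k, s) with j < k, standing for the equation
    \sum s A_jk = 0. *)
Section Isotropy.
Variables (R : realType) (n : nat).
Variable eqs : seq (seq (nat * nat * Z)).

(** The coefficient of A_jk in the m-th equation. *)
Definition iso_coef (m j k : nat) : Z :=
  foldr (fun t c => if (t.1.1 == j) && (t.1.2 == k) then t.2 else c) 0%ZZ
    (nth [::] eqs m).

(** The value of the m-th equation at A. *)
Definition iso_eq (A : 'I_n -> 'I_n -> R) (m : nat) : R :=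
  \sum_(j < n) \sum_(k < n) zr R (iso_coef m j k) * A j k.

Definition upper : bool :=
  all (all (fun t => (t.1.1 < t.1.2)%N)) eqs.

Hypothesis eqs_upper : upper.

Lemma iso_lower m j k : (k <= j)%N -> iso_coef m j k = 0%ZZ.
Proof.
move=> kj; rewrite /iso_coef; have : all (fun t => (t.1.1 < t.1.2)%N) (nth [::] eqs m).
  case: (ltnP m (size eqs)) => h; last by rewrite nth_default.
  by move: (allP eqs_upper) => /(_ _ (mem_nth [::] h)).
elim: (nth _ _ _) => //= t l IH /andP[lt /IH ->].
by case: eqP => //= tj; case: eqP => //= tk; move: lt; rewrite tj tk ltnNge kj.
Qed.

Definition antisym (A : 'I_n -> 'I_n -> R) := forall j k, A j k = - A k j.

(** If e_j /\ e_k acts through its class, then A acts through the values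
    of the equations. *)
Lemma isotropy_sum (V : lmodType R) (X : 'I_n -> 'I_n -> V) (W : nat -> V)
    (A : 'I_n -> 'I_n -> R) : antisym A ->
  (forall j k : 'I_n, (j < k)%N ->
    X j k - X k j = \sum_(m < size eqs) zr R (iso_coef m j k) *: W m) ->
  \sum_j \sum_k A j k *: X j k = \sum_(m < size eqs) iso_eq A m *: W m.
Proof.
move=> Aa XE.
transitivity (\sum_(j < n) \sum_(k < n)
    A j k *: (if (j < k)%N then X j k - X k j else 0)); last first.
  rewrite /iso_eq; under [RHS]eq_bigr do rewrite scaler_suml.
  rewrite [RHS]exchange_big; apply: eq_bigr => j _ /=.
  under [RHS]eq_bigr do rewrite scaler_suml.
  rewrite [RHS]exchange_big; apply: eq_bigr => k _ /=.
  under [RHS]eq_bigr => m _ do rewrite mulrC -scalerA.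
  rewrite -scaler_sumr; congr (_ *: _); case: ltnP => jk; first exact: XE.
  by rewrite big1 // => m _; rewrite iso_lower // scale0r.
(* split into j < k and k < j, and exchange j and k in the second part *)
transitivity (\sum_(j < n) \sum_(k < n) ((if (j < k)%N then A j k *: X j k else 0) +
    (if (k < j)%N then A j k *: X j k else 0))).
  apply: eq_bigr => j _; apply: eq_bigr => k _.
  case: (ltngtP j k) => jk; rewrite ?addr0 ?add0r //.
  have -> : A j k = 0.
    by have := Aa j k; rewrite (val_inj jk) => /eqP; rewrite -addr_eq0 -mulr2n mulrn_eq0 => /eqP.
  by rewrite scale0r.
under eq_bigr do rewrite big_split /=.
rewrite big_split /= [X in _ + X]exchange_big -big_split /=.
apply: eq_bigr => j _; rewrite -big_split /=; apply: eq_bigr => k _.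
case: ltnP => jk; last by rewrite scaler0 addr0.
by rewrite scalerBr (Aa k j) scaleNr.
Qed.

(** The value of the m-th equation at an integral matrix. *)
Definition iso_eqm (B : nat -> nat -> Z) (m : nat) : Z :=
  zsum n (fun j => zsum n (fun k => iso_coef m j k * B j k))%ZZ.

Lemma iso_eqE (B : nat -> nat -> Z) (D : R) (A : 'I_n -> 'I_n -> R) m :
  (forall j k, A j k = zr R (B j k) / D) -> iso_eq A m = zr R (iso_eqm B m) / D.
Proof.
move=> AE; apply: zr_sum_div => j; apply: zr_sum_div => k.
by rewrite AE zrM mulrA.
Qed.

(** B is skew and satisfies the equations. *)
Definition iso_check (B : nat -> nat -> Z) : bool :=
  all_ord n (fun j => all_ord n (fun k => (B j k =? - B k j)%ZZ)) &&
  all (fun m => (iso_eqm B m =? 0)%ZZ) (iota 0 (size eqs)).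

Lemma iso_checkP (B : nat -> nat -> Z) (D : R) (A : 'I_n -> 'I_n -> R) :
  iso_check B -> (forall j k, A j k = zr R (B j k) / D) ->
  antisym A /\ forall m, (m < size eqs)%N -> iso_eq A m = 0.
Proof.
move=> /andP[/all_ordP h1 /allP h2] AE; split=> [j k|m lt].
  have /all_ordP/(_ k)/Z.eqb_eq E := h1 j.
  by rewrite !AE E zrN mulNr.
have mi : m \in iota 0 (size eqs) by rewrite mem_iota.
by have /Z.eqb_eq mz := h2 m mi; rewrite (iso_eqE m AE) mz mul0r.
Qed.

(** A representative (j, k) of the m-th class: the first pair in the m-th
    equation, where it has coefficient 1. *)
Definition rep m : nat * nat := (head (0, 0, 0%ZZ) (nth [::] eqs m)).1.

Section Forms.
Variable l : seq (N * Z).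
Local Notation b := (@bas R n).

(** The action of e_j /\ e_k on the form l. *)
Definition der_pair (j k : nat) := fnorm (der_elem n l j k ++ fscale (-1) (der_elem n l k j)).
(** The action of the representative of the m-th class. *)
Definition der_class (m : nat) := der_pair (rep m).1 (rep m).2.

(** Every e_j /\ e_k acts on l as the combination of class
    representatives given by the coefficients of the equations. *)
Definition forms_check : bool :=
  let W := [seq der_class m | m <- iota 0 (size eqs)] in
  all_ord n (fun j => all_ord n (fun k => (j < k)%N ==>
    feq (der_pair j k) (flatten [seq (let c := iso_coef m j k in
      if (c =? 0)%ZZ then [::] else fscale c (nth [::] W m)) | m <- iota 0 (size eqs)]))).

Lemma forms_isotropy (A : 'I_n -> 'I_n -> R) : antisym A -> forms_check ->
  der A (lin b l) = \sum_(m < size eqs) iso_eq A m *: lin b (der_class m).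
Proof.
move=> Aa /all_ordP h; rewrite derE.
apply: (isotropy_sum (X := fun j k => lin b (der_elem n l j k)) (W := fun m => lin b (der_class m))) => // j k jk.
have /all_ordP/(_ k)/implyP/(_ jk)/(feqP b) := h j.
rewrite /der_pair lin_norm lin_cat lin_scale scaleN1r => ->.
rewrite -lin_sum; apply: eq_bigr => m _.
rewrite (nth_map 0%N) ?size_iota // nth_iota // add0n.
case: Z.eqb_spec => [->|_]; first by rewrite lin_nil scale0r.
by rewrite lin_scale.
Qed.

(** For each m the leading mask of the form der_class m occurs in no other
    der_class m', which makes these forms linearly independent. *)
Definition indep_check : bool :=
  let W := [seq der_class m | m <- iota 0 (size eqs)] in
  all (below n) W && all (fun m => let I := (head (0%num, 0%ZZ) (nth [::] W m)).1 in
    [&& (I <? 2 ^ N.of_nat n)%num, negb (coef I (nth [::] W m) =? 0)%ZZ &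
     all (fun m' => (m == m') || (coef I (nth [::] W m') =? 0)%ZZ) (iota 0 (size eqs))])
    (iota 0 (size eqs)).

Lemma forms_indep (c : nat -> R) : indep_check ->
  \sum_(m < size eqs) c m *: lin b (der_class m) = 0 ->
  forall m, (m < size eqs)%N -> c m = 0.
Proof.
move=> /andP[/allP hb /allP h] s0 m lt.
have nthW k : (k < size eqs)%N -> nth [::] [seq der_class m | m <- iota 0 (size eqs)] k = der_class k.
  by move=> kl; rewrite (nth_map 0%N) ?size_iota // nth_iota // add0n.
have mi k : (k < size eqs)%N -> k \in iota 0 (size eqs) by rewrite mem_iota add0n.
have := h m (mi m lt); rewrite nthW //; set I := (head _ _).1.
move=> /and3P[Ib nz /allP z].
have bW k : (k < size eqs)%N -> below n (der_class k).
  by move=> kl; apply: hb; apply/map_f/mi.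
have := congr1 (fun a : form R n => a (set_of n I)) s0.
rewrite sum_ffunE ffunE (bigD1 (Ordinal lt)) //= big1 ?addr0.
  rewrite !ffunE lin_coefE ?bW //= => /eqP; rewrite mulf_eq0 zr_eq0 (negPf nz) orbF.
  by move/eqP.
move=> k km; rewrite !ffunE lin_coefE ?bW //=.
have := z k (mi k (ltn_ord k)); rewrite nthW //.
have -> /= : (m == k) = false.
  by apply/negbTE; apply: contra km => /eqP mk; apply/eqP/val_inj; rewrite /= mk.
by move=> /Z.eqb_eq ->; rewrite zr0 scaler0.
Qed.

End Forms.

Section Spinors.
Variables (NN : nat) (gam : 'I_n -> 'M[R]_NN).
Hypothesis gamP : clifford gam.
Local Notation c := (gamw gam).
Variable Q : seq (seq nat * Z).
Local Notation cmul := (cmul n).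

(** The Clifford product e_j e_k Q. *)
Definition spin_pair (j k : nat) := cmul (mulw n [:: j] [:: k]) Q.
(** The action of the representative of the m-th class on Q: e_j e_k - e_k e_j
    is 2 e_j e_k. *)
Definition spin_class (m : nat) := fscale 2 (spin_pair (rep m).1 (rep m).2).

(** On the range of Q every e_j e_k acts as the combination of class
    representatives given by the coefficients of the equations. *)
Definition spin_check : bool :=
  let W := [seq spin_class m | m <- iota 0 (size eqs)] in
  all_ord n (fun j => all_ord n (fun k => (j < k)%N ==>
    feq (spin_pair j k ++ fscale (-1) (spin_pair k j))
      (flatten [seq fscale (iso_coef m j k) (nth [::] W m) | m <- iota 0 (size eqs)]))).

Lemma spin_isotropy (A : 'I_n -> 'I_n -> R) : antisym A -> spin_check ->
  clifford2 gam A *m lin c Q = \sum_(m < size eqs) iso_eq A m *: lin c (spin_class m).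
Proof.
move=> Aa /all_ordP h; rewrite clifford2E // mulmx_suml.
under eq_bigr do rewrite mulmx_suml.
under eq_bigr do under eq_bigr do rewrite -scalemxAl cmulP //.
apply: (isotropy_sum (X := fun j k => lin c (spin_pair j k)) (W := fun m => lin c (spin_class m))) => // j k jk.
have /all_ordP/(_ k)/implyP/(_ jk)/(feqP c) := h j.
rewrite lin_cat lin_scale scaleN1r => ->.
rewrite -lin_sum; apply: eq_bigr => m _.
by rewrite (nth_map 0%N) ?size_iota // nth_iota // add0n lin_scale.
Qed.

(** For representatives w_m one has Q w_m (2 w_m' Q) = kappa Q if m = m',
    and 0 otherwise. *)
Definition spin_indep_check (kappa : Z) : bool :=
  let W := [seq spin_class m | m <- iota 0 (size eqs)] in
  negb (kappa =? 0)%ZZ && all (fun m =>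
    let Qw := cmul Q (mulw n [:: (rep m).1] [:: (rep m).2]) in
    all (fun m' => feq (cmul Qw (nth [::] W m')) (if m == m' then fscale kappa Q else [::]))
      (iota 0 (size eqs))) (iota 0 (size eqs)).

Lemma spin_indep kappa (x : nat -> R) (v : 'cV[R]_NN) : spin_indep_check kappa ->
  lin c Q *m v != 0 ->
  (\sum_(m < size eqs) x m *: lin c (spin_class m)) *m v = 0 ->
  forall m, (m < size eqs)%N -> x m = 0.
Proof.
move=> /andP[k0 /allP h] Qv s0 m lt.
have mi k : (k < size eqs)%N -> k \in iota 0 (size eqs) by rewrite mem_iota add0n.
have /allP hm := h m (mi m lt).
set Qw := cmul _ _ in hm.
(* multiply by Q w_m on the left *)
have : lin c Qw *m ((\sum_(m < size eqs) x m *: lin c (spin_class m)) *m v) = 0.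
  by rewrite s0 mulmx0.
rewrite mulmxA mulmx_sumr (bigD1 (Ordinal lt)) //= big1 ?addr0; last first.
  move=> k km; rewrite -scalemxAr cmulP //.
  have := hm k (mi k (ltn_ord k)); rewrite (nth_map 0%N) ?size_iota // nth_iota // add0n.
  have -> /= : (m == k) = false.
    by apply/negbTE; apply: contra km => /eqP mk; apply/eqP/val_inj; rewrite /= mk.
  by move=> /(feqP c) ->; rewrite lin_nil scaler0.
have := hm m (mi m lt); rewrite (nth_map 0%N) ?size_iota // nth_iota // add0n eqxx.
move=> /(feqP c) E; rewrite -scalemxAr cmulP // E lin_scale scalerA -scalemxAl.
move=> /eqP; rewrite scaler_eq0 (negPf Qv) orbF mulf_eq0 zr_eq0 (negPf k0) orbF.
by move/eqP.
Qed.

(** The trace of Q is N times its coefficient on the empty word, which is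
    nonzero. *)
Definition trace_check : bool :=
  all (fun t => (t.1 == [::]) || traceless n t.1) Q && negb (coef [::] Q =? 0)%ZZ.

(** Q is nonzero in every representation. *)
Lemma spinor_ex : (0 < NN)%N -> trace_check -> exists v : 'cV[R]_NN, lin c Q *m v != 0.
Proof.
move=> N0 /andP[h nz].
have : \tr (lin c Q) != 0.
  by rewrite trace_lin // mulf_neq0 ?zr_eq0 // pnatr_eq0 -lt0n.
move=> tr0; have : lin c Q != 0 by apply: contraNneq tr0 => ->; rewrite raddf0.
move=> Q0; have [j Qj] : exists j, col j (lin c Q) != 0.
  apply/existsP; rewrite -negb_forall; apply: contra Q0 => /forallP z.
  apply/eqP/matrixP => i j; have /eqP/colP/(_ i) := z j.
  by rewrite !mxE.
by exists (delta_mx j 0); rewrite -colE.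
Qed.

End Spinors.
End Isotropy.

(** * The structure forms in coordinates *)

Section StructureForms.
Variable R : realType.

Lemma ebE n (s : seq nat) : all (fun i => (i.-1 <= n)%N) s ->
  eb R n s = lin (@bas R n.+1) (ewedgem n.+1 (map predn s)).
Proof.
move=> h; rewrite /eb ewedgemP; congr (lin _ (ewedgem _ _)).
elim: s h => //= i s IH /andP[lt /IH ->]; by rewrite inordK.
Qed.

Section Pull.
Variable n : nat.

(** The pullback of a basis form along the injection f of index sets. *)
Lemma basis_pull m (f : 'I_n -> 'I_m) (S : {set 'I_n}) (I : {set 'I_m}) : injective f ->
  \sum_(J : {set 'I_n} | (f @: J)%SET == I) basis_form R S J = ((f @: S)%SET == I)%:R.
Proof.
move=> fi; case: eqP => [<-|ne].
  rewrite (bigD1 S) //= ffunE eqxx big1 ?addr0 // => J /andP[_ /negPf JS].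
  by rewrite ffunE JS.
rewrite big1 // => J /eqP JI; rewrite ffunE; case: eqP => // JS.
by case: ne; rewrite -JS.
Qed.

(** Pullback from the first n coordinates: bits beyond n, which denote nothing,
    must be cleared as n becomes an index. *)
Definition pull_rightm (l : seq (N * Z)) : seq (N * Z) :=
  flin (fun m => [:: (N.land m (N.ones (N.of_nat n)), 1%ZZ)]) l.

Lemma pull_rightP l :
  pull_right (lin (@bas R n) l) = lin (@bas R (n + 1)) (pull_rightm l).
Proof.
apply: (lin_flin (f := @pull_right R n)) => [m|c a b]; last first.
  apply/ffunP => I; rewrite !ffunE scaler_sumr -big_split; apply: eq_bigr => J _.
  by rewrite !ffunE.
apply/ffunP => I; rewrite lin_seq1 scale1r !ffunE basis_pull; last exact: lshift_inj.
rewrite eq_sym; congr (_ == _)%:R; apply/finset.setP => i; rewrite finset.inE /bit N.land_spec.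
have [j ->|j ->] := split_ordP i.
  rewrite finset.mem_imset ?finset.inE; last exact: lshift_inj.
  rewrite N.ones_spec_low ?andbT //=; have := ltn_ord j; lia.
rewrite N.ones_spec_high ?andbF; last by rewrite /=; lia.
by apply/negbTE/imsetP => -[k _ /eqP]; rewrite eq_rlshift.
Qed.

(** Pullback from the last n coordinates: indices are shifted by one. *)
Definition pull_leftm (l : seq (N * Z)) : seq (N * Z) :=
  flin (fun m => [:: (N.shiftl m 1, 1%ZZ)]) l.

Lemma pull_leftP l :
  pull_left (lin (@bas R n) l) = lin (@bas R (1 + n)) (pull_leftm l).
Proof.
apply: (lin_flin (f := @pull_left R n)) => [m|c a b]; last first.
  apply/ffunP => I; rewrite !ffunE scaler_sumr -big_split; apply: eq_bigr => J _.
  by rewrite !ffunE.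
apply/ffunP => I; rewrite lin_seq1 scale1r !ffunE basis_pull; last exact: rshift_inj.
rewrite eq_sym; congr (_ == _)%:R; apply/finset.setP => i; rewrite finset.inE /bit.
have [j ->|j ->] := split_ordP i.
  rewrite N.shiftl_spec_low; last by rewrite /= (ord1 j).
  by apply/negbTE/imsetP => -[k _ /eqP]; rewrite eq_lrshift.
rewrite finset.mem_imset ?finset.inE; last exact: rshift_inj.
have -> : N.of_nat (rshift 1 j) = (N.of_nat j + 1)%num by rewrite /=; lia.
by rewrite N.shiftl_spec_high' ?N.add_sub //; lia.
Qed.

End Pull.

(** c e_{i1 i2 ...} with 1-based indices. *)
Definition ebm n c s := fscale c (ewedgem n.+1 (map predn s)).

(** The structure forms, expanded in basis forms. *)
Definition F6m := fnorm (ebm 5 (-1) [:: 1; 2] ++ ebm 5 (-1) [:: 3; 4] ++ ebm 5 (-1) [:: 5; 6])%N.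
Definition Pplusm := fnorm (ebm 5 (-1) [:: 1; 3; 5] ++ ebm 5 1 [:: 2; 3; 6]
  ++ ebm 5 1 [:: 1; 4; 6] ++ ebm 5 1 [:: 2; 4; 5])%N.
Definition Pminusm := fnorm (ebm 5 (-1) [:: 1; 3; 6] ++ ebm 5 (-1) [:: 1; 4; 5]
  ++ ebm 5 (-1) [:: 2; 3; 5] ++ ebm 5 1 [:: 2; 4; 6])%N.
Definition omega7m := fnorm (wedgem 7 (fscale (-1) (pull_rightm 6 F6m)) (ebm 6 1 [:: 7])
  ++ fscale (-1) (pull_rightm 6 Pplusm))%N.
Definition G2m := fnorm (ebm 6 1 [:: 1; 2; 7] ++ ebm 6 (-1) [:: 2; 3; 6] ++ ebm 6 1 [:: 3; 4; 7]
  ++ ebm 6 1 [:: 5; 6; 7] ++ ebm 6 (-1) [:: 1; 4; 6] ++ ebm 6 (-1) [:: 2; 4; 5]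
  ++ ebm 6 1 [:: 1; 3; 5])%N.
Definition Phi8m := fnorm (wedgem 8 [:: (1%num, 1%ZZ)] (pull_leftm omega7m)
  ++ pull_leftm (hodgem 7 omega7m)).

Lemma zrN1 : zr R (-1) = -1. Proof. by []. Qed.

Lemma ebm1 n s : all (fun i => (i.-1 <= n)%N) s ->
  lin (@bas R n.+1) (ebm n 1 s) = eb R n s.
Proof. by move=> h; rewrite lin_scale -ebE // scale1r. Qed.
Lemma ebmN n s : all (fun i => (i.-1 <= n)%N) s ->
  lin (@bas R n.+1) (ebm n (-1) s) = - eb R n s.
Proof. by move=> h; rewrite lin_scale -ebE // zrN1 scaleN1r. Qed.

Lemma F6E : F6 R = lin (@bas R 6) F6m.
Proof. by rewrite /F6m lin_norm 2!lin_cat 3?ebmN // addrA. Qed.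
Lemma PplusE : Psi_plus R = lin (@bas R 6) Pplusm.
Proof. by rewrite /Pplusm lin_norm 3!lin_cat ebmN // 3?ebm1 // 2!addrA. Qed.
Lemma PminusE : Psi_minus R = lin (@bas R 6) Pminusm.
Proof. by rewrite /Pminusm lin_norm 3!lin_cat 3?ebmN // ebm1 // 2!addrA. Qed.
Lemma omega7E : omega7 R = lin (@bas R 7) omega7m.
Proof.
rewrite /omega7m lin_norm lin_cat lin_scale -wedgemP lin_scale ebm1 //.
by rewrite zrN1 2!scaleN1r /omega7 F6E PplusE 2!pull_rightP.
Qed.
Lemma G2E : G2_model R = lin (@bas R 7) G2m.
Proof.
by rewrite /G2m lin_norm 6!lin_cat 4?ebm1 // 3?ebmN // 5!addrA.
Qed.
Lemma Phi8E : Phi8 R = lin (@bas R 8) Phi8m.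
Proof.
rewrite /Phi8m lin_norm lin_cat -wedgemP -2!pull_leftP -hodgemP -omega7E.
by rewrite -(covec_lin R (ord0 : 'I_8)).
Qed.

Lemma omega7_G2 : omega7 R = G2_model R.
Proof. by rewrite omega7E G2E; apply: feqP; vm_compute. Qed.

End StructureForms.

(** * Isotropy equations and spinor projections *)

(** Equations of su(3) in so(6), with 0-based indices. *)
Definition eqs6 : seq (seq (nat * nat * Z)) :=
  [:: [:: (0, 1, 1%ZZ); (2, 3, 1%ZZ); (4, 5, 1%ZZ)];
      [:: (0, 2, 1%ZZ); (1, 3, (-1)%ZZ)];
      [:: (0, 3, 1%ZZ); (1, 2, 1%ZZ)];
      [:: (0, 4, 1%ZZ); (1, 5, (-1)%ZZ)];
      [:: (0, 5, 1%ZZ); (1, 4, 1%ZZ)];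
      [:: (2, 4, 1%ZZ); (3, 5, (-1)%ZZ)];
      [:: (2, 5, 1%ZZ); (3, 4, 1%ZZ)]]%N.
(** Equations of g2 in so(7), with 0-based indices. *)
Definition eqs7 : seq (seq (nat * nat * Z)) :=
  [:: [:: (0, 1, 1%ZZ); (2, 3, 1%ZZ); (4, 5, 1%ZZ)];
      [:: (0, 2, 1%ZZ); (1, 3, (-1)%ZZ); (5, 6, 1%ZZ)];
      [:: (0, 3, 1%ZZ); (1, 2, 1%ZZ); (4, 6, 1%ZZ)];
      [:: (0, 4, 1%ZZ); (1, 5, (-1)%ZZ); (3, 6, (-1)%ZZ)];
      [:: (0, 5, 1%ZZ); (1, 4, 1%ZZ); (2, 6, (-1)%ZZ)];
      [:: (0, 6, 1%ZZ); (2, 5, 1%ZZ); (3, 4, 1%ZZ)];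
      [:: (1, 6, 1%ZZ); (2, 4, 1%ZZ); (3, 5, (-1)%ZZ)]]%N.
(** Equations of spin(7) in so(8). *)
Definition eqs8 : seq (seq (nat * nat * Z)) :=
  [:: [:: (0, 1, 1%ZZ); (2, 7, 1%ZZ); (3, 5, 1%ZZ); (4, 6, (-1)%ZZ)];
      [:: (0, 2, 1%ZZ); (1, 7, (-1)%ZZ); (3, 6, (-1)%ZZ); (4, 5, (-1)%ZZ)];
      [:: (0, 3, 1%ZZ); (1, 5, (-1)%ZZ); (2, 6, 1%ZZ); (4, 7, 1%ZZ)];
      [:: (0, 4, 1%ZZ); (1, 6, 1%ZZ); (2, 5, 1%ZZ); (3, 7, (-1)%ZZ)];
      [:: (0, 5, 1%ZZ); (1, 3, 1%ZZ); (2, 4, (-1)%ZZ); (6, 7, 1%ZZ)];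
      [:: (0, 6, 1%ZZ); (1, 4, (-1)%ZZ); (2, 3, (-1)%ZZ); (5, 7, (-1)%ZZ)];
      [:: (0, 7, 1%ZZ); (1, 2, 1%ZZ); (3, 4, 1%ZZ); (5, 6, 1%ZZ)]]%N.

(** The product of the elements 1 + s w, for the signed words (w, s).  When the
    words commute and have square 1, it is a multiple of a projection. *)
Definition cliffproj n (s : seq (seq nat * Z)) : seq (seq nat * Z) :=
  foldr (fun t q => cmul n [:: ([::], 1%ZZ); t] q) [:: ([::], 1%ZZ)] s.

(** The four-words fix the spinors annihilated by e_12 - e_34, e_12 - e_56
    and their analogues, which form a plane.  The three-word, a term of Psi^+ up
    to sign, cuts this plane down to a line, so that Q w_m w_m' Q is a
    multiple of Q for any two class representatives. *)
Definition Q6 := cliffproj 6 [:: ([:: 0; 1; 2; 3], (-1)%ZZ); ([:: 0; 1; 4; 5], (-1)%ZZ);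
  ([:: 0; 2; 4], 1%ZZ)]%N.
(** A line; the words are three of the terms of the Hodge dual of omega, with
    opposite sign. *)
Definition Q7 := cliffproj 7 [:: ([:: 0; 1; 2; 3], (-1)%ZZ); ([:: 0; 1; 4; 5], (-1)%ZZ);
  ([:: 0; 2; 5; 6], (-1)%ZZ)]%N.
(** A line; the words are four of the terms of Phi, with opposite sign, and
    generate the volume element, so that they fix the chirality. *)
Definition Q8 := cliffproj 8 [:: ([:: 0; 1; 2; 7], (-1)%ZZ); ([:: 0; 1; 3; 5], (-1)%ZZ);
  ([:: 0; 1; 4; 6], 1%ZZ); ([:: 0; 2; 3; 6], 1%ZZ)]%N.

(** * Three-forms with all contractions in the isotropy algebra *)

Section ThreeForms.
Variables (R : realType) (n : nat).

(** Every set of indices has a mask in range. *)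
Lemma mask_ex (I : {set 'I_n}) : exists2 M, (M <? 2 ^ N.of_nat n)%num & I = set_of n M.
Proof.
pose M := foldr (fun i m => N.lor (mask1 i) m) 0%num (map val (enum I)).
have bitM i : bit M i = (i \in map val (enum I)).
  rewrite /M; elim: (map _ _) => [|j s IH]; first by [].
  by rewrite in_cons -IH eq_sym -bit_mask1; exact: bitU.
exists (M mod 2 ^ N.of_nat n)%num; first by apply/N.ltb_lt/N.mod_upper_bound; lia.
apply/finset.setP => i; rewrite in_set_of /bit N.mod_pow2_bits_low; last first.
  by have := ltn_ord i; lia.
by rewrite -/(bit M i) bitM mem_map ?mem_enum //; exact: val_inj.
Qed.

Lemma card_set_of M : #|set_of n M| = count (bit M) (iota 0 n).
Proof.
rewrite -sum1_card -sum1_count big_mkcond (_ : iota 0 n = index_iota 0 n).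
  by rewrite big_mkord [RHS]big_mkcond; apply: eq_bigr => i _; rewrite in_set_of.
by rewrite /index_iota subn0.
Qed.

Lemma lin_is_form p l : all (fun t => count (bit t.1) (iota 0 n) == p) l ->
  is_form p (lin (@bas R n) l).
Proof.
move=> /allP h I Ip; rewrite lin_at big_seq_cond big1 // => t /andP[tl /eqP It].
by move: Ip; rewrite It card_set_of (eqP (h t tl)) eqxx.
Qed.

(** The component a(E_i, E_j, E_k) in terms of the coefficients of a. *)
Definition comp3m (i j k : nat) : seq (N * Z) :=
  if [|| i == j, i == k | j == k] then [::]
  else [:: (N.lor (mask1 i) (N.lor (mask1 j) (mask1 k)),
    (fsgn n (mask1 k) 0 * (fsgn n (mask1 j) (mask1 k)
       * fsgn n (mask1 i) (N.lor (mask1 j) (mask1 k))))%ZZ)].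

Variable a : form R n.
Definition coeff (M : N) : R^o := a (set_of n M).

Lemma comp3E (i j k : 'I_n) : comp a [:: i; j; k] = lin coeff (comp3m i j k).
Proof.
rewrite /comp /= !ffunE !finset.inE !orbF /comp3m !val_eqE.
have s0 : finset.set0 = set_of n 0%num.
  by apply/finset.setP => l; rewrite !finset.inE.
case: (eqVneq j k) => jk; first by rewrite !orbT lin_nil mulr0.
rewrite orbF; case: (eqVneq i j) => ij /=; first by rewrite lin_nil !mulr0.
case: (eqVneq i k) => ik /=; first by rewrite lin_nil !mulr0.
rewrite lin_seq1 !zrM /coeff.
have s1 : (k |: finset.set0 = set_of n (mask1 k))%SET by rewrite finset.setU0 set_of1.
have s2 : (j |: set_of n (mask1 k) = set_of n (N.lor (mask1 j) (mask1 k)))%SET.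
  by rewrite set_of1; apply/finset.setP => l; rewrite !finset.inE bitU.
have s3 : (i |: set_of n (N.lor (mask1 j) (mask1 k)) =
    set_of n (N.lor (mask1 i) (N.lor (mask1 j) (mask1 k))))%SET.
  by rewrite set_of1; apply/finset.setP => l; rewrite !finset.inE !bitU.
rewrite !s1 !s2 !s3 s0 !set_of1 !shuffle_sign_mask /GRing.scale /=; ring.
Qed.

(** Alternation in the last two arguments. *)
Definition comp3_alt_check : bool := all_ord n (fun i => all_ord n (fun j => all_ord n (fun k =>
  feq (comp3m i j k) (fscale (-1) (comp3m i k j))))).

Lemma comp_alt (i j k : 'I_n) : comp3_alt_check ->
  comp a [:: i; j; k] = - comp a [:: i; k; j].
Proof.
move=> /all_ordP h; have /all_ordP/(_ j)/all_ordP/(_ k)/(feqP coeff) E := h i.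
by rewrite !comp3E E lin_scale scaleN1r.
Qed.

Variable eqs : seq (seq (nat * nat * Z)).

(** The m-th equation for the skew matrix a(E_i, ., .), as a linear form in
    the coefficients of a. *)
Definition contraction_eq (i m : nat) : seq (N * Z) :=
  flatten [seq flatten [seq (let c := iso_coef eqs m j k in
      if (c =? 0)%ZZ then [::] else fscale c (comp3m i j k))
    | k <- iota 0 n] | j <- iota 0 n].

Lemma contraction_eqP (i : 'I_n) m : iso_eq eqs (fun j k => comp a [:: i; j; k]) m = lin coeff (contraction_eq i m).
Proof.
rewrite /iso_eq /contraction_eq -lin_sum; apply: eq_bigr => j _; rewrite -lin_sum; apply: eq_bigr => k _.
rewrite comp3E; case: Z.eqb_spec => [->|_]; first by rewrite lin_nil mul0r.
by rewrite lin_scale.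
Qed.

(** The system Y of all these linear forms. *)
Definition contraction_eqs := flatten [seq [seq fnorm (contraction_eq i m) | m <- iota 0 (size eqs)] | i <- iota 0 n].

Section Normal.
Variable Y : seq (seq (N * Z)).
(** The matrix Y^T Y, applied to the basis vector M. *)
Definition normal_op (M : N) : seq (N * Z) :=
  flatten [seq (let c := coef M y in if (c =? 0)%ZZ then [::] else fscale c y) | y <- Y].
(** q(Y^T Y) applied to the basis vector M, by Horner's rule; q lists the
    coefficients from the constant term on. *)
Definition normal_poly (q : seq Z) (M : N) : seq (N * Z) :=
  foldr (fun c r => fnorm (fscale c [:: (M, 1%ZZ)] ++ flin normal_op r)) [::] q.
(** (Y^T Y) q(Y^T Y) M = D M. *)
Definition normal_cert (q : seq Z) (D : Z) (M : N) : bool :=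
  feq (flin normal_op (normal_poly q M)) [:: (M, D)].

(** A solution of the system Y is orthogonal to the range of Y^T Y. *)
Lemma normal_op0 l : (forall y, y \in Y -> lin coeff y = 0) ->
  lin coeff (flin normal_op l) = 0.
Proof.
move=> Y0; rewrite /flin lin_flatten big_map big1 // => t _.
rewrite lin_scale /normal_op lin_flatten big_map big_seq big1 ?scaler0 // => y yY.
by case: ifP => _; rewrite ?lin_nil // lin_scale Y0 // scaler0.
Qed.
End Normal.

(** (Y^T Y) q(Y^T Y) = D on three-forms, with D nonzero. *)
Definition torsion_check (q : seq Z) (D : Z) : bool :=
  let Y := contraction_eqs in negb (D =? 0)%ZZ &&
  all (fun M => (count (bit M) (iota 0 n) != 3%N) || normal_cert Y q D M)
    (map N.of_nat (iota 0 (2 ^ n))).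

(** A three-form whose contractions with all E_i satisfy the equations
    vanishes. *)
Lemma three_form_eq0 q D : is_form 3 a -> torsion_check q D ->
  (forall i m, (m < size eqs)%N -> iso_eq eqs (fun j k => comp a [:: i; j; k]) m = 0) ->
  a = 0.
Proof.
move=> a3 /andP[D0 /allP h] a0; apply/ffunP => I; rewrite ffunE.
have [M Mlt IM] := mask_ex I.
case: (eqVneq #|I| 3) => [I3|]; last exact: a3.
have cM : count (bit M) (iota 0 n) = 3.
  by rewrite -I3 IM card_set_of.
have /h : M \in map N.of_nat (iota 0 (2 ^ n)).
  apply/mapP; exists (N.to_nat M); last by rewrite Nnat.N2Nat.id.
  rewrite mem_iota add0n /=; move: Mlt => /N.ltb_lt.
  have -> : (2 ^ N.of_nat n)%num = N.of_nat (2 ^ n); last by lia.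
  elim: {1 2}n => // k IH; rewrite expnS Nat2N.inj_mul -IH Nat2N.inj_succ N.pow_succ_r' //.
rewrite cM eqxx /= => /(feqP coeff); rewrite normal_op0; last first.
  move=> y /flattenP[s /mapP[i]]; rewrite mem_iota add0n => /andP[_ lt] -> /mapP[m].
  rewrite mem_iota add0n => /andP[_ mlt] ->.
  by rewrite lin_norm -(contraction_eqP (Ordinal lt)) a0.
move=> /esym/eqP; rewrite lin_seq1 scaler_eq0 zr_eq0 (negPf D0) /= /coeff -IM.
by move/eqP.
Qed.

End ThreeForms.

(** * Tables *)

(** Arrays of integers of size n in each direction, tabulated so that they
    are computed once. *)
Definition tabulate3 n (f : nat -> nat -> nat -> Z) : seq (seq (seq Z)) :=
  [seq [seq [seq f i j k | k <- iota 0 n] | j <- iota 0 n] | i <- iota 0 n].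
Definition get3 (t : seq (seq (seq Z))) i j k : Z := nth 0%ZZ (nth [::] (nth [::] t i) j) k.
Definition tabulate4 n (f : nat -> nat -> nat -> nat -> Z) : seq (seq (seq (seq Z))) :=
  [seq tabulate3 n (f i) | i <- iota 0 n].
Definition get4 (t : seq (seq (seq (seq Z)))) i : nat -> nat -> nat -> Z :=
  get3 (nth [::] t i).

Lemma nth_tab (T : Type) (x : T) n (f : nat -> T) i : (i < n)%N ->
  nth x [seq f i | i <- iota 0 n] i = f i.
Proof. by move=> lt; rewrite (nth_map 0%N) ?size_iota // nth_iota. Qed.

Lemma get3P n f (i j k : 'I_n) : get3 (tabulate3 n f) i j k = f i j k.
Proof. by rewrite /get3 !nth_tab. Qed.

Lemma get4P n f (i j k l : 'I_n) : get4 (tabulate4 n f) i j k l = f i j k l.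
Proof. by rewrite /get4 nth_tab // get3P. Qed.

(** The structure functions d e_k (E_i, E_j) of the group, with 0-based
    indices shifted by o: the group takes up the coordinates o, ..., o + 5. *)
Definition dcoframem (o k i j : nat) : Z :=
  foldr (fun t c => let: (k', i', j') := t in
    if (k == k' + o) && (i == i' + o) && (j == j' + o) then 1%ZZ
    else if (k == k' + o) && (i == j' + o) && (j == i' + o) then (-1)%ZZ else c)%N
    0%ZZ [:: (0, 2, 5); (3, 1, 5); (4, 1, 2)]%N.

(** T = e_136 - 2 e_145 + e_235 - e_246, shifted in the same way. *)
Definition torsionm (n o : nat) : seq (N * Z) :=
  fnorm (flatten [seq fscale t.2 (ewedgem n [seq (i + o)%N | i <- t.1]) |
    t <- [:: ([:: 0; 2; 5], 1%ZZ); ([:: 0; 3; 4], (-2)%ZZ); ([:: 1; 2; 4], 1%ZZ);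
             ([:: 1; 3; 5], (-1)%ZZ)]%N]).

(** The components T(E_i, E_j, E_k). *)
Definition torsion_table n o := tabulate3 n (fun i j k => compm n (torsionm n o) [:: i; j; k]).
(** Twice the connection nabla^g + (s/2) T; s is 1, 0 or - 1. *)
Definition connection_table n o (s : Z) := tabulate3 n (connectionm (dcoframem o) s (get3 (torsion_table n o))).
(** Four times the curvature of nabla^g + (s/2) T. *)
Definition curvature_table n o (s : Z) := tabulate4 n (curvm n (dcoframem o) (get3 (connection_table n o s))).

Section Smooth.
Variables (R : realType) (n : nat).

Lemma partials_cst (c : R) s : exists c', partials s (fun=> c) = (fun=> c') :> ('rV[R]_n -> R).
Proof.
elim: s => [|i s [c' IH]] /=; first by exists c.
by exists 0; rewrite IH; apply/funext => x; exact: derive_cst.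
Qed.

Lemma smooth_cst (c : R) : smooth (fun _ : 'rV[R]_n => c).
Proof. by move=> s x _; have [c' ->] := partials_cst c s. Qed.

End Smooth.

(** * Solutions with constant coefficients *)

Section Solution.
Variables (R : realType) (n NN o : nat) (e : coframe R n) (gam : 'I_n -> 'M[R]_NN).
Hypothesis dE : forall k i j x, dcoframe e k i j x = zr R (dcoframem o k i j).
Hypothesis gamP : clifford gam.
Hypothesis NN0 : (0 < NN)%N.
Local Notation b := (@bas R n).
Local Notation d := (dcoframem o).

(** The constant three-form T, as a form field. *)
Definition torsion_form : form_field R n := fun=> lin b (torsionm n o).
Local Notation A := (torsion_connection e torsion_form).
Local Notation tt := (get3 (torsion_table n o)).
Local Notation gg s := (get3 (connection_table n o s)).
Local Notation cc s := (get4 (curvature_table n o s)).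

Lemma torsion_tableE (i j k : 'I_n) : compm n (torsionm n o) [:: val i; val j; val k] = tt i j k.
Proof. by rewrite get3P. Qed.

Lemma connection_tableE (s : Z) i j k x :
  torsion_connection e (fun=> zr R s *: lin b (torsionm n o)) i j k x = zr R (gg s i j k) / 2.
Proof.
rewrite (torsion_connectionE dE (tm := torsionm n o) (s := s)) //.
by rewrite get3P /connectionm torsion_tableE.
Qed.

Lemma AE i j k x : A i j k x = zr R (gg 1 i j k) / 2.
Proof. by rewrite -(connection_tableE 1 i j k x) scale1r. Qed.

Lemma minusE i j k x :
  torsion_connection e (fun y => - torsion_form y) i j k x = zr R (gg (-1) i j k) / 2.
Proof. by rewrite -(connection_tableE (-1) i j k x) scaleN1r. Qed.

Lemma lcE i j k x : levi_civita e i j k x = zr R (gg 0 i j k) / 2.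
Proof. by rewrite -(connection_tableE 0 i j k x) scale0r /torsion_connection comp0 mul0r addr0. Qed.

Lemma curv_tableE (s : Z) (G : connection R n) : (forall i j k x, G i j k x = zr R (gg s i j k) / 2) ->
  forall i j a k x, curvature e G i j a k x = zr R (cc s i j a k) / 4.
Proof. by move=> GE i j a k x; rewrite (curvatureE dE GE) get4P. Qed.

Lemma curvAE i j a k x : curvature e A i j a k x = zr R (cc 1 i j a k) / 4.
Proof. exact: (@curv_tableE 1 _ AE). Qed.
Lemma curvBE i j a k x :
  curvature e (torsion_connection e (fun y => - torsion_form y)) i j a k x = zr R (cc (-1) i j a k) / 4.
Proof. exact: (@curv_tableE (-1) _ minusE). Qed.
Lemma curvLE i j a k x : curvature e (levi_civita e) i j a k x = zr R (cc 0 i j a k) / 4.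
Proof. exact: (@curv_tableE 0 _ lcE). Qed.

(** ** The Bianchi identities *)

(** (B1) with alpha' = 1/4 and (B2) with alpha' = 1/6, multiplied by 32 and 48. *)
Definition bianchi_check : bool :=
  let dT := dextm n d (torsionm n o) in
  let rA := fnorm (trace_RRm n (let t := curvature_table n o 1 in get4 t)) in
  let rB := fnorm (trace_RRm n (let t := curvature_table n o (-1) in get4 t)) in
  feq (fscale 32 dT) rA && feq (fscale 48 dT) (rA ++ fscale (-1) rB).

Lemma bianchi1P : bianchi_check -> bianchi1 e torsion_form A 4^-1.
Proof.
move=> /andP[/(feqP b) h _] x; rewrite /torsion_form (dextE dE).
rewrite (trace_RRE (c := cc 1)); last exact: curvAE.
move: h; rewrite lin_scale lin_norm => <-; rewrite !scalerA.
have -> : zr R 32 = 32 by [].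
by rewrite (_ : 2 / 4 * 16^-1 * 32 = 1) ?scale1r //; field.
Qed.

Lemma bianchi2P : bianchi_check -> bianchi2 e torsion_form A 6^-1.
Proof.
move=> /andP[_ /(feqP b) h] x; rewrite /torsion_form (dextE dE).
rewrite (trace_RRE (c := cc 1)); last exact: curvAE.
rewrite (trace_RRE (c := cc (-1))); last exact: curvBE.
move: h; rewrite lin_cat lin_scale lin_norm [lin b (fscale (-1) _)]lin_scale lin_norm.
rewrite scaleN1r -scalerBr scalerA => <-; rewrite scalerA; have -> : zr R 48 = 48 by [].
by rewrite (_ : 2 / 6 * 16^-1 * 48 = 1) ?scale1r //; field.
Qed.

(** ** The equations of motion *)

Section Motion.
Variables (phi : 'rV[R]_n -> R) (p : nat -> Z).
Hypothesis phiE : forall m x, fder e m phi x = zr R (p m) / 2.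
Hypothesis expE : forall m x k, fder e m (fun y => expR (- 2 * phi y) * k) x =
  expR (- 2 * phi x) * (- zr R (p m) * k).

(** The four equations of motion, for alpha' = 1/4. *)
Definition motion_check : bool :=
  let t := torsion_table n o in let g := connection_table n o 1 in let c := curvature_table n o 1 in let cg := curvature_table n o 0 in
  [&& einstein_check n d p (get3 t) (get4 c) (get4 cg), flux_check n d (torsionm n o) p,
      gauge_check n d p (get3 t) (get3 g) (get4 c) & dilaton_check n d p (get3 t) (get4 c) (get4 cg)].

Lemma motionP : motion_check -> equations_of_motion e torsion_form A phi 4^-1.
Proof.
move=> h; apply: (equations_of_motionP dE (tm := torsionm n o) torsion_tableE AE curvAE curvLE phiE expE h).
Qed.

(** ** The supersymmetry equations *)

Variable eqs : seq (seq (nat * nat * Z)).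
Hypothesis eqs_upper : upper eqs.
Variables (Q : seq (seq nat * Z)) (kappa : Z) (S : seq (form R n)).

(** The connection and its curvature take values in the isotropy algebra. *)
Definition holonomy_check : bool :=
  (let g := connection_table n o 1 in all_ord n (fun i => iso_check n eqs (get3 g i))) &&
  (let c := curvature_table n o 1 in
   all_ord n (fun a => all_ord n (fun k => iso_check n eqs (fun i j => get4 c i j a k)))).

Lemma holonomyP : holonomy_check -> forall i x,
  antisym (fun j k => A i j k x) /\
  forall m, (m < size eqs)%N -> iso_eq eqs (fun j k => A i j k x) m = 0.
Proof.
move=> /andP[/all_ordP h _] i x.
by apply: (iso_checkP (h i)) => j k; exact: AE.
Qed.

Lemma curvature_holonomyP : holonomy_check -> forall a k x,
  antisym (fun i j => curvature e A i j a k x) /\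
  forall m, (m < size eqs)%N -> iso_eq eqs (fun i j => curvature e A i j a k x) m = 0.
Proof.
move=> /andP[_ /all_ordP h] a k x; have /all_ordP/(_ k) hk := h a.
by apply: (iso_checkP hk) => i j; exact: curvAE.
Qed.

Lemma parallel_cst (l : seq (N * Z)) : holonomy_check -> forms_check n eqs l ->
  parallel e A (fun=> lin b l).
Proof.
move=> hol fc i x; have [Aa A0] := holonomyP hol i x.
rewrite /cov_form fder_form_cst sub0r (forms_isotropy eqs_upper Aa fc) big1 ?oppr0 // => m _.
by rewrite A0 ?scale0r.
Qed.

(** The forms are annihilated by the algebra given by the equations. *)
Lemma iso_der (l : seq (N * Z)) (B : 'I_n -> 'I_n -> R) : forms_check n eqs l -> antisym B ->
  (forall m, (m < size eqs)%N -> iso_eq eqs B m = 0) -> der B (lin b l) = 0.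
Proof.
move=> fc Ba B0; rewrite (forms_isotropy eqs_upper Ba fc) big1 // => m _.
by rewrite B0 ?scale0r.
Qed.

(** Conversely, only this algebra annihilates an independent form. *)
Lemma der_iso (l : seq (N * Z)) (B : 'I_n -> 'I_n -> R) : forms_check n eqs l ->
  indep_check n eqs l -> antisym B ->
  der B (lin b l) = 0 -> forall m, (m < size eqs)%N -> iso_eq eqs B m = 0.
Proof.
move=> fc ic Ba; rewrite (forms_isotropy eqs_upper Ba fc) => B0.
exact: (forms_indep ic B0).
Qed.

Lemma iso_eqB (c : R) (B B' : 'I_n -> 'I_n -> R) m :
  iso_eq eqs (fun j k => c * (B j k - B' j k)) m = c * (iso_eq eqs B m - iso_eq eqs B' m).
Proof.
rewrite /iso_eq -sumrB mulr_sumr; apply: eq_bigr => j _.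
rewrite -sumrB mulr_sumr; apply: eq_bigr => k _; ring.
Qed.

Lemma torsion_form_is_form x : all (fun t => count (bit t.1) (iota 0 n) == 3%N) (torsionm n o) ->
  is_form 3 (torsion_form x).
Proof. exact: lin_is_form. Qed.

Definition unique_check q D : bool :=
  [&& comp3_alt_check n, all (fun t => count (bit t.1) (iota 0 n) == 3%N) (torsionm n o) &
      torsion_check n eqs q D].

(** A skew torsion preserving a form whose isotropy algebra is cut out by the
    equations is unique. *)
Lemma torsion_unique (l : seq (N * Z)) q D : holonomy_check -> forms_check n eqs l ->
  indep_check n eqs l -> unique_check q D ->
  forall T : form_field R n, (forall x, is_form 3 (T x)) ->
  parallel e (torsion_connection e T) (fun=> lin b l) -> torsion_form = T.
Proof.
move=> hol fc ic /and3P[alt t3 tc] T T3 Tpar; apply/funext => x.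
apply/eqP; rewrite eq_sym -subr_eq0; apply/eqP.
apply: (three_form_eq0 (eqs := eqs) _ tc) => [I I3|i m mlt].
  by rewrite !ffunE (T3 x I I3) (torsion_form_is_form x t3 I3) subrr.
have [Aa A0] := holonomyP hol i x.
pose G := torsion_connection e T.
have Ga : antisym (fun j k => G i j k x).
  move=> j k; rewrite /G /torsion_connection (comp_alt _ _ _ _ alt) mulNr.
  have [/(_ i j k x)/eqP + _] := (levi_civitaP e (levi_civita e)).2 erefl.
  by rewrite addr_eq0 => /eqP ->; rewrite opprD.
have /eqP := Tpar i x; rewrite /cov_form fder_form_cst sub0r oppr_eq0 => /eqP.
move=> /(der_iso fc ic Ga) G0.
(* the difference of the torsions is twice that of the connections *)
rewrite (_ : (fun j k => comp (T x - torsion_form x) [:: i; j; k]) =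
    fun j k => 2 * (G i j k x - A i j k x)).
  by rewrite iso_eqB G0 // A0 // subrr mulr0.
apply/funext => j; apply/funext => k; rewrite /G /torsion_connection.
rewrite compD (_ : comp (- torsion_form x) [:: i; j; k] = - comp (torsion_form x) [:: i; j; k]).
  by field.
by rewrite -scaleN1r compZ mulN1r.
Qed.

Definition structure_check : bool :=
  [&& spin_check n eqs Q, spin_indep_check n eqs Q kappa & trace_check n Q].

Variable v : 'cV[R]_NN.
Hypothesis Qv : lin (gamw gam) Q *m v != 0.
(** The constant spinor Q v. *)
Definition eps0 : spinor_field R n NN := fun=> lin (gamw gam) Q *m v.

Variables (mul : 'rV[R]_n -> 'rV[R]_n -> 'rV[R]_n) (L : set 'rV[R]_n).

(** The isotropy algebra of the spinor Q v is cut out by the equations. *)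
Lemma clifford2_iso (B : 'I_n -> 'I_n -> R) x : structure_check -> antisym B ->
  clifford2 gam B *m eps0 x = 0 <-> forall m, (m < size eqs)%N -> iso_eq eqs B m = 0.
Proof.
move=> /and3P[sc ic _] Ba; rewrite /eps0 mulmxA (spin_isotropy eqs_upper gamP Ba sc).
split=> [B0|B0]; first exact: (spin_indep gamP ic Qv B0).
by rewrite big1 ?mul0mx // => m _; rewrite B0 ?scale0r.
Qed.

Lemma clifford2D (B B' : 'I_n -> 'I_n -> R) :
  clifford2 gam (fun j k => B j k + B' j k) = clifford2 gam B + clifford2 gam B'.
Proof.
rewrite /clifford2 -big_split; apply: eq_bigr => j _; rewrite -big_split.
by apply: eq_bigr => k _; rewrite scalerDl.
Qed.
Lemma clifford2Z c (B : 'I_n -> 'I_n -> R) :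
  clifford2 gam (fun j k => c * B j k) = c *: clifford2 gam B.
Proof.
rewrite /clifford2 scaler_sumr; apply: eq_bigr => j _; rewrite scaler_sumr.
by apply: eq_bigr => k _; rewrite scalerA.
Qed.

Variable Sm : seq (seq (N * Z)).
Hypothesis SmE : S = [seq lin b l | l <- Sm].

Lemma supersymmetric_spinorP : holonomy_check -> structure_check ->
  all (forms_check n eqs) Sm -> has (indep_check n eqs) Sm ->
  supersymmetric_spinor mul L e gam S torsion_form eps0.
Proof.
move=> hol str /allP fc /hasP[l0 l0S ic]; split.
- by move=> s; exact: smooth_cst.
- by [].
- move=> x; split=> // B Ba; rewrite (clifford2_iso x str Ba) SmE; split.
    by move=> B0 a /mapP[l lS ->]; apply: (iso_der (fc l lS)).
  move=> B0; apply: (der_iso (fc l0 l0S) ic Ba); apply: B0.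
  exact: map_f.
- move=> m x; rewrite /spin_cov.
  have -> : \col_s fder e m (fun y => eps0 y s 0) x = 0.
    by apply/colP => s; rewrite [LHS]mxE [RHS]mxE /eps0 fder_cst.
  rewrite add0r.
  have [Aa A0] := holonomyP hol m x; have := (clifford2_iso x str Aa).2 A0.
  have -> : (fun j k => A m j k x) =
      (fun j k => levi_civita e m j k x + 2^-1 * comp (torsion_form x) [:: m; j; k]).
    by apply/funext => j; apply/funext => k; rewrite /torsion_connection mulrC.
  rewrite clifford2D clifford2Z mulmxDl -scalemxAl => h.
  (* the spin connection of nabla^g + T / 2 carries the factor 1/4 *)
  have -> : 8^-1 = 4^-1 * 2^-1 :> R by field.
  by rewrite -scalerA -scalerDr h scaler0.
- move=> a k x; have [Ca C0] := curvature_holonomyP hol a k x.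
  exact/(clifford2_iso x str Ca).
Qed.

(** The Clifford element of the dilatino equation multiplied by 12, for
    E_m phi = p m / 2. *)
Definition dilatino_op : seq (seq nat * Z) := let t := torsion_table n o in
  flatten [seq (if (p m =? 0)%ZZ then [::] else [:: ([:: m], 6 * p m)%ZZ]) | m <- iota 0 n] ++
  flatten [seq flatten [seq flatten [seq
      (let c := get3 t m i j in if (c =? 0)%ZZ then [::] else
         fscale c (flin (insw n m) (mulw n [:: i] [:: j])))
    | j <- iota 0 n] | i <- iota 0 n] | m <- iota 0 n].
Definition dilatino_check : bool := fiszero (cmul n (fnorm dilatino_op) Q).

Lemma dilatinoP U : dilatino_check -> dilatino_on gam U e torsion_form phi eps0.
Proof.
move=> /(fiszeroP (gamw gam)); rewrite -cmulP // lin_norm => h x _.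
rewrite /eps0 mulmxA; set M := (X in X *m _ *m _).
suff -> : M = 12^-1 *: lin (gamw gam) dilatino_op by rewrite -scalemxAl h scaler0 mul0mx.
rewrite /dilatino_op; cbv zeta; rewrite lin_cat scalerDr; congr (_ + _).
  rewrite -lin_sum scaler_sumr; apply: eq_bigr => m _; rewrite phiE.
  case: Z.eqb_spec => [->|_]; first by rewrite mul0r scale0r lin_nil scaler0.
  have -> : lin (gamw gam) [:: ([:: val m], 6 * p m)%ZZ] = (6 * zr R (p m)) *: gam m.
    by rewrite lin_seq1 zrM /gamw [foldr _ _ _]mulmx1 gamn_ord.
  by rewrite scalerA; congr (_ *: _); field.
congr (_ *: _); rewrite -lin_sum; apply: eq_bigr => m _.
rewrite -lin_sum; apply: eq_bigr => i _; rewrite -lin_sum; apply: eq_bigr => j _.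
rewrite compmP (torsion_tableE m i j); case: Z.eqb_spec => [->|_]; first by rewrite scale0r lin_nil.
rewrite lin_scale; congr (_ *: _).
rewrite -(lin_flin (f := fun M : 'M[R]_NN => gamn gam m *m M) (b := gamw gam)).
- by rewrite -mulwP // /gamw /= !mulmx1 !gamn_ord mulmxA.
- by move=> w; exact: inswP.
- exact: mulmx_linear_r.
Qed.

End Motion.

End Solution.

(** * Products with a line *)

Section TwoForms.
Variables (R : realType) (n : nat).

Lemma covec_basis (k : 'I_n) : covec R k = basis_form R [set k]%SET.
Proof. by []. Qed.

Lemma ewedge2 (i j : 'I_n) : (i < j)%N ->
  wedge (covec R i) (wedge (covec R j) (form1 R n)) = basis_form R [set i; j]%SET.
Proof.
move=> ij.
have -> : form1 R n = basis_form R finset.set0.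
  by apply/ffunP => I; rewrite !ffunE finset.cards_eq0.
rewrite !covec_basis wedge_basis ifT; last by rewrite -setI_eq0 finset.setI0.
rewrite finset.setU0 wedgeZr wedge_basis ifT; last first.
  by rewrite disjoints1 finset.inE neq_ltn ij.
have sgn (S T : {set 'I_n}) : (forall a b : 'I_n, a \in S -> b \in T -> (a <= b)%N) ->
    shuffle_sign R S T = 1.
  move=> h; rewrite shuffle_signE big1 // => a aS; rewrite big1 // => b ba.
  by case: (boolP (b \in T)) => // bT; have := h a b aS bT; rewrite leqNgt ba.
rewrite !sgn ?scale1r // => [a b|a b _]; last by rewrite finset.inE.
by rewrite !finset.inE => /eqP -> /eqP ->; exact: ltnW.
Qed.

Lemma two_form_at (B : 'I_n -> 'I_n -> R) (i j : 'I_n) : (i < j)%N ->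
  two_form B [set i; j]%SET = B i j.
Proof.
move=> ij; rewrite /two_form !sum_ffunE (bigD1 i) //= sum_ffunE (bigD1 j) //=.
rewrite ffunE ewedge2 // ffunE eqxx.
have ne (a c : 'I_n) : (a < c)%N -> ([set i; j] == [set a; c])%SET -> a = i /\ c = j.
  move=> ac /eqP /finset.setP E.
  have := E a; have := E c; rewrite !finset.inE !eqxx !orbT /=.
  by case/orP=> /eqP cE; case/orP=> /eqP aE; move: ac ij; rewrite cE aE ?ltnn // => ij' /ltnW;
    rewrite leqNgt ij'.
rewrite big1 ?big1 ?addr0 /=; first by rewrite /GRing.scale /= mulr1.
- move=> a ai; rewrite sum_ffunE big1 // => c ac; rewrite ffunE ewedge2 // ffunE.
  case: eqP => [/eqP/(ne _ _ ac)[ai' _]|_]; last by rewrite /GRing.scale /= mulr0.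
  by rewrite ai' eqxx in ai.
- move=> c /andP[ic cj]; rewrite ffunE ewedge2 // ffunE.
  case: eqP => [/eqP/(ne _ _ ic)[_ cj']|_]; last by rewrite /GRing.scale /= mulr0.
  by rewrite cj' eqxx in cj.
Qed.

Lemma dcoframeC (e : coframe R n) k i j x : dcoframe e k i j x = - dcoframe e k j i x.
Proof. by rewrite /dcoframe opprB. Qed.

(** The structure functions are determined by the forms d e_k. *)
Lemma dcoframeP (e : coframe R n) (d : nat -> nat -> nat -> Z) :
  (forall k i j : 'I_n, d k i j = - d k j i)%ZZ ->
  (forall k x, dcov e k x = two_form (fun i j : 'I_n => zr R (d k i j))) ->
  forall k i j x, dcoframe e k i j x = zr R (d k i j).
Proof.
move=> dC dcE; suff lt (k i j : 'I_n) x : (i < j)%N -> dcoframe e k i j x = zr R (d k i j).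
  move=> k i j x; case: (ltngtP i j) => [/lt//|ji|/val_inj <-].
    by rewrite dcoframeC (lt _ _ _ _ ji) (dC k i j) zrN.
  have := dcoframeC e k i i x; have := dC k i i.
  by move=> /(congr1 (zr R)); rewrite zrN; lra.
by move=> ij; rewrite -(two_form_at (fun i j => dcoframe e k i j x) ij) -/(dcov e k x) dcE two_form_at.
Qed.

End TwoForms.

Section Derivatives.
Variable R : realType.

(** Directional derivatives commute with linear maps of the variable. *)
Lemma derive_lin m n (V : normedModType R) (f : 'rV[R]_m -> V)
    (p : 'rV[R]_n -> 'rV[R]_m) (v x : 'rV[R]_n) :
  linear p -> 'D_v (fun y => f (p y)) x = 'D_(p v) f (p x).
Proof.
move=> pl; rewrite /derive.
rewrite (_ : (fun h => h^-1 *: (((fun y => f (p y)) \o shift x) (h *: v) - f (p x))) =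
  (fun h => h^-1 *: ((f \o shift (p x)) (h *: p v) - f (p x)))) //.
by apply/funext => h /=; rewrite pl.
Qed.

(** Here p is an affine map with linear part q. *)
Lemma derivable_aff m n (V : normedModType R) (f : 'rV[R]_m -> V)
    (p q : 'rV[R]_n -> 'rV[R]_m) (v x : 'rV[R]_n) :
  (forall h y z, p (h *: y + z) = h *: q y + p z) ->
  derivable f (p x) (q v) -> derivable (fun y => f (p y)) x v.
Proof.
move=> pl; rewrite /derivable.
rewrite (_ : (fun h => h^-1 *: ((f \o shift (p x)) (h *: q v) - f (p x))) =
  (fun h => h^-1 *: (((fun y => f (p y)) \o shift x) (h *: v) - f (p x)))) //.
by apply/funext => h /=; rewrite pl.
Qed.

Lemma derive_coord n (V : normedModType R) (g : R -> V) (k : 'I_n) (v x : 'rV[R]_n) :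
  'D_v (fun y : 'rV[R]_n => g (y 0 k)) x = 'D_(v 0 k) (g : R^o -> V) (x 0 k).
Proof.
rewrite /derive.
rewrite (_ : (fun h => h^-1 *: (((fun y : 'rV[R]_n => g (y 0 k)) \o shift x) (h *: v) - g (x 0 k))) =
  (fun h => h^-1 *: (((g : R^o -> V) \o shift (x 0 k)) (h *: v 0 k) - g (x 0 k)))) //.
by apply/funext => h /=; rewrite !mxE.
Qed.

Lemma derivable_coord n (k : 'I_n) (v x : 'rV[R]_n) :
  derivable (fun y : 'rV[R]_n => y 0 k) x v.
Proof. by apply: diff_derivable; exact: differentiable_coord. Qed.

Lemma derive_coord_id n (k : 'I_n) (v x : 'rV[R]_n) :
  'D_v (fun y : 'rV[R]_n => y 0 k) x = v 0 k.
Proof. by rewrite (derive_coord (fun t : R => t : R^o)) derive_id. Qed.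

Lemma smooth_lin n (k : 'I_n) (c : R) : smooth (fun y : 'rV[R]_n => y 0 k * c).
Proof.
have d1 x : differentiable (fun y : 'rV[R]_n => y 0 k * c) x.
  by apply: differentiableM => //; exact: differentiable_coord.
elim/last_ind => [|s i _] x _ //=.
suff [c' ->] : exists c', partials (rcons s i) (fun y : 'rV[R]_n => y 0 k * c) = (fun=> c').
  by [].
elim: s => [|j s [c' IH]] /=.
  exists ((delta_mx 0 i : 'rV[R]_n) 0 k * c); apply/funext => y.
  rewrite deriveMr ?derive_coord_id //=; first by rewrite mulrC.
  exact: derivable_coord.
by exists 0; rewrite IH; apply/funext => y; exact: derive_cst.
Qed.

(** Reduction of a directional derivative to one variable. *)
Lemma derive_line n (V : normedModType R) (f : 'rV[R]_n -> V) (v x : 'rV[R]_n) :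
  'D_v f x = 'D_1 (fun t : R^o => f (t *: v + x)) 0.
Proof.
rewrite /derive.
rewrite (_ : (fun h => h^-1 *: ((f \o shift x) (h *: v) - f x)) =
  (fun h => h^-1 *: (((fun t : R^o => f (t *: v + x)) \o shift (0 : R^o)) (h *: (1 : R^o))
     - f ((0 : R) *: v + x)))) //.
apply/funext => h /=; rewrite scale0r add0r addr0; congr (_ *: (f (_ *: _ + _) - _)).
by rewrite /GRing.scale /= mulr1.
Qed.

Lemma derive_exp_lin n (k : 'I_n) (c : R) (v x : 'rV[R]_n) :
  'D_v (fun y : 'rV[R]_n => expR (- (y 0 k)) * c) x = expR (- (x 0 k)) * (- (v 0 k) * c).
Proof.
rewrite derive_line.
rewrite (_ : (fun t : R^o => _) = (fun t : R => expR (- (t * v 0 k + x 0 k)) * c)); last first.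
  by apply/funext => t; rewrite !mxE.
have D : is_derive (0 : R) 1 (fun t : R => expR (- (t * v 0 k + x 0 k)) * c)
    (expR (- x 0 k) * (- (v 0 k) * c)).
  have D1 : is_derive (0 : R) 1 (fun t : R => - (t * v 0 k + x 0 k)) (- v 0 k).
    apply: is_derive_eq.
    rewrite /GRing.scale /=; ring.
  have D2 : is_derive (0 : R) 1 (fun t : R => expR (- (t * v 0 k + x 0 k)))
     (expR (- (0 * v 0 k + x 0 k)) * (- v 0 k)).
    apply: is_derive_eq.
    by [].
  apply: is_derive_eq; rewrite /GRing.scale /= mul0r add0r; ring.
by rewrite derive_val.
Qed.

End Derivatives.

(** The coframes of the products of an n-dimensional space with a line. *)
Section ProductFrames.
Variables (R : realType) (n : nat) (e : coframe R n).
Hypothesis eU : forall x, e x \in unitmx.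

Lemma coframe_right_unit x : coframe_right e x \in unitmx.
Proof. by rewrite block_diag_mx_unit eU unitmx1. Qed.

Lemma frame_right (i : 'I_n) x :
  frame (coframe_right e) (lshift 1 i) x = row_mx (frame e i (lsubmx x)) 0.
Proof.
rewrite /frame invmx_block_diag ?coframe_right_unit //.
by rewrite block_mxEv rowKu row_row_mx row0.
Qed.

Lemma frame_right1 (i : 'I_1) x :
  frame (coframe_right e) (rshift n i) x = row_mx 0 (delta_mx 0 0).
Proof.
rewrite /frame invmx_block_diag ?coframe_right_unit // invmx1.
by rewrite block_mxEv rowKd row_row_mx row0 row1 (ord1 i).
Qed.

Lemma coframe_left_unit x : coframe_left e x \in unitmx.
Proof. by rewrite block_diag_mx_unit eU unitmx1. Qed.

Lemma frame_left (i : 'I_n) x :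
  frame (coframe_left e) (rshift 1 i) x = row_mx 0 (frame e i (rsubmx x)).
Proof.
rewrite /frame invmx_block_diag ?coframe_left_unit //.
by rewrite block_mxEv rowKd row_row_mx row0.
Qed.

Lemma frame_left1 (i : 'I_1) x :
  frame (coframe_left e) (lshift n i) x = row_mx (delta_mx 0 0) 0.
Proof.
rewrite /frame invmx_block_diag ?coframe_left_unit // invmx1.
by rewrite block_mxEv rowKu row_row_mx row0 row1 (ord1 i).
Qed.

Variable d : nat -> nat -> nat -> Z.
Hypothesis dE : forall k i j x, dcoframe e k i j x = zr R (d k i j).

Lemma dcoframe_right : (forall i j, (d n i j =? 0) && (d i n j =? 0) && (d i j n =? 0))%ZZ ->
  forall k i j x, dcoframe (coframe_right e) k i j x = zr R (d k i j).
Proof.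
move=> d0 k i j x.
have E (Y : 'rV[R]_(n + 1)) y (m : 'I_n) :
    (Y *m coframe_right e y) 0 (lshift 1 m) = (lsubmx Y *m e (lsubmx y)) 0 m.
  by rewrite /coframe_right -{1}(hsubmxK Y) mul_row_block !mulmx0 addr0 row_mxEl.
have E1 (Y : 'rV[R]_(n + 1)) y (m : 'I_1) :
    (Y *m coframe_right e y) 0 (rshift n m) = Y 0 (rshift n m).
  rewrite /coframe_right -{1}(hsubmxK Y) mul_row_block !mulmx0 add0r mulmx1 row_mxEr.
  by rewrite mxE.
have D (Y X : 'rV[R]_(n + 1)) (m : 'I_n) :
    'D_X (fun y => (Y *m coframe_right e y) 0 (lshift 1 m)) x =
    'D_(lsubmx X) (fun y => (lsubmx Y *m e y) 0 m) (lsubmx x).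
  rewrite -(derive_lin (fun y => (lsubmx Y *m e y) 0 m) _ _ (@linearP _ _ _ _ lsubmx)).
  by congr ('D_X _ x); apply/funext => y; rewrite E.
rewrite /dcoframe; have [m ->|m ->] := split_ordP k; last first.
  rewrite (_ : (fun y => _) = cst (frame (coframe_right e) j x 0 (rshift n m))); last first.
    by apply/funext => y; rewrite E1.
  rewrite (_ : (fun y => _) = cst (frame (coframe_right e) i x 0 (rshift n m))); last first.
    by apply/funext => y; rewrite E1.
  rewrite !derive_cst subrr /= (ord1 m) addn0.
  by have /andP[/andP[/Z.eqb_eq -> _] _] := d0 i j.
rewrite !D; have [i' ->|i' ->] := split_ordP i; last first.
  rewrite frame_right1 row_mxKl derive0 sub0r.
  rewrite (_ : (fun y => _) = cst 0); last by apply/funext => y; rewrite mul0mx mxE.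
  rewrite derive_cst oppr0 /= (ord1 i') addn0.
  by have /andP[/andP[_ /Z.eqb_eq ->] _] := d0 m j.
have [j' ->|j' ->] := split_ordP j; last first.
  rewrite frame_right1 row_mxKl derive0 subr0.
  rewrite (_ : (fun y => _) = cst 0); last by apply/funext => y; rewrite mul0mx mxE.
  rewrite derive_cst /= (ord1 j') addn0.
  by have /andP[_ /Z.eqb_eq ->] := d0 m i'.
by rewrite !frame_right !row_mxKl -(dE _ _ _ (lsubmx x)).
Qed.

Lemma dcoframe_left (d' : nat -> nat -> nat -> Z) :
  (forall k i j, d' k.+1 i.+1 j.+1 = d k i j) ->
  (forall i j, (d' 0%N i j =? 0) && (d' i 0%N j =? 0) && (d' i j 0%N =? 0))%ZZ ->
  forall k i j x, dcoframe (coframe_left e) k i j x = zr R (d' k i j).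
Proof.
move=> d'S d0 k i j x.
have E (Y : 'rV[R]_(1 + n)) y (m : 'I_n) :
    (Y *m coframe_left e y) 0 (rshift 1 m) = (rsubmx Y *m e (rsubmx y)) 0 m.
  by rewrite /coframe_left -{1}(hsubmxK Y) mul_row_block !mulmx0 add0r row_mxEr.
have E1 (Y : 'rV[R]_(1 + n)) y (m : 'I_1) :
    (Y *m coframe_left e y) 0 (lshift n m) = Y 0 (lshift n m).
  rewrite /coframe_left -{1}(hsubmxK Y) mul_row_block !mulmx0 addr0 mulmx1 row_mxEl.
  by rewrite mxE.
have D (Y X : 'rV[R]_(1 + n)) (m : 'I_n) :
    'D_X (fun y => (Y *m coframe_left e y) 0 (rshift 1 m)) x =
    'D_(rsubmx X) (fun y => (rsubmx Y *m e y) 0 m) (rsubmx x).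
  rewrite -(derive_lin (fun y => (rsubmx Y *m e y) 0 m) _ _ (@linearP _ _ _ _ rsubmx)).
  by congr ('D_X _ x); apply/funext => y; rewrite E.
rewrite /dcoframe; have [m ->|m ->] := split_ordP k.
  rewrite (_ : (fun y => _) = cst (frame (coframe_left e) j x 0 (lshift n m))); last first.
    by apply/funext => y; rewrite E1.
  rewrite (_ : (fun y => _) = cst (frame (coframe_left e) i x 0 (lshift n m))); last first.
    by apply/funext => y; rewrite E1.
  rewrite !derive_cst subrr /= (ord1 m).
  by have /andP[/andP[/Z.eqb_eq -> _] _] := d0 i j.
rewrite !D; have [i' ->|i' ->] := split_ordP i.
  rewrite frame_left1 row_mxKr derive0 sub0r.
  rewrite (_ : (fun y => _) = cst 0); last by apply/funext => y; rewrite mul0mx mxE.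
  rewrite derive_cst oppr0 /= (ord1 i') add1n.
  by have /andP[/andP[_ /Z.eqb_eq ->] _] := d0 m.+1 j.
have [j' ->|j' ->] := split_ordP j.
  rewrite frame_left1 row_mxKr derive0 subr0.
  rewrite (_ : (fun y => _) = cst 0); last by apply/funext => y; rewrite mul0mx mxE.
  rewrite derive_cst /= (ord1 j') !add1n.
  by have /andP[_ /Z.eqb_eq ->] := d0 m.+1 i'.+1.
by rewrite !frame_left !row_mxKr /= !add1n d'S -(dE _ _ _ (rsubmx x)).
Qed.

End ProductFrames.

(** * Lattices *)

Section Translations.
Variable R : realType.

Lemma continuous_coordP (T : topologicalType) n (f : T -> 'rV[R]_n) :
  (forall j, continuous (fun x => f x 0 j : R)) -> continuous f.
Proof.
move=> fc x; apply/cvg_ballP => eps eps0.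
have : \forall y \near x, forall j, ball (f x 0 j) eps (f y 0 j).
  apply: filter_forall => j; have /cvg_ballP/(_ _ eps0) := fc j x; exact.
apply: filterS => y h; split=> // i j; rewrite ord1; exact: h.
Qed.

Lemma coord_le_norm n (x : 'rV[R]_n) j : `|x 0 j| <= `|x|.
Proof. by rewrite [leRHS]mx_normrE; exact: (le_bigmax _ (fun ij => `|x ij.1 ij.2|) (0, j)). Qed.

Variable n : nat.
Local Notation pt := 'rV[R]_n.
Variables (mul : pt -> pt -> pt) (one : pt) (inv : pt -> pt).

(** Left translations have directional derivatives. *)
Definition trans_derivable : Prop := forall l y w, derivable (mul l) y w.

Lemma row_aff (l : pt) (h : R) (y z : pt) :
  row_mx l (h *: y + z) = h *: row_mx 0 y + row_mx l z :> 'rV[R]_(n + n).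
Proof. by rewrite scale_row_mx add_row_mx scaler0 add0r. Qed.

Hypothesis G : lie_group mul one inv.

Lemma mul_differentiable j z :
  differentiable (fun z : 'rV[R]_(n + n) => mul (lsubmx z) (rsubmx z) 0 j) z.
Proof. by case: G => _ _ _ /(_ j)/(_ [::] z) h _; exact: h. Qed.

Lemma lie_group_derivable : trans_derivable.
Proof.
move=> l y w; apply/derivable_mxP => i j; rewrite (ord1 i).
rewrite (_ : (fun x => _) = fun x => (fun z => mul (lsubmx z) (rsubmx z) 0 j) (row_mx l x)).
  apply: (derivable_aff (f := fun z : 'rV[R]_(n + n) => mul (lsubmx z) (rsubmx z) 0 j)
    (p := fun x => row_mx l x) (q := fun x => row_mx 0 x) (row_aff l)).
  by apply: diff_derivable; exact: mul_differentiable.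
by apply/funext => x; rewrite row_mxKl row_mxKr.
Qed.

Lemma lie_group_continuous l : continuous (mul l).
Proof.
apply: continuous_coordP => j x.
rewrite (_ : (fun x => _) = (fun z => mul (lsubmx z) (rsubmx z) 0 j) \o (row_mx l)); last first.
  by apply/funext => y /=; rewrite row_mxKl row_mxKr.
apply: continuous_comp; last first.
  exact: differentiable_continuous (mul_differentiable _ _).
apply: continuous_coordP => k; have [k' ->|k' ->] := split_ordP k.
  rewrite (_ : (fun x => _) = cst (l 0 k')); first exact: cst_continuous.
  by apply/funext => y; rewrite row_mxEl.
rewrite (_ : (fun x => _) = (fun y : pt => y 0 k')); first exact: coord_continuous.
by apply/funext => y; rewrite row_mxEr.
Qed.

End Translations.

Section Cocompact.
Variables (R : realType) (n : nat).
Local Notation pt := 'rV[R]_n.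
Variables (mul : pt -> pt -> pt) (one : pt) (inv : pt -> pt) (L : set pt).

(** Every orbit meets a fixed box. *)
Definition cocompact : Prop := exists M : R, forall x, exists2 l, L l &
  forall j, `|mul l x 0 j| <= M.

Hypotheses (mulA : associative mul) (mul1 : left_id one mul).
Hypothesis mulV : left_inverse one inv mul.
Hypothesis L_dis : discrete_subgroup mul one inv L.

Let Q := quotient_space mul L.
Let proj (x : pt) : Q := \pi_({eq_quot same_orbit mul L})%qT x.

Lemma proj_eq x y : proj x = proj y <-> orbit mul L x = orbit mul L y.
Proof.
by split=> [/eqmodP/asboolP|xy]; last by apply/eqmodP/asboolP.
Qed.

Lemma orbit_refl x : orbit mul L x x.
Proof. by case: L_dis => L1 _ _ _; exists one => //; rewrite mul1. Qed.

Lemma orbit_mul l x : L l -> orbit mul L (mul l x) = orbit mul L x.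
Proof.
case: L_dis => L1 LM LV _ Ll; apply/seteqP; split=> _ [k Lk <-].
  by exists (mul k l); [exact: LM | rewrite mulA].
exists (mul k (inv l)); first exact/LM/LV.
by rewrite -mulA (mulA (inv l)) mulV mul1.
Qed.

Lemma proj_continuous : continuous proj.
Proof. exact: pi_continuous. Qed.

Lemma proj_surj (q : Q) : exists x, proj x = q.
Proof. by exists (repr q); exact: reprK. Qed.

(** The box is compact and projects onto the quotient. *)
Lemma cocompact_compact : cocompact -> compact [set: Q].
Proof.
move=> [M LM].
have K : compact [set v : pt | forall i, `[- M, M]%classic (v ord0 i)].
  by apply: (@rV_compact _ _ (fun=> `[- M, M]%classic)) => _; exact: segment_compact.
rewrite (_ : [set: Q] = proj @` [set v : pt | forall i, `[- M, M]%classic (v ord0 i)]).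
  apply: continuous_compact K; apply: continuous_subspaceT; exact: proj_continuous.
apply/seteqP; split=> // q _; have [x <-] := proj_surj q.
have [l Ll lx] := LM x; exists (mul l x); last by apply/proj_eq; exact: orbit_mul.
by move=> i /=; rewrite in_itv /= -ler_norml.
Qed.

(** Otherwise the complements of the projections of balls generate a proper
    filter on the quotient.  It has a cluster point; but the projection of a large
    ball is a neighbourhood of that point, the projection being open. *)
Lemma compact_cocompact : (forall l, continuous (mul l)) -> compact [set: Q] -> cocompact.
Proof.
move=> mulC Qc; apply: contrapT => nco.
pose B (M : R) : set Q := [set q | exists2 x, proj x = q & `|x| < M].
have nB M : exists x, ~ B M (proj x).
  apply: contrapT => h; apply: nco; exists M => x.
  have : B M (proj x) by apply: contrapT => Bx; apply: h; exists x.
  move=> [y /proj_eq yx yM]; have := orbit_refl y; rewrite yx => -[l Ll lxy].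
  exists l => // j; rewrite lxy; exact: le_trans (coord_le_norm _ _) (ltW yM).
(* the projections of balls increase, so their complements form a filter base *)
pose F := filter_from [set: R] (fun M => ~` B M).
have FF : ProperFilter F.
  apply: filter_from_proper; last by move=> M _; have [x] := nB M; exists (proj x).
  apply: filter_from_filter; first by exists 0.
  move=> M M' _ _; exists (Num.max M M') => // q nq; split=> -[x xq xM]; apply: nq;
    by exists x => //; rewrite lt_max xM ?orbT.
have [q [_ qF]] : [set: Q] `&` cluster F !=set0 by apply: Qc => //; exact: filterT.
have [x xq] := proj_surj q.
have FB : F (~` B (`|x| + 1)) by exists (`|x| + 1).
have Bn : nbhs q (B (`|x| + 1)).
  apply: open_nbhs_nbhs; split; last by exists x => //; rewrite ltrDl.
  rewrite /open /= /quotient_open.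
  (* the preimage of the projection of a ball is the union of its translates *)
  rewrite (_ : _ @^-1` _ = \bigcup_(l in L) [set y | `|mul l y| < `|x| + 1]).
    apply: bigcup_open => l _.
    rewrite (_ : [set y | _] = (fun y => `|mul l y|) @^-1` [set t | t < `|x| + 1]) //.
    apply: open_comp; last exact: open_lt.
    move=> y _; apply: continuous_comp; [exact: mulC|exact: norm_continuous].
  apply/seteqP; split=> [y [z /proj_eq zy zM]|y [l Ll lM]].
    by have := orbit_refl z; rewrite zy => -[l Ll lyz]; exists l => //=; rewrite lyz.
  by exists (mul l y) => //; apply/proj_eq; exact: orbit_mul.
by have [z [nz /nz]] := qF _ _ FB Bn.
Qed.

End Cocompact.

Section ProductGroups.
Variables (R : realType) (n : nat).
Local Notation pt := 'rV[R]_n.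
Variables (mul : pt -> pt -> pt) (one : pt) (inv : pt -> pt) (e : coframe R n).

(** The algebraic part of the notion of Lie group. *)
Definition group_laws (m : nat) (mu : 'rV[R]_m -> 'rV[R]_m -> 'rV[R]_m) u v : Prop :=
  [/\ associative mu, left_id u mu, right_id u mu & left_inverse u v mu].

Lemma lie_group_laws : lie_group mul one inv -> group_laws mul one inv.
Proof. by case=> mA [m1 m1r] [mV _] _ _. Qed.

Lemma group_right : group_laws mul one inv ->
  group_laws (mul_right mul) (one_right one) (inv_right inv).
Proof.
case=> mA m1 m1r mV; split.
- by move=> x y z; rewrite /mul_right !row_mxKl !row_mxKr mA addrA.
- by move=> x; rewrite /mul_right /one_right row_mxKl row_mxKr m1 add0r hsubmxK.
- by move=> x; rewrite /mul_right /one_right row_mxKl row_mxKr m1r addr0 hsubmxK.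
- by move=> x; rewrite /mul_right /inv_right row_mxKl row_mxKr mV addNr.
Qed.

Lemma group_left : group_laws mul one inv ->
  group_laws (mul_left mul) (one_left one) (inv_left inv).
Proof.
case=> mA m1 m1r mV; split.
- by move=> x y z; rewrite /mul_left !row_mxKl !row_mxKr mA addrA.
- by move=> x; rewrite /mul_left /one_left row_mxKl row_mxKr m1 add0r hsubmxK.
- by move=> x; rewrite /mul_left /one_left row_mxKl row_mxKr m1r addr0 hsubmxK.
- by move=> x; rewrite /mul_left /inv_left row_mxKl row_mxKr mV addNr.
Qed.

Lemma trivial_discrete : group_laws mul one inv -> discrete_subgroup mul one inv [set one].
Proof.
case=> mA m1 m1r mV; have i1 : inv one = one by rewrite -[LHS]m1r mV.
split=> //.
- by move=> _ _ -> ->; rewrite m1.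
- by move=> _ ->.
- by exists setT; split=> //; exact: openT.
Qed.

Lemma derivable_right : trans_derivable mul -> trans_derivable (mul_right mul).
Proof.
move=> mD l y w; apply/derivable_mxP => i j; rewrite (ord1 i).
have [k ->|k ->] := split_ordP j.
  rewrite (_ : (fun x => _) = fun x : 'rV[R]_(n + 1) => mul (lsubmx l) (lsubmx x) 0 k).
    apply: (derivable_aff (f := fun z => mul (lsubmx l) z 0 k) (p := lsubmx) (q := lsubmx)).
      by move=> h u v; rewrite linearP.
    by have /derivable_mxP := mD (lsubmx l) (lsubmx y) (lsubmx w); exact.
  by apply/funext => x; rewrite row_mxEl.
rewrite (_ : (fun x => _) = fun x : 'rV[R]_(n + 1) => rsubmx l 0 k + x 0 (rshift n k)).
  by apply: derivableD; [exact: derivable_cst | exact: derivable_coord].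
by apply/funext => x; rewrite row_mxEr !mxE.
Qed.

Lemma derivable_left : trans_derivable mul -> trans_derivable (mul_left mul).
Proof.
move=> mD l y w; apply/derivable_mxP => i j; rewrite (ord1 i).
have [k ->|k ->] := split_ordP j; last first.
  rewrite (_ : (fun x => _) = fun x : 'rV[R]_(1 + n) => mul (rsubmx l) (rsubmx x) 0 k).
    apply: (derivable_aff (f := fun z => mul (rsubmx l) z 0 k) (p := rsubmx) (q := rsubmx)).
      by move=> h u v; rewrite linearP.
    by have /derivable_mxP := mD (rsubmx l) (rsubmx y) (rsubmx w); exact.
  by apply/funext => x; rewrite row_mxEr.
rewrite (_ : (fun x => _) = fun x : 'rV[R]_(1 + n) => lsubmx l 0 k + x 0 (lshift n k)).
  by apply: derivableD; [exact: derivable_cst | exact: derivable_coord].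
by apply/funext => x; rewrite row_mxEl !mxE.
Qed.

Lemma derive_translation_coord (c : R) m (k : 'I_m) (v x : 'rV[R]_m) :
  'D_v (fun y : 'rV[R]_m => c + y 0 k) x = v 0 k.
Proof.
rewrite deriveD; [|exact: derivable_cst|exact: derivable_coord].
by rewrite derive_cst add0r derive_coord_id.
Qed.

Lemma invariant_right : trans_derivable mul -> translation_invariant mul setT e ->
  translation_invariant (mul_right mul) setT (coframe_right e).
Proof.
move=> mD einv l _ x v.
have -> : 'D_v (mul_right mul l) x =
    row_mx ('D_(lsubmx v) (mul (lsubmx l)) (lsubmx x)) (rsubmx v).
  rewrite derive_mx; last exact: derivable_right.
  apply/rowP => j; rewrite mxE; have [k ->|k ->] := split_ordP j.
    rewrite row_mxEl derive_mx ?mxE; last exact: mD.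
    rewrite -(derive_lin (fun z => mul (lsubmx l) z 0 k) _ _ (@linearP _ _ _ _ lsubmx)).
    by congr ('D_v _ x); apply/funext => y; rewrite row_mxEl.
  rewrite row_mxEr mxE -(derive_translation_coord (rsubmx l 0 k) _ v x).
  by congr ('D_v _ x); apply/funext => y; rewrite row_mxEr !mxE.
rewrite /coframe_right -[in RHS](hsubmxK v) !mul_row_block !mulmx0 !mulmx1 !addr0 !add0r.
by rewrite /mul_right row_mxKl einv.
Qed.

Lemma invariant_left : trans_derivable mul -> translation_invariant mul setT e ->
  translation_invariant (mul_left mul) setT (coframe_left e).
Proof.
move=> mD einv l _ x v.
have -> : 'D_v (mul_left mul l) x =
    row_mx (lsubmx v) ('D_(rsubmx v) (mul (rsubmx l)) (rsubmx x)).
  rewrite derive_mx; last exact: derivable_left.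
  apply/rowP => j; rewrite mxE; have [k ->|k ->] := split_ordP j; last first.
    rewrite row_mxEr derive_mx ?mxE; last exact: mD.
    rewrite -(derive_lin (fun z => mul (rsubmx l) z 0 k) _ _ (@linearP _ _ _ _ rsubmx)).
    by congr ('D_v _ x); apply/funext => y; rewrite row_mxEr.
  rewrite row_mxEl mxE -(derive_translation_coord (lsubmx l 0 k) _ v x).
  by congr ('D_v _ x); apply/funext => y; rewrite row_mxEl !mxE.
rewrite /coframe_left -[in RHS](hsubmxK v) !mul_row_block !mulmx0 !mulmx1 !addr0 !add0r.
by rewrite /mul_left row_mxKr einv.
Qed.

(** Discrete subgroups of the line. *)
Definition discrete_line (Z : set R) : Prop :=
  [/\ Z 0, forall s t, Z s -> Z t -> Z (s + t), forall t, Z t -> Z (- t) &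
    exists2 r : R, 0 < r & forall t, Z t -> `|t| < r -> t = 0].

Lemma discrete_line0 : discrete_line [set 0].
Proof.
split=> //; first by move=> _ _ -> ->; rewrite addr0.
- by move=> _ ->; rewrite oppr0.
- by exists 1.
Qed.

Lemma discrete_multiples (c : R) : 0 < c -> discrete_line (multiples c).
Proof.
move=> c0; split.
- by exists 0; rewrite mul0r.
- by move=> _ _ [k ->] [m ->]; exists (k + m); rewrite intrD mulrDl.
- by move=> _ [k ->]; exists (- k); rewrite mulrNz mulNr.
- exists c => // _ [k ->]; rewrite normrM (gtr0_norm c0) -ltr_pdivlMr // divff ?gt_eqF //.
  rewrite -intr_norm -[1]/(1%:~R) ltr_int => k1.
  have -> : k = 0 by lia.
  by rewrite mul0r.
Qed.

Lemma multiples_cocompact (c : R) : 0 < c ->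
  forall t, exists2 s, multiples c s & `|s + t| <= c.
Proof.
move=> c0 t; exists ((- Num.floor (t / c))%:~R * c); first by exists (- Num.floor (t / c)).
have /andP[lo hi] := real_floor_itv (num_real (t / c)).
have tE : t = t / c * c by rewrite divfK ?gt_eqF.
rewrite {2}tE -mulrDl mulrNz normrM (gtr0_norm c0) ler_piMl ?ltW // ger0_norm; last by lra.
by move: hi; rewrite intrD; lra.
Qed.

Lemma discrete_right L Z : discrete_subgroup mul one inv L -> discrete_line Z ->
  discrete_subgroup (mul_right mul) (one_right one) (inv_right inv) (lattice_right L Z).
Proof.
move=> [L1 LM LV [U [Uo U1 UL]]] [Z0 ZD ZN [r r0 Zr]]; split.
- by split; rewrite /one_right ?row_mxKl ?row_mxKr ?mxE.
- move=> x y [Lx Zx] [Ly Zy]; split; rewrite /mul_right ?row_mxKl ?row_mxKr ?mxE.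
    exact: LM.
  by have := ZD _ _ Zx Zy; rewrite !mxE.
- move=> x [Lx Zx]; split; rewrite /inv_right ?row_mxKl ?row_mxKr ?mxE; first exact: LV.
  by have := ZN _ Zx; rewrite !mxE.
- exists ((fun x : 'rV[R]_(n + 1) => lsubmx x) @^-1` U `&`
    (fun x : 'rV[R]_(n + 1) => `|x 0 (rshift n 0)|) @^-1` [set t | t < r]); split.
  + apply: openI; first by apply: open_comp => // x _; exact: continuous_lsubmx.
    apply: open_comp; last exact: open_lt.
    by move=> x _; apply: continuous_comp; [exact: coord_continuous | exact: norm_continuous].
  + by split; rewrite /= /one_right ?row_mxKl // row_mxEr mxE normr0.
  + move=> x [[/= Ux xr] [Lx Zx]]; rewrite /= -(hsubmxK x); congr row_mx.
      by apply: UL.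
    by apply/rowP => j; rewrite (ord1 j) [RHS]mxE; apply: Zr => //; rewrite mxE.
Qed.

Lemma discrete_left L Z : discrete_subgroup mul one inv L -> discrete_line Z ->
  discrete_subgroup (mul_left mul) (one_left one) (inv_left inv) (lattice_left Z L).
Proof.
move=> [L1 LM LV [U [Uo U1 UL]]] [Z0 ZD ZN [r r0 Zr]]; split.
- by split; rewrite /one_left ?row_mxKl ?row_mxKr ?mxE.
- move=> x y [Zx Lx] [Zy Ly]; split; rewrite /mul_left ?row_mxKl ?row_mxKr ?mxE.
    by have := ZD _ _ Zx Zy; rewrite !mxE.
  exact: LM.
- move=> x [Zx Lx]; split; rewrite /inv_left ?row_mxKl ?row_mxKr ?mxE; last exact: LV.
  by have := ZN _ Zx; rewrite !mxE.
- exists ((fun x : 'rV[R]_(1 + n) => rsubmx x) @^-1` U `&`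
    (fun x : 'rV[R]_(1 + n) => `|x 0 (lshift n 0)|) @^-1` [set t | t < r]); split.
  + apply: openI; first by apply: open_comp => // x _; exact: continuous_rsubmx.
    apply: open_comp; last exact: open_lt.
    by move=> x _; apply: continuous_comp; [exact: coord_continuous | exact: norm_continuous].
  + by split; rewrite /= /one_left ?row_mxKr // row_mxEl mxE normr0.
  + move=> x [[/= Ux xr] [Zx Lx]]; rewrite /= -(hsubmxK x); congr row_mx; last by apply: UL.
    by apply/rowP => j; rewrite (ord1 j) [RHS]mxE; apply: Zr => //; rewrite mxE.
Qed.

Lemma cocompact_right L c : 0 < c -> cocompact mul L ->
  cocompact (mul_right mul) (lattice_right L (multiples c)).
Proof.
move=> c0 [M LM]; exists (Num.max M c) => x.
have [l Ll lx] := LM (lsubmx x).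
have [s Zs sx] := multiples_cocompact c0 (x 0 (rshift n 0)).
exists (row_mx l (const_mx s : 'rV_1)).
  by split; rewrite ?row_mxKl ?row_mxKr // mxE.
move=> j; rewrite /mul_right row_mxKl row_mxKr le_max; have [k ->|k ->] := split_ordP j.
  by rewrite row_mxEl lx.
by rewrite row_mxEr (ord1 k) !mxE sx orbT.
Qed.

Lemma cocompact_left L c : 0 < c -> cocompact mul L ->
  cocompact (mul_left mul) (lattice_left (multiples c) L).
Proof.
move=> c0 [M LM]; exists (Num.max M c) => x.
have [l Ll lx] := LM (rsubmx x).
have [s Zs sx] := multiples_cocompact c0 (x 0 (lshift n 0)).
exists (row_mx (const_mx s : 'rV_1) l).
  by split; rewrite ?row_mxKl ?row_mxKr // mxE.
move=> j; rewrite /mul_left row_mxKl row_mxKr le_max; have [k ->|k ->] := split_ordP j.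
  by rewrite row_mxEl (ord1 k) !mxE sx orbT.
by rewrite row_mxEr lx.
Qed.

Lemma uniform_latticeP L : group_laws mul one inv -> discrete_subgroup mul one inv L ->
  cocompact mul L -> uniform_lattice mul one inv L.
Proof. by case=> mA m1 _ mV dL cL; split=> //; exact: (cocompact_compact mA m1 mV dL cL). Qed.

End ProductGroups.

(** * The metric is not conformally flat *)

Section Conformal.
Variables (R : realType) (n : nat) (e : coframe R n) (d : nat -> nat -> nat -> Z).
Hypothesis es : smooth_coframe e.
Hypothesis dE : forall k i j x, dcoframe e k i j x = zr R (d k i j).
Variables (f : 'rV[R]_n -> R) (y : 'rV[R]_n).
Hypothesis fd : differentiable f y.
Local Notation e' := (rescale f e).
Local Notation s := (expR (- f y)).
Local Notation df i := (fder e i f y).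

(** The frame dual to the coframe e^f e_k is e^(- f) E_k. *)
Lemma frame_rescale i : frame e' i y = s *: frame e i y.
Proof.
rewrite /frame /rescale invmxZ; last by rewrite unitmxZ ?unitfE ?gt_eqF ?expR_gt0 // es.2.
by rewrite -expRN; apply/rowP => j; rewrite !mxE.
Qed.

Lemma frame_dual i k : (frame e i y *m e y) 0 k = (i == k)%:R.
Proof. by rewrite /frame -row_mul mulVmx ?es.2 // !mxE. Qed.

Lemma coframe_differentiable (Y : 'rV[R]_n) k z : differentiable (fun z => (Y *m e z) 0 k) z.
Proof.
rewrite (_ : (fun z => _) = \sum_p (fun z => Y 0 p * e z p k)); last first.
  by apply/funext => u; rewrite mxE fct_sumE.
apply: differentiable_sum => p; apply: differentiableM => //.
exact: (es.1 p k [::] z I).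
Qed.

Lemma deriveZdir (g : 'rV[R]_n -> R) (c : R) (v : 'rV[R]_n) : differentiable g y ->
  'D_(c *: v) g y = c * 'D_v g y.
Proof. by move=> gd; rewrite !deriveE // linearZ. Qed.

(** The factor e^(- f(y)) of the vectors X and Y is a constant here; it cancels
    one factor e^f of the coframe. *)
Lemma derive_rescale (X Y : 'rV[R]_n) k :
  'D_(s *: X) (fun z => ((s *: Y) *m e' z) 0 k) y =
  s * ('D_X (fun z => (Y *m e z) 0 k) y + (Y *m e y) 0 k * 'D_X f y).
Proof.
have hd := coframe_differentiable Y k y.
have Ed : differentiable (fun z => expR (f z)) y.
  by apply: (differentiable_comp (g := expR)) => //; apply/derivable1_diffP; exact: derivable_expR.
have -> : (fun z => ((s *: Y) *m e' z) 0 k) =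
    (fun z => s * (expR (f z) * (Y *m e z) 0 k)).
  by apply/funext => z; rewrite /rescale -scalemxAl -scalemxAr !mxE.
rewrite deriveZdir; last by do 2![apply: differentiableM => //].
rewrite (deriveMl (f := fun z => expR (f z) * (Y *m e z) 0 k)); last first.
  by apply: diff_derivable; apply: differentiableM.
rewrite (deriveM (f := fun z => expR (f z))); try exact: diff_derivable.
have -> : 'D_X (fun z => expR (f z)) y = expR (f y) * 'D_X f y.
  rewrite deriveE // (diff_comp (g := expR) fd) /=; last first.
    by apply/derivable1_diffP; exact: derivable_expR.
  rewrite -(deriveE X fd); set u := 'D_X f y.
  have -> : u = u *: (1 : R^o) by rewrite /GRing.scale /= mulr1.
  rewrite linearZ -deriveE; last by apply/derivable1_diffP; exact: derivable_expR.
  transitivity (u * 'D_1 (expR : R -> R) (f y)) => //.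
  by rewrite derive_val /GRing.scale /= mulr1 mulrC.
have sE : s * expR (f y) = 1 by rewrite expRN mulVf // gt_eqF ?expR_gt0.
move: ('D_X f y) ('D_X _ y) ((Y *m e y) 0 k) => D1 D2 c.
rewrite /GRing.scale /= (_ : s * (s * _) = s * (s * expR (f y) * (D2 + c * D1))).
  by rewrite sE mul1r.
by ring.
Qed.

Lemma dcoframe_rescale k i j : dcoframe e' k i j y =
  s * (zr R (d k i j) + (j == k)%:R * df i - (i == k)%:R * df j).
Proof.
rewrite /dcoframe !frame_rescale !derive_rescale !frame_dual -(dE k i j y) /dcoframe /fder.
move: ('D_(frame e i y) f y) ('D_(frame e j y) f y) ('D_(frame e i y) _ y) => ? ? ?.
by move: ('D_ _ _ y) (expR _) (j == k)%:R (i == k)%:R => ? ? ? ?; ring.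
Qed.

Lemma bracket_rescale i j k : bracket e' i j k y =
  s * (zr R (bracketm d i j k) - (j == k)%:R * df i + (i == k)%:R * df j).
Proof. rewrite /bracket dcoframe_rescale /bracketm zrN; ring. Qed.

(** The connection of e^(2 f) g in the rescaled frame. *)
Lemma levi_civita_rescale i j k : levi_civita e' i j k y =
  s * (zr R (levi_civitam d i j k) / 2 + (i == k)%:R * df j - (i == j)%:R * df k).
Proof.
rewrite /levi_civita !bracket_rescale /levi_civitam; move: (bracketm d i j k) (bracketm d j k i) (bracketm d k i j) => u v w.
rewrite zrD zrB (eq_sym k i) (eq_sym j i) (eq_sym k j).
move: (zr R u) (zr R v) (zr R w) (expR _) (df i) (df j) (df k) => ? ? ? ? ? ? ?.
by move: (i == k)%:R (j == k)%:R (i == j)%:R => ? ? ?; field.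
Qed.

End Conformal.

(** The component R_2314 of the curvature of e^(2 f) g in the rescaled frame is
    that of g times e^(- 2 f): the derivatives of f enter the connection only
    through coefficients with a repeated index, and these cancel. *)
Lemma not_conformally_flat (R : realType) (e : coframe R 6) : smooth_coframe e ->
  (forall k i j x, dcoframe e k i j x = zr R (dcoframem 0 k i j)) -> ~ conformally_flat e.
Proof.
move=> es dE /(_ 0) [U [f [Uo U0 fs flat]]].
have fd y : U y -> differentiable f y by exact: (fs [::] y).
(* i, j, a, b stand for the 1-based indices 2, 3, 1, 4 *)
pose i : 'I_6 := Ordinal (isT : 1 < 6)%N; pose j : 'I_6 := Ordinal (isT : 2 < 6)%N.
pose a : 'I_6 := Ordinal (isT : 0 < 6)%N; pose b : 'I_6 := Ordinal (isT : 3 < 6)%N.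
pose c5 : 'I_6 := Ordinal (isT : 5 < 6)%N.
pose e' := rescale f e; pose G := levi_civita e'.
have GE y : U y -> forall i j k, G i j k y = expR (- f y) *
    (zr R (levi_civitam (dcoframem 0) i j k) / 2 + (i == k)%:R * fder e j f y - (i == j)%:R * fder e k f y).
  by move=> Uy i' j' k'; apply: (levi_civita_rescale es dE); exact: fd.
have BE y : U y -> forall i j k, bracket e' i j k y = expR (- f y) *
    (zr R (bracketm (dcoframem 0) i j k) - (j == k)%:R * fder e i f y + (i == k)%:R * fder e j f y).
  by move=> Uy i' j' k'; apply: (bracket_rescale es dE); exact: fd.
have der0 m p q r : (forall y, U y -> G p q r y = 0) -> fder e' m (G p q r) 0 = 0.
  move=> G0; rewrite /fder (near_eq_derive (g := cst 0)) ?derive_cst //.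
  by have := open_nbhs_nbhs (conj Uo U0); apply: filterS => y; exact: G0.
(* these coefficients are closed terms: rewriting with one of the equations
   below may also replace another coefficient that evaluates to the same value,
   and the next ones are then optional *)
have Lz p q r : (levi_civitam (dcoframem 0) p q r =? 0)%ZZ -> zr R (levi_civitam (dcoframem 0) p q r) = 0.
  by move=> /Z.eqb_eq ->.
have ne (p q : 'I_6) : val p != val q -> (p == q)%:R = 0 :> R.
  by move=> pq; rewrite (_ : (p == q) = false) //; apply/negbTE.
have := flat 0 U0 i j a b; rewrite /curvature -/e' -/G.
rewrite (der0 i j a b); last first.
  by move=> y Uy; rewrite GE // ?(Lz 2 0 3 isT)%N ?(ne j b) // ?(ne j a) //; ring.
rewrite (der0 j i a b); last first.
  by move=> y Uy; rewrite GE // ?(Lz 1 0 3 isT)%N ?(ne i b) // ?(ne i a) //; ring.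
rewrite subr0 add0r -sumrB => /eqP.
have tab : all (fun c => [&& levi_civitam (dcoframem 0) 2 0 c =? 0, levi_civitam (dcoframem 0) 1 c 3 =? 0,
    levi_civitam (dcoframem 0) 1 0 c =? 0, levi_civitam (dcoframem 0) 2 c 3 =? 0 & levi_civitam (dcoframem 0) c 0 3 =? 0])%ZZ
    (iota 0 5) by vm_compute.
(* only the index c = 6 contributes: Gamma_316 Gamma_264 *)
rewrite (bigD1 c5) //= big1 ?addr0; last first.
  move=> c cn; have clt : (c < 5)%N.
    by rewrite ltn_neqAle -ltnS ltn_ord andbT; apply: contra cn => /eqP h; apply/eqP/val_inj.
  have ci : val c \in iota 0 5 by rewrite mem_iota.
  have /and5P[h1 h2 h3 h4 h5] := allP tab _ ci.
  rewrite !GE // BE // ?(Lz _ _ _ h1) ?(Lz _ _ _ h2) ?(Lz _ _ _ h3) ?(Lz _ _ _ h4) ?(Lz _ _ _ h5).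
  rewrite ?(ne j a) // ?(ne i b) // ?(ne i a) // ?(ne j b) //.
  (* the terms in df_1 and df_4 from Gamma_c14 need the brackets at c = 1 and 4 *)
  have [b0 b3] : zr R (bracketm (dcoframem 0) i j a) = 0 /\ zr R (bracketm (dcoframem 0) i j b) = 0 by [].
  case: (eqVneq c a) => [->|ca].
    rewrite ?(ne j a) // ?(ne i a) // ?(ne a b) // b0.
    move: (expR _) (fder e a f 0) (fder e b f 0) (fder e i f 0) (fder e j f 0) => ? ? ? ? ?.
    by move: (a == a)%:R => ?; ring.
  case: (eqVneq c b) => [->|cb].
    rewrite ?(ne j b) // ?(ne i b) // b3.
    move: (expR _) (fder e a f 0) (fder e b f 0) (fder e i f 0) (fder e j f 0) => ? ? ? ? ?.
    by move: true%:R => ?; ring.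
  rewrite mulr0n; move: (expR _) (fder e a f 0) (fder e b f 0) (fder e c f 0) => ? ? ? ?.
  by move: (fder e i f 0) (fder e j f 0) (zr R _) (i == c)%:R (j == c)%:R => ? ? ? ? ?; ring.
rewrite !GE // BE // ?(Lz 1 0 5 isT)%N ?(Lz 2 5 3 isT)%N ?(Lz 5 0 3 isT)%N.
have -> : zr R (levi_civitam (dcoframem 0) j a c5) = 1 by [].
have -> : zr R (levi_civitam (dcoframem 0) i c5 b) = - 1 by [].
rewrite ?(ne j c5) // ?(ne j a) // ?(ne i b) // ?(ne i c5) // ?(ne i a) // ?(ne j b) // ?(ne c5 b) // ?(ne c5 a) //.
have := expR_gt0 (- f 0).
move: (expR _) (fder e a f 0) (fder e b f 0) (fder e c5 f 0) (fder e i f 0) (fder e j f 0).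
move=> t ? ? ? ? ? t0; rewrite (_ : _ - _ = - (t ^+ 2 / 4)); last by field.
rewrite oppr_eq0 mulf_eq0 invr_eq0 pnatr_eq0 orbF expf_eq0 /= => /eqP h.
by rewrite h ltxx in t0.
Qed.

(** * Assembling the solutions *)

Section Structure.
Variables (R : realType) (e : coframe R 6).
Hypothesis he : structure_equations e.

Lemma two_form_dcoframem (k : nat) :
  two_form (fun i j : 'I_6 => zr R (dcoframem 0 k i j)) = lin (@bas R 6) (two_formm 6 (dcoframem 0 k)).
Proof. by rewrite (@two_formmP R 6 (dcoframem 0 k) 1) ?invr1 ?scale1r // => i j; rewrite mulr1. Qed.

Lemma structure_dcoframe k i j x : dcoframe e k i j x = zr R (dcoframem 0 k i j).
Proof.
apply: dcoframeP => {k i j x} [k i j|k x].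
  have h : all_ord 6 (fun k => all_ord 6 (fun i => all_ord 6 (fun j =>
    (dcoframem 0 k i j =? - dcoframem 0 k j i)%ZZ))) by vm_compute.
  by have /all_ordP/(_ i)/all_ordP/(_ j)/Z.eqb_eq := all_ordP h k.
have [[h1 h2 h5] [h0 h3 h4]] := he x.
rewrite two_form_dcoframem; case: k => [[|[|[|[|[|[|//]]]]]] lt];
  [move: h0|move: h1|move: h2|move: h3|move: h4|move: h5];
  rewrite (_ : inord _ = Ordinal lt); try (by apply/val_inj; rewrite /= inordK);
  move=> ->; rewrite ?ebE // -?(lin_nil (@bas R 6)); apply: feqP; by vm_compute.
Qed.

End Structure.

Lemma dcoframem0_6 i j : ((dcoframem 0 6 i j =? 0) && (dcoframem 0 i 6 j =? 0) && (dcoframem 0 i j 6 =? 0))%ZZ.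
Proof. by rewrite /dcoframem /= !andbF. Qed.

Lemma dcoframem1S k i j : dcoframem 1 k.+1 i.+1 j.+1 = dcoframem 0 k i j.
Proof. by []. Qed.

Lemma dcoframem1_0 i j : ((dcoframem 1 0 i j =? 0) && (dcoframem 1 i 0 j =? 0) && (dcoframem 1 i j 0 =? 0))%ZZ.
Proof. by rewrite /dcoframem /= !andbF. Qed.

Section LinearDilaton.
Variables (R : realType) (n : nat) (e : coframe R n) (k0 : 'I_n) (p : nat -> Z).
Hypothesis frameE : forall (m : 'I_n) x, frame e m x 0 k0 = zr R (p m).

(** phi = x_k0 / 2 *)
Definition dilaton : 'rV[R]_n -> R := fun x => x 0 k0 * 2^-1.

Lemma dilatonE m x : fder e m dilaton x = zr R (p m) / 2.
Proof.
rewrite /fder /dilaton deriveMr; last exact: derivable_coord.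
by rewrite derive_coord_id frameE mulrC.
Qed.

Lemma exp_dilatonE m x k : fder e m (fun y => expR (- 2 * dilaton y) * k) x =
  expR (- 2 * dilaton x) * (- zr R (p m) * k).
Proof.
have E y : - 2 * dilaton y = - (y 0 k0) by rewrite /dilaton; field.
rewrite /fder (_ : (fun y => _) = (fun y : 'rV[R]_n => expR (- (y 0 k0)) * k)).
  by rewrite derive_exp_lin frameE (E x).
by apply/funext => y; rewrite (E y).
Qed.

Lemma dilaton_smooth : smooth dilaton.
Proof. exact: smooth_lin. Qed.

Lemma dilaton_nonconstant : exists x y, dilaton x != dilaton y.
Proof.
exists 0, (delta_mx 0 k0); rewrite /dilaton !mxE !eqxx mul0r mul1r eq_sym.
by rewrite invr_eq0 pnatr_eq0.
Qed.

End LinearDilaton.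

Section LeeForm.
Variables (R : realType) (n o : nat) (e : coframe R n).
Hypothesis dE : forall k i j x, dcoframe e k i j x = zr R (dcoframem o k i j).
Variables (l : seq (N * Z)) (phi : 'rV[R]_n -> R) (p : nat -> Z).
Hypothesis phiE : forall m x, fder e m phi x = zr R (p m) / 2.
Local Notation b := (@bas R n).

(** The form hodge (hodge (d omega) /\ omega) for the constant form omega = l. *)
Definition leem : seq (N * Z) :=
  fnorm (hodgem n (wedgem n (hodgem n (dextm n (dcoframem o) l)) l)).
(** Twice the differential of phi. *)
Definition dphim : seq (N * Z) := flatten [seq [:: (mask1 k, p k)] | k <- iota 0 n].

Lemma leeE x : hodge (wedge (hodge (dext e (fun=> lin b l) x)) (lin b l)) = lin b leem.
Proof. by rewrite (dextE dE) hodgemP wedgemP hodgemP lin_norm. Qed.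

Lemma dfunE x : dfun e phi x = 2^-1 *: lin b dphim.
Proof.
rewrite /dfun /dphim -lin_sum scaler_sumr; apply: eq_bigr => k _.
by rewrite phiE covec_lin !lin_seq1 scale1r scalerA mulrC.
Qed.

(** This form is z times twice the differential of phi, and is closed. *)
Definition lee_check (z : Z) : bool :=
  feq (fscale z dphim) leem && fiszero (dextm n (dcoframem o) leem).

Lemma lee_dfun z (r c : R) x : lee_check z -> r * zr R z = c / 2 ->
  c *: dfun e phi x = r *: hodge (wedge (hodge (dext e (fun=> lin b l) x)) (lin b l)).
Proof.
move=> /andP[/(feqP b) h _] rc.
by rewrite leeE dfunE scalerA -rc -h lin_scale scalerA.
Qed.

Lemma lee_closed z (r : R) x : lee_check z ->
  dext e (fun x => r *: hodge (wedge (hodge (dext e (fun=> lin b l) x)) (lin b l))) x = 0.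
Proof.
move=> /andP[_ /(fiszeroP b) h].
rewrite (_ : (fun x => _) = fun=> r *: lin b leem); last first.
  by apply/funext => y; rewrite leeE.
rewrite (_ : dext e _ x = r *: dext e (fun=> lin b leem) x).
  by rewrite (dextE dE) h scaler0.
rewrite /dext [RHS]scaler_sumr; apply: eq_bigr => k _.
by rewrite !fder_form_cst !wedge0r !add0r contractZ wedgeZr.
Qed.

End LeeForm.

Section Assembly.
Variables (R : realType) (n NN o : nat) (e : coframe R n) (gam : 'I_n -> 'M[R]_NN).
Hypothesis dE : forall k i j x, dcoframe e k i j x = zr R (dcoframem o k i j).
Hypothesis gamP : clifford gam.
Hypothesis NN0 : (0 < NN)%N.
Variables (eqs : seq (seq (nat * nat * Z))) (Q : seq (seq nat * Z)) (kappa : Z).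
Variables (q : seq Z) (D : Z).
Local Notation b := (@bas R n).

(** All that concerns the connection, its torsion and its spinor. *)
Definition geometry_check : bool :=
  [&& upper eqs, holonomy_check n o eqs, bianchi_check n o,
      structure_check n eqs Q kappa & unique_check n o eqs q D].

Lemma spinor_exists (Sm : seq (seq (N * Z))) : geometry_check ->
  all (forms_check n eqs) Sm -> has (indep_check n eqs) Sm ->
  exists eps : spinor_field R n NN,
    (forall mul L, supersymmetric_spinor mul L e gam [seq lin b l | l <- Sm] (@torsion_form R n o) eps) /\
    (forall (phi : 'rV[R]_n -> R) (p : nat -> Z) (U : set 'rV[R]_n), (forall m x, fder e m phi x = zr R (p m) / 2) ->
       dilatino_check n o p Q -> dilatino_on gam U e (@torsion_form R n o) phi eps).
Proof.
move=> /and5P[up hol bi str un] fc ic.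
have /and3P[_ _ tr] := str.
have [v Qv] := spinor_ex gamP NN0 tr.
exists (eps0 gam Q v); split=> [mul L|phi p U phiE dc].
  exact: (supersymmetric_spinorP dE gamP up Qv _ _ erefl hol str fc ic).
exact: (dilatinoP gamP phiE _ dc).
Qed.

Lemma bianchi1_ex : geometry_check ->
  exists2 alpha : R, 0 < alpha &
    bianchi1 e (@torsion_form R n o) (torsion_connection e (@torsion_form R n o)) alpha.
Proof.
move=> /and5P[_ _ bi _ _]; exists 4^-1; last exact: (bianchi1P dE bi).
by rewrite invr_gt0.
Qed.

Lemma bianchi2_ex : geometry_check ->
  exists2 alpha : R, 0 < alpha &
    bianchi2 e (@torsion_form R n o) (torsion_connection e (@torsion_form R n o)) alpha.
Proof.
move=> /and5P[_ _ bi _ _]; exists 6^-1; last exact: (bianchi2P dE bi).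
by rewrite invr_gt0.
Qed.

Lemma skew_torsion_unique l : geometry_check -> forms_check n eqs l -> indep_check n eqs l ->
  unique (skew_torsion e (lin b l)) (@torsion_form R n o).
Proof.
move=> /and5P[up hol bi str un] fc ic.
have /and3P[_ t3 _] := un.
split; last first.
  by move=> T [_ T3 Tp]; exact: (torsion_unique dE up hol fc ic un T3 Tp).
split; [by move=> I; exact: smooth_cst | by move=> x; exact: torsion_form_is_form |].
exact: (parallel_cst dE up hol fc).
Qed.

Variables (mul : 'rV[R]_n -> 'rV[R]_n -> 'rV[R]_n) (one : 'rV[R]_n).
Variables (inv : 'rV[R]_n -> 'rV[R]_n).
Hypothesis e_inv : translation_invariant mul setT e.
Variables (l : seq (N * Z)) (k0 : 'I_n) (p : nat -> Z) (c r : R) (z : Z).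
Hypothesis frameE : forall (m : 'I_n) x, frame e m x 0 k0 = zr R (p m).

(** All that is needed for a solution of the supersymmetry equations and of the
    equations of motion; the last conjunct says that the flux is not zero. *)
Definition solution_check : bool :=
  [&& geometry_check, forms_check n eqs l && indep_check n eqs l,
      dilatino_check n o p Q, motion_check n o p, lee_check n o l p z &
      let t := torsionm n o in let I := (head (0%num, 0%ZZ) t).1 in
      [&& below n t, (I <? 2 ^ N.of_nat n)%num & negb (coef I t =? 0)%ZZ]].

Lemma solution_torsion : solution_check -> unique (skew_torsion e (lin b l)) (@torsion_form R n o).
Proof. by case/and3P=> geo /andP[fc ic] _; exact: skew_torsion_unique. Qed.

Hypothesis rc : r * zr R z = c / 2.
Let lee : form_field R n :=
  fun x => r *: hodge (wedge (hodge (dext e (fun=> lin b l) x)) (lin b l)).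

Lemma descends_const L : descends mul L e (@torsion_form R n o).
Proof. by split=> // m _ x v; exact: e_inv. Qed.

Lemma global_solutionP L : solution_check -> discrete_subgroup mul one inv L ->
  (forall m x, L m -> mul m x 0 k0 = x 0 k0) ->
  global_solution mul one inv L e gam [:: lin b l] (@torsion_form R n o) lee c.
Proof.
move=> /and5P[geo /andP[fc ic] di mo /andP[le /and3P[tb tI tc]]] dL Lk.
have /and5P[up hol bi str un] := geo.
split=> //; split; first exact: descends_const.
split.
  exists 0; apply/eqP => t0; move: tc; rewrite -(zr_eq0 R).
  by rewrite -(lin_coefE R tb tI) -/(@torsion_form R n o 0) t0 ffunE eqxx.
split; last exact: bianchi2_ex.
have fcs : all (forms_check n eqs) [:: l] by rewrite /= fc.
have ics : has (indep_check n eqs) [:: l] by rewrite /= ic.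
have [eps [susy dil]] := spinor_exists (Sm := [:: l]) geo fcs ics.
have phiE := dilatonE frameE.
exists (dilaton k0), eps; split.
- split; first exact: dilaton_smooth.
  by move=> m Lm x; rewrite /dilaton Lk.
- by move=> x; exact: (lee_dfun dE phiE x le rc).
- exact: dilaton_nonconstant.
- split; first exact: susy.
  exact: (dil _ p).
- exists 4^-1; first by rewrite invr_gt0.
  split; first exact: (bianchi1P dE bi).
  exact: (motionP dE phiE (exp_dilatonE frameE) mo).
Qed.

Lemma compact_local_solutionP L : solution_check -> uniform_lattice mul one inv L ->
  compact_local_solution mul one inv L e gam [:: lin b l] (@torsion_form R n o) lee c.
Proof.
move=> /and5P[geo /andP[fc ic] di mo /andP[le /and3P[tb tI tc]]] uL.
have /and5P[up hol bi str un] := geo.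
split=> //; split; first exact: descends_const.
split; first by move=> x; exact: (lee_closed dE r x le).
have phiE := dilatonE frameE.
split; last split.
- have fcs : all (forms_check n eqs) [:: l] by rewrite /= fc.
  have ics : has (indep_check n eqs) [:: l] by rewrite /= ic.
  have [eps [susy dil]] := spinor_exists (Sm := [:: l]) geo fcs ics.
  exists eps; split; first exact: susy.
  move=> x; exists setT, (dilaton k0); split=> //.
  + exact: openT.
  + by move=> s y _; exact: dilaton_smooth.
  + by move=> y _; exact: (lee_dfun dE phiE y le rc).
  + exact: (dil _ p).
- exact: bianchi1_ex.
- exact: bianchi2_ex.
Qed.

End Assembly.

(** The dilaton is half the coordinate along the first line added. *)
Definition dphi7 (m : nat) : Z := if m == 6 then 1%ZZ else 0%ZZ.
Definition dphi8 (m : nat) : Z := if m == 7 then 1%ZZ else 0%ZZ.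

Lemma solution_check7 :
  solution_check 7 0 eqs7 Q7 (-16) [:: 84; -17; 1]%ZZ 108 omega7m dphi7 (-3).
Proof. by vm_compute. Qed.

Lemma solution_check8 :
  solution_check 8 1 eqs8 Q8 (-32) [:: 11; -1]%ZZ 18 Phi8m dphi8 (-6).
Proof. by vm_compute. Qed.

Lemma geometry_check6 : geometry_check 6 0 eqs6 Q6 (-16) [:: 44; -12; 1]%ZZ 48.
Proof. by vm_compute. Qed.

Lemma forms_check6 : all (forms_check 6 eqs6) [:: F6m; Pplusm; Pminusm].
Proof. by vm_compute. Qed.

Lemma indep_check6 : indep_check 6 eqs6 Pplusm.
Proof. by vm_compute. Qed.

Lemma has_indep6 : has (indep_check 6 eqs6) [:: F6m; Pplusm; Pminusm].
Proof.
by apply/hasP; exists Pplusm; [rewrite !in_cons eqxx orbT | exact: indep_check6].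
Qed.

(** nabla J = 0. *)
Definition endo_check : bool :=
  let g := connection_table 6 0 1 in
  all_ord 6 (fun i => all_ord 6 (fun j => all_ord 6 (fun k =>
    (zsum 6 (fun l => get3 g i l j * compm 6 F6m [:: l; k]
                    - get3 g i k l * compm 6 F6m [:: j; l]) =? 0)%ZZ))).

Lemma endo_check6 : endo_check. Proof. by vm_compute. Qed.

Section Dimension6.
Variables (R : realType) (e : coframe R 6).
Hypothesis dE : forall k i j x, dcoframe e k i j x = zr R (dcoframem 0 k i j).

Lemma SU3_torsion_unique : unique (SU3_torsion e) (torsion_form 0).
Proof.
have /and5P[up hol bi str un] := geometry_check6.
have /and3P[_ t3 _] := un.
have /and4P[fF fp fm _] := forms_check6.
split; last first.
  move=> T [[_ T3] _ _ Tp _]; rewrite PplusE in Tp.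
  exact: (torsion_unique dE up hol fp indep_check6 un T3 Tp).
split.
- split; first by move=> I; exact: smooth_cst.
  by move=> x; exact: torsion_form_is_form.
- move=> i j k x; have [Aa _] := holonomyP dE hol i x.
  by rewrite (Aa j k) addNr.
- move=> i j k x; rewrite fder_cst add0r.
  rewrite (zr_sum_div (D := 2) (f := fun l => (get3 (connection_table 6 0 1) i l j * compm 6 F6m [:: l; val k]
     - get3 (connection_table 6 0 1) i k l * compm 6 F6m [:: val j; l])%ZZ)).
    have /all_ordP/(_ i)/all_ordP/(_ j)/all_ordP/(_ k)/Z.eqb_eq := endo_check6.
    by move=> ->; rewrite zr0 mul0r.
  by move=> l; rewrite !(AE dE) F6E !compmP zrB !zrM; field.
- by rewrite PplusE; exact: (parallel_cst dE up hol fp).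
- by rewrite PminusE; exact: (parallel_cst dE up hol fm).
Qed.

End Dimension6.

Lemma frame7 (R : realType) (e : coframe R 6) : (forall x, e x \in unitmx) ->
  forall (m : 'I_7) x, frame (coframe_right e) m x 0 (rshift 6 (0 : 'I_1)) = zr R (dphi7 m).
Proof.
move=> eU m x; have [k ->|k ->] := split_ordP (m : 'I_(6 + 1)).
  rewrite frame_right // row_mxEr mxE /dphi7 /= ifF //.
  by apply/negbTE; rewrite neq_ltn ltn_ord.
by rewrite frame_right1 // row_mxEr mxE eqxx /dphi7 /= (ord1 k).
Qed.

Lemma frame8 (R : realType) (e : coframe R 6) : (forall x, e x \in unitmx) ->
  forall (m : 'I_8) x, frame (coframe_left (coframe_right e)) m x 0
    (rshift 1 (rshift 6 (0 : 'I_1))) = zr R (dphi8 m).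
Proof.
move=> eU m x; have eU7 := coframe_right_unit eU.
have [k ->|k ->] := split_ordP (m : 'I_(1 + 7)).
  by rewrite (frame_left1 eU7) row_mxEr mxE /dphi8 /= (ord1 k).
rewrite (frame_left eU7) row_mxEr (frame7 eU) /dphi8 /dphi7 /=.
by rewrite add1n.
Qed.

Theorem theorem6p4 (R : realType)
  (mul : 'rV[R]_6 -> 'rV[R]_6 -> 'rV[R]_6) (one : 'rV[R]_6)
  (inv : 'rV[R]_6 -> 'rV[R]_6) (e : coframe R 6)
  (gam6 : 'I_6 -> 'M[R]_8) (gam7 : 'I_7 -> 'M[R]_8) (gam8 : 'I_8 -> 'M[R]_16)
  (hG : lie_group mul one inv)
  (he : smooth_coframe e)
  (hinv : translation_invariant mul setT e)
  (hde : structure_equations e)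
  (hgam6 : clifford gam6) (hgam7 : clifford gam7) (hgam8 : clifford gam8) :
  let mul7 := mul_right mul in
  let one7 := one_right one in
  let inv7 := inv_right inv in
  let e7 := coframe_right e in
  let mul8 := mul_left mul7 in
  let one8 := one_left one7 in
  let inv8 := inv_left inv7 in
  let e8 := coframe_left e7 in
  [/\ (* dimension 6 *)
      ~ conformally_flat e /\
      (exists T : form_field R 6, unique (SU3_torsion e) T /\
        let A := torsion_connection e T in
        [/\ exists eps : spinor_field R 6 8,
              supersymmetric_spinor mul [set one] e gam6
                [:: F6 R; Psi_plus R; Psi_minus R] T eps,
            exists2 alpha : R, 0 < alpha & bianchi1 e T A alpha &
            exists2 alpha : R, 0 < alpha & bianchi2 e T A alpha]),
      (* dimension 7 *)
      omega7 R = G2_model R /\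
      (exists T : form_field R 7, unique (skew_torsion e7 (omega7 R)) T /\
        (* G x R *)
        global_solution mul7 one7 inv7 [set one7] e7 gam7 [:: omega7 R]
          T (lee7 e7 (omega7 R)) 2 /\
        (* Nil^6 x S^1 *)
        (forall (Gamma : set 'rV[R]_6) (l : R),
          uniform_lattice mul one inv Gamma -> 0 < l ->
          compact_local_solution mul7 one7 inv7
            (lattice_right Gamma (multiples l)) e7 gam7 [:: omega7 R]
            T (lee7 e7 (omega7 R)) 2)) &
      (* dimension 8 *)
      (exists T : form_field R 8, unique (skew_torsion e8 (Phi8 R)) T /\
        (forall Gamma : set 'rV[R]_6, uniform_lattice mul one inv Gamma ->
          (* Nil^6 x R x R *)
          global_solution mul8 one8 inv8
            (lattice_left [set 0] (lattice_right Gamma [set 0]))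
            e8 gam8 [:: Phi8 R] T (lee8 e8 (Phi8 R)) (12 / 7) /\
          (* Nil^6 x S^1 x S^1 *)
          (forall l0 l7 : R, 0 < l0 -> 0 < l7 ->
            compact_local_solution mul8 one8 inv8
              (lattice_left (multiples l0)
                 (lattice_right Gamma (multiples l7)))
              e8 gam8 [:: Phi8 R] T (lee8 e8 (Phi8 R)) (12 / 7))))].

Proof.
have G0 := lie_group_laws hG; have eU := he.2.
have tD := lie_group_derivable hG; have tC := lie_group_continuous hG.
have dE6 := structure_dcoframe hde.
have dE7 : forall k i j x, dcoframe (coframe_right e) k i j x = zr R (dcoframem 0 k i j).
  exact: (dcoframe_right eU dE6 dcoframem0_6).
have eU7 := coframe_right_unit eU.
have dE8 : forall k i j x, dcoframe (coframe_left (coframe_right e)) k i j x = zr R (dcoframem 1 k i j).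
  exact: (dcoframe_left eU7 dE7 dcoframem1S dcoframem1_0).
have inv7 := invariant_right tD hinv.
have inv8 := invariant_left (derivable_right tD) inv7.
have G7 := group_right G0; have G8 := group_left G7.
have coco L : uniform_lattice mul one inv L -> cocompact mul L.
  by case: G0 => mA m1 _ mV [dL cL]; exact: (compact_cocompact mA m1 mV dL tC cL).
move=> mul7 one7 inv7' e7 mul8 one8 inv8' e8; split.
- split; first exact: (not_conformally_flat he dE6).
  exists (torsion_form 0); split; first exact: SU3_torsion_unique.
  split.
  + have [//|eps [susy _]] := spinor_exists dE6 hgam6 _ geometry_check6 forms_check6 has_indep6.
    exists eps; rewrite F6E PplusE PminusE; exact: susy.
  + exact: (bianchi1_ex dE6 geometry_check6).
  + exact: (bianchi2_ex dE6 geometry_check6).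
- split; first exact: omega7_G2.
  have rc : - 3^-1 * zr R (-3) = 2 / 2 by have -> : zr R (-3) = - 3 by []; field.
  exists (torsion_form 0); rewrite omega7E; split; first exact: (solution_torsion dE7 solution_check7).
  split.
    apply: (global_solutionP dE7 hgam7 _ inv7 (frame7 eU) rc solution_check7) => //.
      exact: trivial_discrete.
    by move=> m x ->; case: G7 => _ -> _ _.
  move=> Gamma l uG l0.
  apply: (compact_local_solutionP dE7 hgam7 _ inv7 (frame7 eU) rc solution_check7) => //.
  apply: uniform_latticeP => //.
    by apply: discrete_right; [case: uG | exact: discrete_multiples].
  exact: (cocompact_right l0 (coco _ uG)).
- have rc : - 7^-1 * zr R (-6) = 12 / 7 / 2 by have -> : zr R (-6) = - 6 by []; field.
  exists (torsion_form 1); rewrite Phi8E; split; first exact: (solution_torsion dE8 solution_check8).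
  move=> Gamma uG; have [dG _] := uG; split.
    apply: (global_solutionP dE8 hgam8 _ inv8 (frame8 eU) rc solution_check8) => //.
      exact: (discrete_left (discrete_right dG (discrete_line0 R)) (discrete_line0 R)).
    move=> m x [_ [_ m0]]; rewrite /mul8 /mul_left row_mxEr /mul7 /mul_right row_mxEr.
    by rewrite mxE [rsubmx (rsubmx m) 0 0]m0 add0r !mxE.
  move=> l0 l7 l00 l70.
  apply: (compact_local_solutionP dE8 hgam8 _ inv8 (frame8 eU) rc solution_check8) => //.
  apply: uniform_latticeP => //.
    exact: (discrete_left (discrete_right dG (discrete_multiples l70))
      (discrete_multiples l00)).
  exact: (cocompact_left l00 (cocompact_right l70 (coco _ uG))).
Qed.
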